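(* Let $d\ge3$, $T\ge1$ be integers, $L>0$, $p=q=1$, and $\Theta=\{x\in\mathbb{R}^d:x\ge0,\ \|x\|_1=1\}$. Let $V:\Theta\to\mathbb{R}$, $V(x)=\sum_{j=1}^dx_j\log(x_j)$ (with $0\log0=0$). Suppose each $f_t:\mathbb{R}^d\to\mathbb{R}$, $t\ge1$, is convex and satisfies $|f_t(x)-f_t(x')|\le L\|x-x'\|_1$ for all $x,x'\in\mathbb{R}^d$, and that (canceling noise) $\xi_t'=\xi_t''$ almost surely for all $t\ge1$. Run the zero-order $\ell_1$-randomized online dual averaging algorithm (defined in the context) with this $V$ and with constant parameters $\eta_t=\eta$, $h_t=h$, where, with $R=\sqrt{\log d}$, $$\eta=\frac{R}{(\sqrt6+\sqrt{12})L}\sqrt{\frac{1}{dT}}\qquad\text{and any}\qquad 0<h\le\frac{7R}{100\,\mathrm{b}_1(d)\sqrt T}\,d^{\frac12},\qquad \mathrm{b}_1(d)=\frac{d}{d+1}.$$ Then, for any $x\in\Theta$, $$\mathbb{E}\left[\sum_{t=1}^T\big(f_t(x_t)-f_t(x)\big)\right]\le11.9\cdot L\sqrt{dT\log(d)}.$$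
   Context: Notation: $\log$ is the natural logarithm; $\mathrm{sign}$ is applied componentwise, with value $1$ at $0$; $\partial B_1^d=\{x\in\mathbb{R}^d:\|x\|_1=1\}$. ''Uniformly distributed on $\partial B_1^d$'' means distributed according to the normalized surface measure. Algorithm (zero-order $\ell_1$-randomized online dual averaging). An adversary fixes functions $f_1,f_2,\dots:\mathbb{R}^d\to\mathbb{R}$. Inputs: a convex function $V:\Theta\to\mathbb{R}$, step sizes $\eta_t>0$, discretization parameters $h_t>0$. Generate independent vectors $\zeta_1,\zeta_2,\dots$ uniformly distributed on $\partial B_1^d$, and set $z_1=0$. For $t=1,2,\dots$: - $x_t=\arg\max_{x\in\Theta}\{\eta_t\langle z_t,x\rangle-V(x)\}$; - query $y_t'=f_t(x_t+h_t\zeta_t)+\xi_t'$ and $y_t''=f_t(x_t-h_t\zeta_t)+\xi_t''$, where $\xi_t',\xi_t''\in\mathbb{R}$ are noise variables (random or not); - $g_t=\frac{d}{2h_t}(y_t'-y_t'')\,\mathrm{sign}(\zeta_t)$; - $z_{t+1}=z_t-g_t$. *)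

(* Defs.v *)
From HB Require Import structures.
From mathcomp Require Export all_boot all_order all_algebra.
From mathcomp Require Export all_classical all_reals all_analysis.

Set Implicit Arguments.
Unset Strict Implicit.
Unset Printing Implicit Defensive.

Import Order.TTheory GRing.Theory Num.Theory.
Import numFieldNormedType.Exports.

Local Open Scope classical_set_scope.
Local Open Scope ring_scope.

(* Borel sigma-algebra of R^n, generated by the coordinates. *)
Definition rV_display : measure_display.
Proof. exact: default_measure_display. Qed.

Section measurable_rV.
Variables (R : realType) (n : nat).

Let coord (j : 'I_n) (v : 'rV[R]_n) : measurableTypeR R := v ord0 j.

Let rV_set0 : g_sigma_preimage coord set0.
Proof. exact: sigma_algebra0. Qed.

Let rV_setC A : g_sigma_preimage coord A -> g_sigma_preimage coord (~` A).
Proof. exact: sigma_algebraC. Qed.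

Let rV_bigcup (F : (set 'rV[R]_n)^nat) :
  (forall i, g_sigma_preimage coord (F i)) ->
  g_sigma_preimage coord (\bigcup_i (F i)).
Proof. exact: sigma_algebra_bigcup. Qed.

#[warnings="-redundant-canonical-projection"]
HB.instance Definition _ := @isMeasurable.Build rV_display
  'rV[R]_n (g_sigma_preimage coord) rV_set0 rV_setC rV_bigcup.

#[warnings="-redundant-canonical-projection"]
End measurable_rV.

Fixpoint lebesgue_rV (R : realType) (n : nat) : set 'rV[R]_n -> \bar R :=
  match n return set 'rV[R]_n -> \bar R with
  | 0%N => \d_(0 : 'rV[R]_0)
  | m.+1 => pushforward (@lebesgue_measure R \x @lebesgue_rV R m)%E
      (fun p : measurableTypeR R * 'rV[R]_m =>
         (row_mx (p.1 : R)%:M p.2 : 'rV[R]_(1 + m)))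
  end.

Section l1_geometry.
Variable R : realType.

Definition dotp (d : nat) (u v : 'rV[R]_d) : R :=
  \sum_(j < d) u ord0 j * v ord0 j.

(* The norm [`| v |] of the library on 'rV[R]_d is the sup norm. *)
Definition l1norm (d : nat) (v : 'rV[R]_d) : R := \sum_(j < d) `|v ord0 j|.

Definition l1sphere (d : nat) : set 'rV[R]_d := [set v : 'rV[R]_d | l1norm v = 1].

(* [Num.sg] does not fit here: it is 0 at 0. *)
Definition sign_rV (d : nat) (v : 'rV[R]_d) : 'rV[R]_d :=
  \row_j (if 0 <= v ord0 j then 1 else -1).

Definition simplex (d : nat) : set 'rV[R]_d :=
  [set v : 'rV[R]_d | (forall j, 0 <= v ord0 j) /\ l1norm v = 1].

(* The library has [ln 0 = 0]; in any case [0 * ln 0 = 0]. *)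
Definition negentropy (d : nat) (v : 'rV[R]_d) : R :=
  \sum_(j < d) v ord0 j * ln (v ord0 j).

(* The point (u_0, ..., u_(d-2), y) of R^d. *)
Definition rcons_rV (d : nat) (u : 'rV[R]_d.-1) (y : R) : 'rV[R]_d :=
  \row_(j < d) oapp (fun i : 'I_d.-1 => u ord0 i) y (insub (j : nat)).

(* Surface measure of the graph of [phi] over [D], in R^d: the area element is
   sqrt (1 + |grad phi|^2) du. *)
Definition graph_area (d : nat) (phi : 'rV[R]_d.-1 -> R) (D : set 'rV[R]_d.-1)
    (A : set 'rV[R]_d) : \bar R :=
  (\int[@lebesgue_rV R d.-1]_(u in D `&` [set u | A (rcons_rV u (phi u))])
    (Num.sqrt (1 + \sum_(j < d.-1) ('D_(delta_mx ord0 j) phi u) ^+ 2))%:E)%E.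

(* The l1 sphere is, up to its equator [y = 0], the union of the two graphs
   y = 1 - |u|_1 and y = |u|_1 - 1 over the open unit l1 ball of R^(d-1). The
   equator has dimension d - 2, hence zero area; so have the points where phi is
   not differentiable. *)
Definition l1sphere_area (d : nat) (A : set 'rV[R]_d) : \bar R :=
  let B := [set u : 'rV[R]_d.-1 | l1norm u < 1] in
  (graph_area (fun u => (1 - l1norm u)%R) B A +
   graph_area (fun u => (l1norm u - 1)%R) B A)%E.

Definition uniform_l1sphere (d : nat) (mu : set 'rV[R]_d -> \bar R) : Prop :=
  forall A : set 'rV[R]_d, measurable A ->
    mu A = (fine (l1sphere_area A) / fine (l1sphere_area (@l1sphere d)))%:E.

End l1_geometry.

Definition mutually_independent (d d' : measure_display)
    (Omega : measurableType d) (E : measurableType d') (R : realType)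
    (P : probability Omega R) (I : set nat) (X : nat -> {RV P >-> E}) : Prop :=
  forall (s : seq nat) (A : nat -> set E), uniq s ->
    (forall i, i \in s -> I i /\ measurable (A i)) ->
    P (\bigcap_(i in [set` s]) (X i @^-1` A i)) =
    (\prod_(i <- s) P (X i @^-1` A i))%E.

Section dual_averaging.
Variables (R : realType) (d : nat).

Definition is_argmax (D : set 'rV[R]_d) (F : 'rV[R]_d -> R) (x : 'rV[R]_d) :=
  D x /\ forall y, D y -> F y <= F x.

Definition grad_estimate (f : 'rV[R]_d -> R) (h : R) (x zeta : 'rV[R]_d)
    (xi' xi'' : R) : 'rV[R]_d :=
  let y' := f (x + h *: zeta) + xi' in
  let y'' := f (x - h *: zeta) + xi'' in
  (d%:R / (2 * h) * (y' - y'')) *: sign_rV zeta.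

(* One trajectory, for given realizations of the randomization and of the
   noise. Rounds are numbered from 1; index 0 of the sequences is unused. Only
   the values of [V] on [Theta] matter. *)
Definition dual_averaging_run (Theta : set 'rV[R]_d) (V : 'rV[R]_d -> R)
    (eta h : nat -> R) (f : nat -> 'rV[R]_d -> R) (zeta : nat -> 'rV[R]_d)
    (xi' xi'' : nat -> R) (z x : nat -> 'rV[R]_d) : Prop :=
  z 1%N = 0 /\
  forall t, (1 <= t)%N ->
    is_argmax Theta (fun y => eta t * dotp (z t) y - V y) (x t) /\
    z t.+1 = z t - grad_estimate (f t) (h t) (x t) (zeta t) (xi' t) (xi'' t).

End dual_averaging.

(* Main.v *)
Require Import Defs.
From mathcomp Require Import unstable measurable_realfun ring lra.
From HB Require Import structures.
Import Order.TTheory GRing.Theory Num.Theory.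
Import numFieldNormedType.Exports.
Local Open Scope classical_set_scope.
Local Open Scope ring_scope.

Set Implicit Arguments.
Unset Strict Implicit.
Unset Printing Implicit Defensive.

(** The argmax defining [x_t] is attained only at the softmax of [eta * z_t]
([argmax_softmax]), so the algorithm is the exponential-weights algorithm fed
with the gradient estimates [g_t = c_t * sign zeta_t], where [c_t] is the
two-point difference quotient. Almost surely the noise cancels in [c_t], and the
expected regret has to be bounded by three independent estimates.

Regret of exponential weights, pathwise. With the potential
[ln (\sum_j exp (eta * z_j))] and the fact that all entries of [g_t] have the
same absolute value [|c_t|], a Hoeffding-type inequality gives
[\sum_t <g_t, x_t - u> <= ln d / eta + 4 * eta * \sum_t c_t ^ 2]
([exponential_weights_regret]).

Second moment of the estimate. For a function [F] that is K-Lipschitz for the l1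
norm, [F zeta - F (- zeta)] has second moment at most [32 K^2 / (d + 1)] under
the uniform law of the l1 sphere ([sphere_mean_odd_sqr]). This is a Poincare
inequality, proved by induction on the dimension: the first coordinate [s] of a
uniform point has density proportional to [(1 - |s|) ^ (d - 2)], the rest is
uniform on a sphere of radius [1 - |s|], and the law of total variance
reproduces the bound with the same constant ([sphere_mean_variance]).

Bias of the estimate. For [F] convex and K-Lipschitz, the symmetric difference
estimator at 0 satisfies
[d / 2 * E (<sign zeta, w> * (F zeta - F (- zeta))) <= F w - F 0 + K d / (d + 1)]
([sphere_gradient]). By the divergence theorem the left-hand side is the
derivative along [w] of the mean of [F] over the unit l1 ball, and convexity
compares that derivative with an increment of [F]. The divergence theorem is
replaced here by a limit: the indicator of the ball is smoothed into a ramp of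
width [delta] in the radius, translating the ramp by [e * w] and differentiating
at [e = 0] under the integral gives the inequality for the ramp
([ramp_gradient_le]), and polar coordinates for the l1 norm ([polar]) turn it
into the inequality on the sphere as [delta] tends to 0.

The last two estimates are about a uniform direction and a fixed point. They
apply conditionally because [x_t] depends only on [zeta_1, ..., zeta_(t-1)],
which are independent of [zeta_t] ([past_integral_le]). The choice of [eta]
gives [ln d / eta] and [32 eta d T L^2] the same order, and with
[s = sqrt 6 + sqrt 12] the total is at most
[(s + 32 / s + 7 / 100) * L * sqrt (d T ln d)], where the factor is below [11.9]
([regret_constant]).

The surface measure enters through one fact: on both graphs that form the l1
sphere the area element is the constant [sqrt d], so that the normalized surface
measure is the normalized Lebesgue measure of the projection ([l1sphere_areaE]).
In the sequel it is described by [cone_measure], which omits that constant. *)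

(** * The Borel structure and the Lebesgue measure of R^n *)

Section measurability_rV.
Context {R : realType}.

Lemma g_sigma_preimage_sub n (T : Type) (f : 'I_n -> T -> R) (S : set (set T)) :
  sigma_algebra setT S ->
  (forall j A, measurable A -> S (f j @^-1` A)) -> g_sigma_preimage f `<=` S.
Proof.
move=> sS H; apply: smallest_sub => //.
case: n f H => [|n] f H; first by rewrite big_ord0.
rewrite -bigcup_mkord_ord; apply: bigcup_sub => i Ii.
by move=> A [B mB <-]; rewrite setTI; exact: H.
Qed.

Lemma measurable_coord n (j : 'I_n) :
  measurable_fun setT (fun v : 'rV[R]_n => v ord0 j).
Proof.
move=> _ A mA; apply: sub_sigma_algebra.
case: n j => [[]//|n] j.
rewrite -bigcup_mkord_ord; exists j; first exact: ltn_ord.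
by exists A => //; rewrite inord_val.
Qed.

Lemma measurable_fun_rV d (T : measurableType d) n (f : T -> 'rV[R]_n) :
  (forall j, measurable_fun setT (fun t => f t ord0 j)) -> measurable_fun setT f.
Proof.
move=> mf _ A mA; rewrite setTI.
have : [set B | measurable (f @^-1` B)] A.
  move: A mA; apply: g_sigma_preimage_sub.
    split => //=.
    - by rewrite preimage_set0.
    - by move=> B mB; rewrite setTD preimage_setC; exact: measurableC.
    - by move=> F mF; rewrite preimage_bigcup; exact: bigcupT_measurable.
  move=> j B mB /=; rewrite -[X in measurable X]setTI; exact: mf.
by [].
Qed.

(** Splitting off the first coordinate follows the recursion that defines [lebesgue_rV]. *)
Definition cons_rV n (s : R) (v : 'rV[R]_n) : 'rV[R]_n.+1 :=
  (row_mx s%:M v : 'rV[R]_(1 + n)).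
Definition behead_rV n (v : 'rV[R]_n.+1) : 'rV[R]_n := \row_j v ord0 (lift ord0 j).

Lemma cons_rV0 n s (v : 'rV[R]_n) : cons_rV s v ord0 ord0 = s.
Proof.
rewrite /cons_rV; have -> : (ord0 : 'I_n.+1) = lshift n (ord0 : 'I_1) by exact: val_inj.
by rewrite (@row_mxEl R 1 1 n) mxE.
Qed.

Lemma cons_rVS n s (v : 'rV[R]_n) (j : 'I_n) : cons_rV s v ord0 (lift ord0 j) = v ord0 j.
Proof.
rewrite /cons_rV; have -> : (lift ord0 j : 'I_n.+1) = rshift 1 j by exact: val_inj.
by rewrite (@row_mxEr R 1 1 n).
Qed.

Lemma behead_cons_rV n s (v : 'rV[R]_n) : behead_rV (cons_rV s v) = v.
Proof. by apply/rowP => j; rewrite mxE cons_rVS. Qed.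

Lemma cons_behead_rV n (v : 'rV[R]_n.+1) : cons_rV (v ord0 ord0) (behead_rV v) = v.
Proof.
apply/rowP => j; case: (unliftP ord0 j) => [k ->|->]; last by rewrite cons_rV0.
by rewrite cons_rVS mxE.
Qed.

Lemma cons_rVD n s t (u v : 'rV[R]_n) : cons_rV s u + cons_rV t v = cons_rV (s + t) (u + v).
Proof.
by apply/rowP => j; rewrite mxE; case: (unliftP ord0 j) => [k ->|->];
  rewrite ?cons_rVS ?cons_rV0 ?mxE.
Qed.

Lemma cons_rVZ n a s (u : 'rV[R]_n) : a *: cons_rV s u = cons_rV (a * s) (a *: u).
Proof.
by apply/rowP => j; rewrite mxE; case: (unliftP ord0 j) => [k ->|->];
  rewrite ?cons_rVS ?cons_rV0 ?mxE.
Qed.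

Lemma measurable_cons_rV n :
  measurable_fun setT (fun p : measurableTypeR R * 'rV[R]_n => cons_rV p.1 p.2).
Proof.
apply: measurable_fun_rV => j.
case: (unliftP ord0 j) => [k ->|->].
  under eq_fun do rewrite cons_rVS.
  exact: (measurableT_comp (measurable_coord k) measurable_snd).
by under eq_fun do rewrite cons_rV0; exact: measurable_fst.
Qed.

Lemma measurable_behead_rV n : measurable_fun setT (@behead_rV n).
Proof.
apply: measurable_fun_rV => j; under eq_fun do rewrite mxE; exact: measurable_coord.
Qed.

Lemma lebesgue_rVS n : @lebesgue_rV R n.+1 =
  pushforward (@lebesgue_measure R \x @lebesgue_rV R n)%E
    (fun p : measurableTypeR R * 'rV[R]_n => cons_rV p.1 p.2).
Proof. by []. Qed.

(** A set function that has the properties of a measure need not carry the structure of one; this packs it. *)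
Lemma sigma_finite_measure_of d (T : measurableType d) (m : set T -> \bar R) :
  m set0 = 0%E -> (forall A, (0 <= m A)%E) -> semi_sigma_additive m ->
  sigma_finite setT m -> exists mu : {sigma_finite_measure set T -> \bar R}, m = mu.
Proof.
move=> m0 mge0 msig mfin.
pose m1 := isMeasure.Build _ _ _ m m0 mge0 msig.
pose mu : {measure set T -> \bar R} := HB.pack m m1.
pose m2 := @Measure_isSigmaFinite.Build _ _ _ mu mfin.
pose m' : {sigma_finite_measure set T -> \bar R} := HB.pack m (Measure.on mu) m2.
by exists m'.
Qed.

(** The instance has to be built along the recursion: at each dimension the product
with the one-dimensional measure is a measure because the previous one is sigma-finite. *)
Lemma lebesgue_rV_measure n : exists mu : {sigma_finite_measure set 'rV[R]_n -> \bar R},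
  @lebesgue_rV R n = mu.
Proof.
elim: n => [|n [mu IH]].
  by exists (\d_(0 : 'rV[R]_0)).
rewrite lebesgue_rVS IH.
pose c (p : measurableTypeR R * 'rV[R]_n) := cons_rV p.1 p.2.
have mc : measurable_fun setT c := @measurable_cons_rV n.
pose m := pushforward (@lebesgue_measure R \x mu)%E c.
have m0 : m set0 = 0%E by rewrite /m /pushforward preimage_set0 measure0.
have mge0 A : (0 <= m A)%E by exact: integral_ge0.
have msig : semi_sigma_additive m.
  exact: (@measure_semi_sigma_additive _ _ _ (pushforward (lebesgue_measure \x mu)%E c)).
have mfin : sigma_finite setT m.
  have /sigma_finiteP[F [TF ndF Foo]] := sigma_finiteT (@lebesgue_measure R).
  have /sigma_finiteP[G [TG ndG Goo]] := sigma_finiteT mu.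
  exists (fun k => [set v : 'rV[R]_n.+1 | F k (v ord0 ord0) /\ G k (behead_rV v)]).
    apply/esym; rewrite -subTset => v _.
    have [i _ Fi] : (\bigcup_i F i) (v ord0 ord0) by rewrite -TF.
    have [j _ Gj] : (\bigcup_i G i) (behead_rV v) by rewrite -TG.
    exists (maxn i j) => //; split.
      by move/subsetPset : (ndF _ _ (leq_maxl i j)); exact.
    by move/subsetPset : (ndG _ _ (leq_maxr i j)); exact.
  move=> k; have [mFk Fkoo] := Foo k; have [mGk Gkoo] := Goo k; split.
    apply: measurableI.
      by rewrite -[X in measurable X]setTI; exact: measurable_coord.
    by rewrite -[X in measurable X]setTI; exact: measurable_behead_rV.
  rewrite /m /pushforward (_ : c @^-1` _ = F k `*` G k).
    by rewrite product_measure1E// lte_mul_pinfty// ge0_fin_numE.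
  apply/seteqP; split => -[s v] /=; rewrite /c /= cons_rV0 behead_cons_rV //.
exact: sigma_finite_measure_of.
Qed.

Lemma lebesgue_rV_set0 n : @lebesgue_rV R n set0 = 0%E.
Proof. by have [mu ->] := lebesgue_rV_measure n; rewrite measure0. Qed.

Lemma lebesgue_rV_ge0 n (A : set 'rV[R]_n) : (0 <= @lebesgue_rV R n A)%E.
Proof. by have [mu ->] := lebesgue_rV_measure n. Qed.

Lemma lebesgue_rV_sigma_additive n : semi_sigma_additive (@lebesgue_rV R n).
Proof.
by have [mu ->] := lebesgue_rV_measure n; exact: measure_semi_sigma_additive.
Qed.

HB.instance Definition _ n := isMeasure.Build _ _ _ (@lebesgue_rV R n)
  (@lebesgue_rV_set0 n) (@lebesgue_rV_ge0 n) (@lebesgue_rV_sigma_additive n).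

Lemma lebesgue_rV_sigma_finite n : sigma_finite setT (@lebesgue_rV R n).
Proof. by have [mu ->] := lebesgue_rV_measure n; exact: sigma_finiteT. Qed.

HB.instance Definition _ n := @Measure_isSigmaFinite.Build _ _ _
  (@lebesgue_rV R n) (@lebesgue_rV_sigma_finite n).

Local Open Scope ereal_scope.

Lemma integral_lebesgue_rV0 (H : 'rV[R]_0 -> \bar R) :
  measurable_fun setT H -> \int[@lebesgue_rV R 0]_u H u = H 0%R.
Proof. by move=> mH; rewrite integral_dirac// diracT mul1e. Qed.

Lemma measurable_fun_cons n s : measurable_fun setT (@cons_rV n s).
Proof.
apply: measurable_fun_rV => j; case: (unliftP ord0 j) => [k ->|->].
  by under eq_fun do rewrite cons_rVS; exact: measurable_coord.
by under eq_fun do rewrite cons_rV0; exact: measurable_cst.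
Qed.

Lemma integral_lebesgue_rVS n (H : 'rV[R]_n.+1 -> \bar R) :
  measurable_fun setT H -> (forall v, 0 <= H v) ->
  \int[@lebesgue_rV R n.+1]_v H v =
  \int[@lebesgue_measure R]_s \int[@lebesgue_rV R n]_u H (cons_rV s u).
Proof.
move=> mH H0; rewrite lebesgue_rVS.
rewrite (@ge0_integral_pushforward _ _ _ _ _ _ (@measurable_cons_rV n)
  (lebesgue_measure \x @lebesgue_rV R n) setT H) //.
rewrite preimage_setT fubini_tonelli1//; last by move=> p; exact: H0.
by apply: measurableT_comp => //; exact: measurable_cons_rV.
Qed.

Lemma measurable_int_cons n (H : 'rV[R]_n.+1 -> \bar R) :
  measurable_fun setT H -> (forall v, 0 <= H v) ->
  measurable_fun setT (fun s : R => \int[@lebesgue_rV R n]_u H (cons_rV s u)).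
Proof.
move=> mH H0.
apply: (@measurable_fun_fubini_tonelli_F _ _ _ _ _ (@lebesgue_rV R n)
  (fun p : measurableTypeR R * 'rV[R]_n => H (cons_rV p.1 p.2))) => //.
by apply: measurableT_comp => //; exact: measurable_cons_rV.
Qed.

End measurability_rV.

(** * Lipschitz functions are measurable *)

Section measurable_lipschitz.
Context {R : realType}.

Lemma measurable_l1norm n : measurable_fun setT (@l1norm R n).
Proof.
apply: measurable_sum => j; apply: measurableT_comp => //; exact: measurable_coord.
Qed.

Lemma measurable_fun_addrV d (T : measurableType d) n (f g : T -> 'rV[R]_n) :
  measurable_fun setT f -> measurable_fun setT g ->
  measurable_fun setT (fun t => f t + g t).
Proof.
move=> mf mg; apply: measurable_fun_rV => j; under eq_fun do rewrite mxE.
by apply: measurable_funD; apply: measurableT_comp (measurable_coord j) _.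
Qed.

Lemma measurable_fun_scalerV d (T : measurableType d) n (a : T -> R) (g : T -> 'rV[R]_n) :
  measurable_fun setT a -> measurable_fun setT g ->
  measurable_fun setT (fun t => a t *: g t).
Proof.
move=> mf mg; apply: measurable_fun_rV => j; under eq_fun do rewrite mxE.
by apply: measurable_funM => //; apply: measurableT_comp (measurable_coord j) _.
Qed.

Lemma rat_near (x e : R) : 0 < e -> exists q : rat, `|x - ratr q| < e.
Proof.
move=> e0; have [q] : exists q : rat, ratr q \in `]x - e, x + e[.
  by apply: rat_in_itvoo; rewrite ltrBlDr -addrA ltrDl addr_gt0.
rewrite in_itv/= => /andP[h1 h2]; exists q; rewrite ltr_norml; lra.
Qed.

Definition l1lip n (K : R) (F : 'rV[R]_n -> R) :=
  forall u v, `|F u - F v| <= K * l1norm (u - v).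

(** The open superlevel set at level [a] is a countable union of l1 balls with rational
data: around a rational [q], the Lipschitz bound keeps [F] above [a] on the
ball of radius [r] as soon as [a < F q - K r]. *)
Lemma l1lip_measurable n (K : R) (F : 'rV[R]_n -> R) : 0 <= K -> l1lip K F ->
  measurable_fun setT F.
Proof.
move=> K0 lF.
apply: (measurability _ (RGenOInfty.measurableE R)) => //.
move=> _ [_ [a ->] <-]; rewrite setTI.
pose U (p : 'rV[rat]_n * rat) : set 'rV[R]_n :=
  if a < F (map_mx ratr p.1) - K * ratr p.2 then
  [set v | l1norm (v - map_mx ratr p.1) < ratr p.2] else set0.
have -> : F @^-1` `]a, +oo[%classic = \bigcup_p U p.
  apply/seteqP; split => [v /=|v [[q r] _]]; last first.
    rewrite /U /=; case: ifPn => //= ha hv.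
    rewrite in_itv/= andbT; have := lF v (map_mx ratr q).
    have : K * l1norm (v - map_mx ratr q) <= K * ratr r by rewrite ler_wpM2l// ltW.
    rewrite ler_norml; lra.
  rewrite in_itv/= andbT => av.
  (* [e] is so small that a ball of rational centre within [e] of [v] and of rational
     radius between [e] and [2 e] both contains [v] and has the required margin. *)
  pose e := (F v - a) / (2 * K + 1) / 2.
  have e0 : 0 < e by rewrite divr_gt0// divr_gt0 ?subr_gt0//; lra.
  have [r hr] := rat_near (3 / 2 * e) (divr_gt0 e0 (ltr0Sn _ 1)).
  pose e' := e / n.+1%:R.
  have e'0 : 0 < e' by rewrite divr_gt0.
  have /choice[q hq] : forall j, exists q : rat, `|v ord0 j - ratr q| < e'.
    by move=> j; exact: rat_near.
  exists (\row_j q j, r) => //; rewrite /U /=.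
  have hvq : l1norm (v - map_mx ratr (\row_j q j)) < e.
    rewrite /l1norm (le_lt_trans (y := \sum_(j < n) e'))//.
      by apply: ler_sum => j _; rewrite !mxE ltW.
    rewrite sumr_const card_ord -mulr_natl /e' mulrCA gtr_pMr// ltr_pdivrMr//.
    by rewrite mul1r ltr_nat.
  have Fvq : F v - F (map_mx ratr (\row_j q j)) <= K * e.
    by rewrite (le_trans (ler_norm _))// (le_trans (lF _ _))// ler_wpM2l// ltW.
  have ee : 2 * (2 * K + 1) * e = F v - a.
    by rewrite /e; field; lra.
  clearbody e'; clearbody e.
  move: hr; rewrite ltr_norml => /andP[hr1 hr2].
  have Kr : K * ratr r <= K * (2 * e) by rewrite ler_wpM2l//; lra.
  rewrite ifT; last first.
    have e3 : 2 * (2 * K + 1) * e = 4 * (K * e) + 2 * e by ring.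
    have : 0 <= K * e by rewrite mulr_ge0// ltW.
    lra.
  by rewrite /=; lra.
apply: countable_bigcupT_measurable; first exact: countableP.
move=> -[q r]; rewrite /U /=; case: ifPn => // _.
rewrite -[X in measurable X]setTI.
have mg : measurable_fun setT (fun v : 'rV[R]_n => l1norm (v - map_mx ratr q)).
  apply: measurableT_comp; first exact: measurable_l1norm.
  by apply: measurable_fun_addrV => //; exact: measurable_cst.
have := mg measurableT `]-oo, ratr r[%classic (measurable_itv _).
by rewrite set_itvE.
Qed.

End measurable_lipschitz.

(** * Affine changes of variables *)

Section affine.
Context {R : realType}.
Local Open Scope ereal_scope.
Local Notation leb := (@lebesgue_measure R).

Lemma measurable_affine (a b : R) : measurable_fun setT (fun x : R => (a * x + b)%R).
Proof. by apply: measurable_funD => //; apply: measurable_funM. Qed.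

(** Uniqueness of the Lebesgue measure, applied to the image of half-open intervals
under [x |-> a x + b]. *)
Lemma ge0_integral_affine_pos (a b : R) (H : R -> \bar R) : (0 < a)%R ->
  measurable_fun setT H -> (forall x, 0 <= H x) ->
  \int[leb]_x H x = a%:E * \int[leb]_x H (a * x + b)%R.
Proof.
move=> a0 mH H0.
pose f (x : measurableTypeR R) : measurableTypeR R := (a * x + b)%R.
have mf : measurable_fun setT f by exact: measurable_affine.
pose k : {nonneg R} := NngNum (ltW a0).
have lebE A : measurable A -> leb A = mscale k (pushforward leb f) A.
  apply: (@lebesgue_measure_unique _ (mscale k (pushforward leb f))) => //.
  move=> _ [[c d]] _ <-; rewrite /= /mscale /=.
  rewrite -[pushforward _ _ _]/(leb (f @^-1` `]c, d]%classic)).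
  rewrite (_ : f @^-1` _ = `](c - b) / a, (d - b) / a]%classic)%R; last first.
    apply/seteqP; split => x /=; rewrite !in_itv/= ltr_pdivrMr// ler_pdivlMr//;
      rewrite /f (mulrC x a); lra.
  rewrite !lebesgue_measure_itv/= !lte_fin ltr_pM2r ?invr_gt0// ltrD2r.
  case: ifPn => // cd; last by rewrite mule0.
  rewrite -!EFinB -EFinM; congr EFin; field; lra.
rewrite (@eq_measure_integral _ _ _ setT (mscale k (pushforward leb f))); last first.
  by move=> A mA _; exact: lebE.
rewrite ge0_integral_mscale//; congr (_ * _).
by rewrite (@ge0_integral_pushforward _ _ _ _ _ _ mf)//= preimage_setT.
Qed.

Lemma ge0_integral_opp (H : R -> \bar R) :
  measurable_fun setT H -> (forall x, 0 <= H x) ->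
  \int[leb]_x H x = \int[leb]_x H (- x)%R.
Proof.
move=> mH H0.
have mf : measurable_fun setT (-%R : measurableTypeR R -> measurableTypeR R) by [].
rewrite -(@eq_measure_integral _ _ _ setT leb (pushforward leb (-%R : _ -> measurableTypeR R))).
  by rewrite (@ge0_integral_pushforward _ _ _ _ _ _ mf)//= preimage_setT.
by move=> A mA _; exact: lebesgue_measureN.
Qed.

Lemma ge0_integral_affine (a b : R) (H : R -> \bar R) : (a != 0)%R ->
  measurable_fun setT H -> (forall x, 0 <= H x) ->
  \int[leb]_x H x = `|a|%:E * \int[leb]_x H (a * x + b)%R.
Proof.
move=> a0 mH H0; have [agt0|ale0] := ltP 0%R a.
  by rewrite gtr0_norm//; exact: ge0_integral_affine_pos.
have alt0 : (a < 0)%R by rewrite lt_neqAle a0.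
rewrite ltr0_norm// (@ge0_integral_affine_pos (- a) b)//; last by rewrite oppr_gt0.
congr (_ * _); rewrite ge0_integral_opp//.
  by apply: eq_integral => x _; rewrite mulrNN.
by apply: measurableT_comp => //; exact: measurable_affine.
Qed.

Lemma ge0_integral_rV_affine n (a : R) (w : 'rV[R]_n) (H : 'rV[R]_n -> \bar R) :
  (a != 0)%R -> measurable_fun setT H -> (forall x, 0 <= H x) ->
  \int[@lebesgue_rV R n]_x H x =
  (`|a| ^+ n)%:E * \int[@lebesgue_rV R n]_x H (a *: x + w)%R.
Proof.
move=> a0.
have maff k (z : 'rV[R]_k) : measurable_fun setT (fun x : 'rV[R]_k => (a *: x + z)%R).
  apply: measurable_fun_addrV; last exact: measurable_cst.
  by apply: measurable_fun_scalerV => //; exact: measurable_id.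
elim: n w H => [|n IH] w H mH H0.
  have mHc : measurable_fun setT (fun x : 'rV[R]_0 => H (a *: x + w)%R)
    by exact: (measurableT_comp mH (maff _ w)).
  rewrite integral_lebesgue_rV0// (integral_lebesgue_rV0 mHc).
  by rewrite expr0 mul1e; congr (H _); apply/rowP => -[].
have mHc : measurable_fun setT (fun x : 'rV[R]_n.+1 => H (a *: x + w)%R)
    by exact: (measurableT_comp mH (maff _ w)).
rewrite integral_lebesgue_rVS// (integral_lebesgue_rVS mHc)//.
rewrite (@ge0_integral_affine a (w ord0 ord0) _ a0); last 2 first.
- exact: measurable_int_cons.
- by move=> s; exact: integral_ge0.
rewrite exprS EFinM -muleA; congr (_ * _).
rewrite -ge0_integralZl; last 4 first.
- by [].
- by apply: (measurable_int_cons mHc).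
- by move=> s _; exact: integral_ge0.
- by rewrite lee_fin exprn_ge0.
apply: eq_integral => s _.
rewrite (IH (behead_rV w)) //; last exact: (measurableT_comp mH (measurable_fun_cons _)).
congr (_ * _); apply: eq_integral => u _; congr (H _).
by rewrite cons_rVZ -[in RHS](cons_behead_rV w) cons_rVD.
Qed.

End affine.

(** * The projected measure on the l1 sphere *)

Section cone.
Context {R : realType}.

Lemma measure_of d (T : measurableType d) (m : set T -> \bar R) :
  m set0 = 0%E -> (forall A, (0 <= m A)%E) -> semi_sigma_additive m ->
  exists mu : {measure set T -> \bar R}, m = mu.
Proof.
move=> m0 mge0 msig.
pose m1 := isMeasure.Build _ _ _ m m0 mge0 msig.
pose mu : {measure set T -> \bar R} := HB.pack m m1.
by exists mu.
Qed.

Lemma measurable_patchT d (T : measurableType d) (D : set T) (g : T -> \bar R) :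
  measurable D -> measurable_fun setT g -> measurable_fun setT (g \_ D).
Proof. by move=> mD mg; apply/(measurable_restrictT _ mD); exact: measurable_funTS. Qed.

Lemma rcons_rVE n (u : 'rV[R]_n) y (j : 'I_n.+1) :
  rcons_rV (d := n.+1) u y ord0 j = oapp (fun i : 'I_n => u ord0 i) y (insub (j : nat)).
Proof. by rewrite mxE. Qed.

Lemma rcons_rV_widen n (u : 'rV[R]_n) y (j : 'I_n) :
  rcons_rV (d := n.+1) u y ord0 (widen_ord (leqnSn n) j) = u ord0 j.
Proof.
rewrite rcons_rVE (insubT (fun k => k < n)%N (ltn_ord j))/=.
by congr (u _ _); exact: val_inj.
Qed.

Lemma rcons_rV_max n (u : 'rV[R]_n) y :
  rcons_rV (d := n.+1) u y ord0 ord_max = y.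
Proof. by rewrite rcons_rVE insubF//= ltnn. Qed.

Lemma ord_widen_max n (j : 'I_n.+1) :
  (exists i : 'I_n, j = widen_ord (leqnSn n) i) \/ j = ord_max.
Proof.
have [jn|jn] := ltnP j n; [left|right].
  by exists (Ordinal jn); exact: val_inj.
by apply: val_inj => /=; apply/eqP; rewrite eqn_leq jn -ltnS ltn_ord.
Qed.

Lemma rcons_cons_rV n s (u : 'rV[R]_n) y :
  rcons_rV (d := n.+2) (cons_rV s u) y = cons_rV s (rcons_rV (d := n.+1) u y).
Proof.
apply/rowP => j; case: (unliftP ord0 j) => [k ->|->].
  rewrite cons_rVS; case: (ord_widen_max k) => [[i ->]|->].
    rewrite rcons_rV_widen.
    have -> : lift ord0 (widen_ord (leqnSn n) i) =
      widen_ord (leqnSn n.+1) (lift ord0 i) by exact: val_inj.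
    by rewrite rcons_rV_widen cons_rVS.
  have -> : lift ord0 ord_max = (ord_max : 'I_n.+2) by exact: val_inj.
  by rewrite !rcons_rV_max.
have -> : (ord0 : 'I_n.+2) = widen_ord (leqnSn n.+1) ord0 by exact: val_inj.
by rewrite rcons_rV_widen /= cons_rV0; rewrite [X in cons_rV _ _ _ X](_ : _ = ord0) ?cons_rV0//; exact: val_inj.
Qed.

Lemma rcons_rVZ n a (u : 'rV[R]_n) y :
  a *: rcons_rV (d := n.+1) u y = rcons_rV (d := n.+1) (a *: u) (a * y).
Proof.
apply/rowP => j; rewrite mxE; case: (ord_widen_max j) => [[i ->]|->].
  by rewrite !rcons_rV_widen mxE.
by rewrite !rcons_rV_max.
Qed.

Lemma l1norm_rcons n (u : 'rV[R]_n) y :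
  l1norm (rcons_rV (d := n.+1) u y) = l1norm u + `|y|.
Proof.
rewrite /l1norm big_ord_recr/= rcons_rV_max; congr (_ + _).
by apply: eq_bigr => i _; rewrite rcons_rV_widen.
Qed.

Lemma l1norm_cons n s (u : 'rV[R]_n) : l1norm (cons_rV s u) = `|s| + l1norm u.
Proof.
rewrite /l1norm big_ord_recl cons_rV0; congr (_ + _).
by apply: eq_bigr => i _; rewrite cons_rVS.
Qed.

Lemma l1norm_ge0 n (u : 'rV[R]_n) : 0 <= l1norm u.
Proof. exact: sumr_ge0. Qed.

Lemma l1norm0 n : l1norm (0 : 'rV[R]_n) = 0.
Proof. by rewrite /l1norm big1// => j _; rewrite mxE normr0. Qed.

Lemma l1normZ n a (u : 'rV[R]_n) : l1norm (a *: u) = `|a| * l1norm u.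
Proof. by rewrite /l1norm mulr_sumr; apply: eq_bigr => j _; rewrite mxE normrM. Qed.

Lemma l1normN n (u : 'rV[R]_n) : l1norm (- u) = l1norm u.
Proof. by rewrite -scaleN1r l1normZ normrN normr1 mul1r. Qed.

Lemma l1normD n (u v : 'rV[R]_n) : l1norm (u + v) <= l1norm u + l1norm v.
Proof.
by rewrite /l1norm -big_split/=; apply: ler_sum => j _; rewrite mxE ler_normD.
Qed.

Lemma measurable_rcons_rV d (T : measurableType d) n (f : T -> 'rV[R]_n) (g : T -> R) :
  measurable_fun setT f -> measurable_fun setT g ->
  measurable_fun setT (fun t => rcons_rV (d := n.+1) (f t) (g t)).
Proof.
move=> mf mg; apply: measurable_fun_rV => j; case: (ord_widen_max j) => [[i ->]|->].
  under eq_fun do rewrite rcons_rV_widen.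
  exact: (measurableT_comp (measurable_coord i) mf).
by under eq_fun do rewrite rcons_rV_max.
Qed.

Definition open_l1ball n : set 'rV[R]_n := [set u | l1norm u < 1].

Lemma measurable_open_l1ball n : measurable (@open_l1ball n).
Proof.
rewrite -[X in measurable X]setTI.
have := @measurable_l1norm R n measurableT `]-oo, 1[%classic (measurable_itv _).
by rewrite set_itvE.
Qed.

(** The two graphs that cover the l1 sphere of R^(n+1) up to its equator. *)
Definition cap_pos n (u : 'rV[R]_n) := rcons_rV (d := n.+1) u (1 - l1norm u).
Definition cap_neg n (u : 'rV[R]_n) := rcons_rV (d := n.+1) u (l1norm u - 1).

Lemma measurable_cap_pos n : measurable_fun setT (@cap_pos n).
Proof.
apply: measurable_rcons_rV; first exact: measurable_id.
by apply: measurable_funB => //; exact: measurable_l1norm.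
Qed.

Lemma measurable_cap_neg n : measurable_fun setT (@cap_neg n).
Proof.
apply: measurable_rcons_rV; first exact: measurable_id.
by apply: measurable_funB => //; exact: measurable_l1norm.
Qed.

(** Lebesgue measure of the projection along the last axis, counted on both caps. It
is [n + 1] times the volume of the cone spanned by a part of the sphere, which is
what makes the polar formula hold. *)
Definition cone_measure n (A : set 'rV[R]_n.+1) : \bar R :=
  (@lebesgue_rV R n (@cap_pos n @^-1` A `&` @open_l1ball n) +
   @lebesgue_rV R n (@cap_neg n @^-1` A `&` @open_l1ball n))%E.

Local Open Scope ereal_scope.

Lemma cone_measure_ex n : exists mu : {measure set 'rV[R]_n.+1 -> \bar R},
  @cone_measure n = mu /\ forall H, measurable_fun setT H -> (forall v, 0 <= H v) ->
  \int[mu]_v H v = \int[@lebesgue_rV R n]_(u in @open_l1ball n) (H (cap_pos u) + H (cap_neg u)).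
Proof.
have mB := @measurable_open_l1ball n.
have mp := @measurable_cap_pos n; have mn := @measurable_cap_neg n.
pose lb := mrestr (@lebesgue_rV R n) mB.
have [mu1 mu1E] : exists mu : {measure set 'rV[R]_n.+1 -> \bar R},
    pushforward lb (@cap_pos n) = mu.
  apply: measure_of; first by rewrite /pushforward preimage_set0 /lb measure0.
    by move=> A; rewrite /pushforward /lb /mrestr; exact: lebesgue_rV_ge0.
  exact: (@measure_semi_sigma_additive _ _ _ (pushforward lb (@cap_pos n))).
have [mu2 mu2E] : exists mu : {measure set 'rV[R]_n.+1 -> \bar R},
    pushforward lb (@cap_neg n) = mu.
  apply: measure_of; first by rewrite /pushforward preimage_set0 /lb measure0.
    by move=> A; rewrite /pushforward /lb /mrestr; exact: lebesgue_rV_ge0.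
  exact: (@measure_semi_sigma_additive _ _ _ (pushforward lb (@cap_neg n))).
exists (measure_add mu1 mu2); split.
  by apply/funext => A; rewrite [RHS]measure_addE -mu1E -mu2E.
move=> H mH H0.
have intlb G : measurable_fun setT G -> (forall v, 0 <= G v) ->
    \int[lb]_v G v = \int[@lebesgue_rV R n]_(u in @open_l1ball n) G u.
  move=> mG G0.
  rewrite [RHS](@eq_measure_integral _ _ _ _ lb); last first.
    by move=> A mA AB; rewrite /lb /= /mrestr setIidl.
  rewrite -[in LHS](setUv (@open_l1ball n)) ge0_integral_setU//; last 3 first.
  - exact: measurableC.
  - exact: measurable_funTS.
  - by apply/disj_setPCl.
  rewrite [X in _ + X](_ : _ = 0) ?adde0//.
  apply: null_set_integral => //; first exact: measurableC.
    exact: measurable_funTS.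
  by rewrite /lb/= /mrestr setICl measure0.
rewrite ge0_integral_measure_add//.
rewrite -(@eq_measure_integral _ _ _ setT mu1 (pushforward lb (@cap_pos n))); last first.
  by move=> A _ _; rewrite -mu1E.
rewrite -(@eq_measure_integral _ _ _ setT mu2 (pushforward lb (@cap_neg n))); last first.
  by move=> A _ _; rewrite -mu2E.
rewrite (ge0_integral_pushforward mp)// (ge0_integral_pushforward mn)//.
have mHp : measurable_fun setT (H \o @cap_pos n) := measurableT_comp mH mp.
have mHn : measurable_fun setT (H \o @cap_neg n) := measurableT_comp mH mn.
rewrite !preimage_setT [X in X + _](intlb (H \o @cap_pos n))//; last by move=> v; exact: H0.
rewrite [X in _ + X](intlb (H \o @cap_neg n))//; last by move=> v; exact: H0.
by rewrite ge0_integralD//; exact: measurable_funTS.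
Qed.

Lemma cone_measure_set0 n : @cone_measure n set0 = 0.
Proof. by have [mu [-> _]] := cone_measure_ex n; rewrite measure0. Qed.

Lemma cone_measure_ge0 n A : 0 <= @cone_measure n A.
Proof. by have [mu [-> _]] := cone_measure_ex n. Qed.

Lemma cone_measure_sigma_additive n : semi_sigma_additive (@cone_measure n).
Proof.
by have [mu [-> _]] := cone_measure_ex n; exact: measure_semi_sigma_additive.
Qed.

HB.instance Definition _ n := isMeasure.Build _ _ _ (@cone_measure n)
  (@cone_measure_set0 n) (@cone_measure_ge0 n) (@cone_measure_sigma_additive n).

Lemma integral_cone n (H : 'rV[R]_n.+1 -> \bar R) :
  measurable_fun setT H -> (forall v, 0 <= H v) ->
  \int[@cone_measure n]_v H v =
  \int[@lebesgue_rV R n]_(u in @open_l1ball n) (H (cap_pos u) + H (cap_neg u)).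
Proof.
move=> mH H0; have [mu [muE muH]] := cone_measure_ex n; rewrite -muH//.
by apply: eq_measure_integral => A _ _; rewrite -muE.
Qed.

Lemma measurable_caps n (H : 'rV[R]_n.+1 -> \bar R) : measurable_fun setT H ->
  measurable_fun setT (fun u => H (cap_pos u) + H (cap_neg u)).
Proof.
move=> mH; apply: emeasurable_funD.
  exact: (measurableT_comp mH (@measurable_cap_pos n)).
exact: (measurableT_comp mH (@measurable_cap_neg n)).
Qed.

Lemma integral_cone0 (H : 'rV[R]_1 -> \bar R) :
  measurable_fun setT H -> (forall v, 0 <= H v) ->
  \int[@cone_measure 0]_v H v = H (const_mx 1%R) + H (const_mx (-1)%R).
Proof.
move=> mH H0; rewrite integral_cone// integral_mkcond integral_lebesgue_rV0; last first.
  by apply: measurable_patchT; [exact: measurable_open_l1ball|exact: measurable_caps].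
have n0 : l1norm (0 : 'rV[R]_0) = 0%R by rewrite l1norm0.
rewrite patchE ifT; last by rewrite inE /open_l1ball /= n0 ltr01.
congr (H _ + H _); apply/rowP => j; (have -> : j = ord_max by rewrite (ord1 j); exact: val_inj).
  by rewrite /cap_pos [LHS]rcons_rV_max mxE n0 subr0.
by rewrite /cap_neg [LHS]rcons_rV_max mxE n0 sub0r.
Qed.

(** The caps are compatible with slicing at the first coordinate; this is what allows
the recursion on the dimension. *)
Lemma cap_pos_cons n s (u : 'rV[R]_n) : (`|s| < 1)%R ->
  cap_pos (cons_rV s ((1 - `|s|) *: u)) = cons_rV s ((1 - `|s|) *: cap_pos u).
Proof.
move=> s1; rewrite /cap_pos l1norm_cons l1normZ rcons_cons_rV rcons_rVZ.
rewrite (ger0_norm (x := 1 - `|s|)) ?subr_ge0 1?ltW//.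
by congr cons_rV; congr rcons_rV; ring.
Qed.

Lemma cap_neg_cons n s (u : 'rV[R]_n) : (`|s| < 1)%R ->
  cap_neg (cons_rV s ((1 - `|s|) *: u)) = cons_rV s ((1 - `|s|) *: cap_neg u).
Proof.
move=> s1; rewrite /cap_neg l1norm_cons l1normZ rcons_cons_rV rcons_rVZ.
rewrite (ger0_norm (x := 1 - `|s|)) ?subr_ge0 1?ltW//.
by congr cons_rV; congr rcons_rV; ring.
Qed.

(** Slicing at the first coordinate [s]: the slice of the sphere is a sphere of radius
[1 - |s|], and the dilation by that radius in R^n gives the factor
[(1 - |s|) ^ n]. *)
Lemma integral_coneS n (H : 'rV[R]_n.+2 -> \bar R) :
  measurable_fun setT H -> (forall v, 0 <= H v) ->
  \int[@cone_measure n.+1]_v H v =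
  \int[@lebesgue_measure R]_(s in `](-1)%R, 1%R[%classic)
    (((1 - `|s|) ^+ n)%:E * \int[@cone_measure n]_v H (cons_rV s ((1 - `|s|) *: v))%R).
Proof.
move=> mH H0; rewrite integral_cone// integral_mkcond integral_lebesgue_rVS; last 2 first.
- by apply: measurable_patchT; [exact: measurable_open_l1ball|exact: measurable_caps].
- by move=> v; apply: erestrict_ge0 => u _; rewrite adde_ge0.
rewrite [RHS]integral_mkcond; apply: eq_integral => s _; rewrite patchE.
case: ifPn => [/set_mem/=|/negP hs]; last first.
  apply: integral0_eq => u _; rewrite patchE memNset// /open_l1ball /= l1norm_cons => hu.
  apply: hs; rewrite inE/= in_itv/= -ltr_norml.
  by rewrite (le_lt_trans _ hu)// lerDl l1norm_ge0.
rewrite in_itv/= -ltr_norml => s1.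
have r0 : (0 < 1 - `|s|)%R by rewrite subr_gt0.
have mG : measurable_fun setT (fun u : 'rV[R]_n =>
    ((fun x => H (cap_pos x) + H (cap_neg x)) \_ (@open_l1ball n.+1)) (cons_rV s u)).
  apply: (measurableT_comp _ (measurable_fun_cons s)).
  by apply: measurable_patchT; [exact: measurable_open_l1ball|exact: measurable_caps].
rewrite (ge0_integral_rV_affine (a := (1 - `|s|)%R) 0%R _ mG) ?gt_eqF//; last first.
  by move=> v; apply: erestrict_ge0 => u _; rewrite adde_ge0.
rewrite gtr0_norm//; congr (_ * _).
have mHs : measurable_fun setT (fun v : 'rV[R]_n.+1 => H (cons_rV s ((1 - `|s|) *: v))%R).
  apply: (measurableT_comp mH); apply: (measurableT_comp (measurable_fun_cons s)).
  by apply: measurable_fun_scalerV => //; exact: measurable_id.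
rewrite integral_cone//.
rewrite [RHS]integral_mkcond; apply: eq_integral => u _.
rewrite !patchE addr0.
have -> : (cons_rV s ((1 - `|s|) *: u)%R \in @open_l1ball n.+1) = (u \in @open_l1ball n).
  have E : (l1norm (cons_rV s ((1 - `|s|) *: u)) < 1 = (l1norm u < 1))%R.
    rewrite l1norm_cons l1normZ (gtr0_norm r0) -subr_gt0.
    rewrite (_ : 1 - _ = (1 - `|s|) * (1 - l1norm u))%R; last by ring.
    by rewrite pmulr_rgt0// subr_gt0.
  by apply/idP/idP; rewrite !inE /open_l1ball /= E.
by case: ifPn => // _; rewrite cap_pos_cons// cap_neg_cons.
Qed.

Lemma measurable_oppV n : measurable_fun setT (fun v : 'rV[R]_n => (- v)%R).
Proof.
under eq_fun do rewrite -scaleN1r.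
by apply: measurable_fun_scalerV => //; exact: measurable_id.
Qed.

Lemma cap_posN n (u : 'rV[R]_n) : cap_pos (- u)%R = (- cap_neg u)%R.
Proof.
by rewrite -[RHS]scaleN1r /cap_neg rcons_rVZ scaleN1r mulN1r opprB /cap_pos l1normN.
Qed.

Lemma cap_negN n (u : 'rV[R]_n) : cap_neg (- u)%R = (- cap_pos u)%R.
Proof.
by rewrite -[RHS]scaleN1r /cap_pos rcons_rVZ scaleN1r mulN1r opprB /cap_neg l1normN.
Qed.

(** The antipodal map exchanges the two caps. *)
Lemma cone_measureN n (H : 'rV[R]_n.+1 -> \bar R) :
  measurable_fun setT H -> (forall v, 0 <= H v) ->
  \int[@cone_measure n]_v H (- v)%R = \int[@cone_measure n]_v H v.
Proof.
move=> mH H0.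
have mHN : measurable_fun setT (fun v : 'rV[R]_n.+1 => H (- v)%R).
  exact: (measurableT_comp mH (@measurable_oppV n.+1)).
rewrite !integral_cone// integral_mkcond [RHS]integral_mkcond.
have mG : measurable_fun setT ((fun x => H (cap_pos x) + H (cap_neg x)) \_ (@open_l1ball n)).
  by apply: measurable_patchT; [exact: measurable_open_l1ball|exact: measurable_caps].
rewrite [RHS](ge0_integral_rV_affine (a := (-1)%R) 0%R _ mG) ?oppr_eq0 ?oner_eq0//; last first.
  by move=> v; apply: erestrict_ge0 => u _; rewrite adde_ge0.
rewrite normrN1 expr1n mul1e; apply: eq_integral => u _.
rewrite !patchE addr0 scaleN1r.
have -> : (- u \in @open_l1ball n)%R = (u \in @open_l1ball n).
  by apply/idP/idP; rewrite !inE /open_l1ball /= l1normN.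
by case: ifPn => // _; rewrite cap_posN cap_negN addeC.
Qed.

Lemma cone_measure_sphere n : @cone_measure n (~` @l1sphere R n.+1) = 0.
Proof.
have h A B : (forall u, B u -> ~ A u) -> @lebesgue_rV R n (A `&` B) = 0.
  move=> AB; rewrite (_ : A `&` B = set0) ?measure0//.
  by apply/seteqP; split => // u [Au Bu]; exact: AB Bu Au.
rewrite /cone_measure !h ?adde0// => u; rewrite /open_l1ball /= => u1; apply.
  rewrite /l1sphere /= l1norm_rcons ltr0_norm ?subr_lt0//; ring.
rewrite /l1sphere /= l1norm_rcons gtr0_norm ?subr_gt0//; ring.
Qed.

End cone.

(** * Polar coordinates for the l1 norm *)

Section polar.
Context {R : realType}.
Local Open Scope ereal_scope.
Local Notation leb := (@lebesgue_measure R).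

Lemma integral_onemX k :
  \int[leb]_(s in `[0%R, 1%R]%classic) (((1 - s) ^+ k)%R)%:E = ((k.+1%:R)^-1)%:E.
Proof.
rewrite (@continuous_FTC2 _ (fun s : R => onem s ^+ k)%R (fun x : R => onem x ^+ k.+1 / - k.+1%:R)%R)//=.
- rewrite -EFinB; congr EFin; rewrite onem1 expr0n/= mul0r onem0 expr1n mul1r sub0r.
  by rewrite invrN opprK.
- by apply: continuous_in_subspaceT => x x01; exact: continuous_onemXn.
- exact: derivable_oo_LRcontinuous_onemXnMr.
- move=> x x01; rewrite derive1Mr//; last exact: onemXn_derivable.
  by rewrite derive_onemXn mulrAC divff// mul1r.
Qed.

(** Folding the line at 0. *)
Lemma integral_symm (H : R -> \bar R) : measurable_fun setT H -> (forall x, 0 <= H x) ->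
  \int[leb]_x H x = \int[leb]_(x in `]0%R, +oo[%classic) (H x + H (- x)%R).
Proof.
move=> mH H0.
have mHN : measurable_fun setT (fun x : R => H (- x)%R).
  by apply: (measurableT_comp mH); exact: oppr_measurable.
rewrite ge0_integralD//; [|exact: measurable_funTS|exact: measurable_funTS].
have -> : \int[leb]_(x in `]0%R, +oo[%classic) H (- x)%R = \int[leb]_(x in `]-oo, 0%R[%classic) H x.
  rewrite integral_mkcond [RHS]integral_mkcond.
  rewrite [RHS]ge0_integral_opp; last 2 first.
  - by apply: measurable_patchT => //; exact: measurable_itv.
  - by move=> x; apply: erestrict_ge0.
  apply: eq_integral => x _; rewrite !patchE; congr (if _ then _ else _).
  by apply/idP/idP; rewrite !inE/= !in_itv/= ?andbT oppr_lt0.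
rewrite integral_itv_obnd_cbnd; last exact: measurable_funTS.
rewrite addeC -ge0_integral_setU//; last 2 first.
- exact: measurable_funTS.
- apply/disj_setPS => x [] /=; rewrite !in_itv/= andbT; lra.
congr integral; apply/esym; rewrite -subTset => x _ /=.
by rewrite !in_itv/= andbT; have [] := ltP x 0%R; [left|right].
Qed.

Lemma integral_absitv (g : R -> \bar R) : measurable_fun setT g -> (forall x, 0 <= g x) ->
  \int[leb]_(s in `](-1)%R, 1%R[%classic) g `|s|%R =
  2%:E * \int[leb]_(s in `[0%R, 1%R]%classic) g s.
Proof.
move=> mg g0.
have mga : measurable_fun setT (fun s : R => g `|s|%R).
  by apply: (measurableT_comp mg); exact: normr_measurable.
rewrite integral_mkcond integral_symm; last 2 first.
- by apply: measurable_patchT => //; exact: measurable_itv.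
- by move=> x; apply: erestrict_ge0.
rewrite (integral_itv_bndoo (x := 0%R) (y := 1%R) true false); last exact: measurable_funTS.
have -> : 2%:E * \int[leb]_(s in `]0%R, 1%R[%classic) g s =
    \int[leb]_(s in `]0%R, 1%R[%classic) (2%:E * g s).
  by rewrite ge0_integralZl//; exact: measurable_funTS.
rewrite [LHS]integral_mkcond [RHS]integral_mkcond; apply: eq_integral => x _.
rewrite !patchE; have [x0|x0] := ltP 0%R x; last first.
  by rewrite !memNset//= in_itv/=; [move=> /andP[]|rewrite andbT]; lra.
rewrite ifT; last by rewrite inE/= in_itv/= x0.
have -> : (x \in `]0%R, 1%R[%classic) = (x < 1)%R.
  by apply/idP/idP; rewrite inE/= in_itv/= x0.
have -> : (x \in `](-1)%R, 1%R[%classic) = (x < 1)%R.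
  by apply/idP/idP; rewrite inE/= in_itv/=; lra.
have -> : ((- x)%R \in `](-1)%R, 1%R[%classic) = (x < 1)%R.
  by apply/idP/idP; rewrite inE/= in_itv/=; lra.
case: ifPn => _; last by rewrite adde0.
by rewrite normrN gtr0_norm// mule_natl mule2n.
Qed.

Lemma integral_absonemX k :
  \int[leb]_(s in `](-1)%R, 1%R[%classic) (((1 - `|s|) ^+ k)%R)%:E = (2 / k.+1%:R)%:E.
Proof.
have -> : \int[leb]_(s in `](-1)%R, 1%R[%classic) (((1 - `|s|) ^+ k)%R)%:E =
  \int[leb]_(s in `](-1)%R, 1%R[%classic) (fun t => `|(1 - t) ^+ k|%:E) `|s|%R.
  apply: eq_integral => s; rewrite inE/= in_itv/= => s1.
  by rewrite (ger0_norm (x := ((1 - `|s|) ^+ k)%R))// exprn_ge0// subr_ge0 ler_norml; lra.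
rewrite (integral_absitv (g := fun t : R => `|(1 - t) ^+ k|%:E)); last 2 first.
- apply/measurable_EFinP; apply: measurableT_comp => //; apply: measurable_funX.
  by apply: measurable_funB.
- by move=> x; rewrite lee_fin.
rewrite EFinM -integral_onemX; congr (_ * _).
apply: eq_integral => s; rewrite inE/= in_itv/= => s1.
by rewrite ger0_norm// exprn_ge0// subr_ge0; lra.
Qed.

(** [n + 1] times the volume [2 ^ (n + 1) / (n + 1)!] of the unit l1 ball. *)
Definition cone_mass n : R := (2 ^+ n.+1 / n`!%:R)%R.

Lemma cone_mass_gt0 n : (0 < cone_mass n)%R.
Proof. by rewrite divr_gt0// ?exprn_gt0// ltr0n fact_gt0. Qed.

Lemma cone_massS n : cone_mass n.+1 = (cone_mass n * (2 / n.+1%:R))%R.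
Proof.
rewrite /cone_mass factS natrM exprS; field.
by rewrite addrC natr1 !pnatr_eq0 /= -lt0n fact_gt0.
Qed.

Lemma cone_measureT n : @cone_measure R n setT = (cone_mass n)%:E.
Proof.
have h m : @cone_measure R m setT = \int[@cone_measure R m]_v (cst 1 v).
  by rewrite integral_cst// mul1e.
elim: n => [|n IH].
  by rewrite h integral_cone0//= /cone_mass expr1 fact0 divr1 -EFinD.
rewrite h integral_coneS//=.
under eq_integral do rewrite -h IH muleC.
rewrite ge0_integralZl; last 4 first.
- by [].
- apply/measurable_EFinP; apply: measurable_funTS; apply: measurable_funX.
  by apply: measurable_funB => //; exact: normr_measurable.
- by move=> s /=; rewrite in_itv/= lee_fin => s1; rewrite exprn_ge0// subr_ge0 ler_norml; lra.
- by rewrite lee_fin ltW// cone_mass_gt0.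
by rewrite integral_absonemX -EFinM -cone_massS.
Qed.

Lemma cone_measure_fin n : fin_num_fun (@cone_measure R n).
Proof.
move=> A mA; rewrite ge0_fin_numE//; apply: (@le_lt_trans _ _ (@cone_measure R n setT)).
  by apply: le_measure; rewrite ?inE.
by rewrite cone_measureT ltry.
Qed.

HB.instance Definition _ n := @Measure_isFinite.Build _ _ _ (@cone_measure R n)
  (@cone_measure_fin n).

Lemma measurable_int_cone d (T : measurableType d) n (H : T * 'rV[R]_n.+1 -> \bar R) :
  measurable_fun setT H -> (forall p, 0 <= H p) ->
  measurable_fun setT (fun t => \int[@cone_measure R n]_v H (t, v)).
Proof.
move=> mH H0.
exact: (@measurable_fun_fubini_tonelli_F _ _ _ _ _ (@cone_measure R n) H).
Qed.

Lemma measurable_scale_pair n : measurable_fun setT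
  (fun p : R * 'rV[R]_n => (p.1 *: p.2)%R).
Proof. exact: measurable_fun_scalerV. Qed.

(** Induction on the dimension. Slice at the first coordinate [s] and use polar
coordinates in the slice, with radius [rho]; the radius in the large space is
[r = rho + |s|], and at fixed [r] the substitution [s = r * t] produces the
recursive description of [cone_measure]. *)
Lemma polar n (H : 'rV[R]_n.+1 -> \bar R) :
  measurable_fun setT H -> (forall v, 0 <= H v) ->
  \int[@lebesgue_rV R n.+1]_v H v =
  \int[leb]_(r in `]0%R, +oo[%classic)
    ((r ^+ n)%:E * \int[@cone_measure R n]_v H (r *: v)%R).
Proof.
elim: n H => [|n IH] H mH H0.
  rewrite integral_lebesgue_rVS//.
  have h s : \int[@lebesgue_rV R 0]_u H (cons_rV s u) = H (s *: const_mx 1)%R.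
    rewrite integral_lebesgue_rV0; last exact: (measurableT_comp mH (measurable_fun_cons s)).
    congr (H _); apply/rowP => j; have -> : j = ord0 by rewrite (ord1 j).
    by rewrite cons_rV0 !mxE mulr1.
  under eq_integral do rewrite h.
  have mHs : measurable_fun setT (fun s : R => H (s *: const_mx 1)%R).
    by apply: (measurableT_comp mH); apply: measurable_fun_scalerV.
  rewrite integral_symm//; apply: eq_integral => r _.
  rewrite expr0 mul1e integral_cone0//; last first.
    by apply: (measurableT_comp mH); apply: measurable_fun_scalerV => //; exact: measurable_id.
  congr (_ + H _); apply/rowP => j; rewrite !mxE; ring.
rewrite integral_lebesgue_rVS//.
pose K (p : measurableTypeR R * measurableTypeR R) :=
  \int[@cone_measure R n]_v H (cons_rV p.1 (p.2 *: v)%R).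
have K0 p : 0 <= K p by exact: integral_ge0.
have mK : measurable_fun setT K.
  apply: (@measurable_int_cone _ _ n
    (fun q : (measurableTypeR R * measurableTypeR R) * 'rV[R]_n.+1 => H (cons_rV q.1.1 (q.1.2 *: q.2)%R))) => //.
  apply: (measurableT_comp mH).
  pose g (q : (measurableTypeR R * measurableTypeR R) * 'rV[R]_n.+1) :
    measurableTypeR R * 'rV[R]_n.+1 := (q.1.1, (q.1.2 *: q.2)%R).
  apply: (measurableT_comp (@measurable_cons_rV R n.+1) (g := g)).
  apply: measurable_fun_pair; first exact: (measurableT_comp measurable_fst measurable_fst).
  apply: measurable_fun_scalerV => //.
  exact: (measurableT_comp measurable_snd measurable_fst).
pose k (p : measurableTypeR R * measurableTypeR R) :=
  ((fun q : measurableTypeR R * measurableTypeR R =>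
     (`|q.2| ^+ n)%:E * K q) \_ [set q | (0 < q.2)%R]) p.
have mD : measurable [set q : measurableTypeR R * measurableTypeR R | (0 < q.2)%R].
  have := @measurable_snd _ _ (measurableTypeR R) (measurableTypeR R) measurableT
    `]0%R, +oo[%classic (measurable_itv _).
  by rewrite setTI; congr measurable; apply/seteqP; split => q /=; rewrite in_itv/= andbT.
have mk : measurable_fun setT k.
  apply: measurable_patchT => //; apply: emeasurable_funM => //.
  apply/measurable_EFinP; apply: measurable_funX; apply: measurableT_comp => //.
have k0 p : 0 <= k p.
  by apply: erestrict_ge0 => q _; rewrite mule_ge0// lee_fin exprn_ge0.
transitivity (\int[leb]_s \int[leb]_r k (s, r)).
  apply: eq_integral => s _; rewrite IH; last 2 first.
  - exact: (measurableT_comp mH (measurable_fun_cons s)).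
  - by [].
  rewrite integral_mkcond; apply: eq_integral => r _; rewrite /k !patchE.
  have -> : (r \in `]0%R, +oo[%classic) = (0 < r)%R.
    by apply/idP/idP; rewrite inE/= in_itv/= andbT.
  have -> : ((s, r) \in [set q : measurableTypeR R * measurableTypeR R | (0 < q.2)%R]) = (0 < r)%R.
    by apply/idP/idP; rewrite inE.
  by case: ifPn => // r0; rewrite gtr0_norm.
(* The radius in the slice is [r - |s|]. *)
pose tau (p : measurableTypeR R * measurableTypeR R) : measurableTypeR R * measurableTypeR R :=
  (p.1, p.2 - `|p.1|)%R.
have mtau : measurable_fun setT tau.
  apply: measurable_fun_pair => //; apply: measurable_funB => //.
  exact: measurableT_comp.
transitivity (\int[leb]_s \int[leb]_r (k \o tau) (s, r)).
  apply: eq_integral => s _.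
  rewrite (ge0_integral_affine (a := 1%R) (- `|s|)%R) ?oner_eq0//; last first.
    exact: (measurableT_comp mk (measurable_pair1 _)).
  by rewrite normr1 mul1e; apply: eq_integral => r _; rewrite mul1r.
rewrite fubini_tonelli//; [|exact: measurableT_comp|by move=> p; exact: k0].
rewrite [RHS]integral_mkcond; apply: eq_integral => r _; rewrite patchE.
case: ifPn => [/set_mem/=|/negP hr]; last first.
  apply: integral0_eq => s _; rewrite /k /tau /= patchE memNset//= => h.
  apply: hr; rewrite inE/= in_itv/= andbT; have := normr_ge0 s; lra.
rewrite in_itv/= andbT => r0.
rewrite integral_coneS//; last first.
  by apply: (measurableT_comp mH); apply: measurable_fun_scalerV => //; exact: measurable_id.
pose G (t : R) := ((fun s : R => ((1 - `|s|) ^+ n)%:E *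
  \int[@cone_measure R n]_v H (r *: cons_rV s ((1 - `|s|) *: v))%R) \_ `](-1)%R, 1%R[%classic) t.
have G0 t : 0 <= G t.
  apply: erestrict_ge0 => u /=; rewrite in_itv/= => u1.
  rewrite mule_ge0 ?integral_ge0// lee_fin exprn_ge0// subr_ge0 ler_norml; lra.
(* The substitution [s = r * t] at fixed [r]. *)
have kG s : k (tau (s, r)) = (r ^+ n)%:E * G (r^-1 * s + 0)%R.
  rewrite /k /tau /G addr0 !patchE /=.
  have rs : (`|r^-1 * s| = r^-1 * `|s|)%R by rewrite normrM gtr0_norm// invr_gt0.
  have E1 : (r * (1 - r^-1 * `|s|) = r - `|s|)%R by field; rewrite gt_eqF.
  have -> : ((r^-1 * s)%R \in `](-1)%R, 1%R[%classic) = (0 < r - `|s|)%R.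
    rewrite -E1 pmulr_rgt0// subr_gt0 -rs ltr_norml.
    by apply/idP/idP; rewrite inE/= in_itv/=.
  have -> : ((s, (r - `|s|)%R) \in [set q : measurableTypeR R * measurableTypeR R | (0 < q.2)%R])
      = (0 < r - `|s|)%R by apply/idP/idP; rewrite inE.
  case: ifPn => [rs0|_]; last by rewrite mule0.
  rewrite muleA -EFinM rs -exprMn E1 gtr0_norm//; congr (_ * _); apply: eq_integral => v _.
  by rewrite cons_rVZ scalerA E1 mulrA divff ?gt_eqF// mul1r.
transitivity (\int[leb]_s ((r ^+ n)%:E * G (r^-1 * s + 0)%R)).
  by apply: eq_integral => s _; rewrite -kG.
have mabs : measurable_fun setT (fun t : R => 1 - `|t|)%R.
  by apply: measurable_funB => //; exact: normr_measurable.
have mG : measurable_fun setT G.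
  apply: measurable_patchT; first exact: measurable_itv.
  apply: emeasurable_funM.
    by apply/measurable_EFinP; apply: measurable_funX.
  apply: (@measurable_int_cone _ _ n (fun q : measurableTypeR R * 'rV[R]_n.+1 =>
    H (r *: cons_rV q.1 ((1 - `|q.1|) *: q.2))%R)) => //.
  apply: (measurableT_comp mH); apply: measurable_fun_scalerV => //.
  pose g (q : measurableTypeR R * 'rV[R]_n.+1) : measurableTypeR R * 'rV[R]_n.+1 :=
    (q.1, ((1 - `|q.1|) *: q.2)%R).
  apply: (measurableT_comp (@measurable_cons_rV R n.+1) (g := g)).
  apply: measurable_fun_pair => //.
  by apply: measurable_fun_scalerV => //; exact: (measurableT_comp mabs measurable_fst).
have maf : measurable_fun setT (fun s : R => G (r^-1 * s + 0)%R).
  by apply: (measurableT_comp mG); exact: measurable_affine.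
rewrite ge0_integralZl//; last by rewrite lee_fin exprn_ge0// ltW.
rewrite [in RHS]integral_mkcond -/G [in RHS](ge0_integral_affine (a := r^-1%R) 0%R)//; last first.
  by rewrite invr_eq0 gt_eqF.
rewrite muleA -EFinM gtr0_norm ?invr_gt0//; congr (_%:E * _).
by rewrite exprS mulrAC divff ?mul1r// gt_eqF.
Qed.

End polar.

(** * The surface measure of the l1 sphere *)

Section sphere_area.
Context {R : realType}.
Local Notation leb := (@lebesgue_measure R).

(** The partial derivatives of the graph functions [c + s * |u|_1], as limits of
difference quotients that make sense at every point. *)
Definition abs_slope (s x : R) : R := lim (h^-1 *: (s * (`|h + x| - `|x|)) @[h --> (0 : R)^']).

Lemma abs_slopeE s x : x != 0 -> abs_slope s x = s * Num.sg x.
Proof.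
move=> x0; apply: cvg_lim => //.
apply: cvg_near_cst; near=> h.
have h0 : h != 0 by near: h; exact: nbhs_dnbhs_neq.
have hx : `|h| < `|x|.
  near: h; apply: dnbhs0_lt; by rewrite normr_gt0.
have -> : `|h + x| - `|x| = Num.sg x * h.
  move: hx; have [xn|xp|xe] := ltgtP x 0; last by move: (x0); rewrite xe eqxx.
  - rewrite (ltr0_norm xn) (ltr0_sg xn) => hx; rewrite mulN1r ltr0_norm; first by ring.
    by move: hx; rewrite ltr_norml; lra.
  - rewrite (gtr0_norm xp) (gtr0_sg xp) => hx; rewrite mul1r gtr0_norm; first by ring.
    by move: hx; rewrite ltr_norml; lra.
by rewrite /GRing.scale/=; field.
Unshelve. all: by end_near. Qed.

Lemma abs_slope_sqr s x : s ^+ 2 = 1 -> x != 0 -> abs_slope s x ^+ 2 = 1.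
Proof. by move=> s1 x0; rewrite abs_slopeE// exprMn s1 mul1r sqr_sg x0. Qed.

(** At 0 the limit may not exist and then has an arbitrary value, which a
measurability statement has to carry along. *)
Lemma measurable_abs_slope s : measurable_fun setT (abs_slope s).
Proof.
rewrite (_ : abs_slope s = fun x => if x == 0 then abs_slope s 0 else
    if 0 < x then s else - s); last first.
  apply/funext => x; case: eqP => [->//|/eqP x0]; rewrite abs_slopeE//.
  by case: ltgtP x0 => // [xp|xn] _; rewrite ?(gtr0_sg xp) ?(ltr0_sg xn) ?mulr1 ?mulrN1.
apply: measurable_fun_if => //=; first exact: measurable_fun_eqr.
by apply: measurable_funTS; apply: measurable_fun_if => //; exact: measurable_fun_ltr.
Qed.

Lemma derive_l1norm n (s c : R) (j : 'I_n) (u : 'rV[R]_n) :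
  'D_(delta_mx ord0 j) (fun u => c + s * l1norm u) u = abs_slope s (u ord0 j).
Proof.
rewrite /derive /abs_slope.
set g1 := (fun h => _); set g2 := (fun h => h^-1 *: (s * _)).
suff -> : g1 = g2 by [].
apply/funext => h; rewrite /g1 /g2; congr (_ *: _) => /=.
rewrite opprD addrACA subrr add0r -mulrBr; congr (_ * _).
rewrite /l1norm (bigD1 j)//= [in X in _ - X](bigD1 j)//= !mxE !eqxx mulr1.
rewrite [X in _ + X - _](_ : _ = \sum_(i < n | i != j) `|u ord0 i|); first by ring.
apply: eq_bigr => i ij; rewrite !mxE eqxx (negPf ij) mulr0 add0r//.
Qed.

Local Open Scope ereal_scope.

Definition axis_plane n (j : 'I_n) : set 'rV[R]_n := [set u | u ord0 j = 0%R].

Lemma measurable_axis_plane n (j : 'I_n) : measurable (axis_plane j).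
Proof.
rewrite -[X in measurable X]setTI.
exact: (@measurable_coord R n j measurableT [set 0%R] (measurable_set1 _)).
Qed.

Lemma lebesgue_rV_indic n (A : set 'rV[R]_n) : measurable A ->
  @lebesgue_rV R n A = \int[@lebesgue_rV R n]_u (\1_A u)%:E.
Proof. by move=> mA; rewrite integral_indic// setIT. Qed.

(** Induction on the dimension: only the slices orthogonal to the axis of [j] carry
the hyperplane, and there is a single one of them when [j] is the first index. *)
Lemma lebesgue_rV_hyperplane n (j : 'I_n) :
  @lebesgue_rV R n (axis_plane j) = 0.
Proof.
elim: n j => [[]//|n IH] j.
rewrite lebesgue_rV_indic; last exact: measurable_axis_plane.
rewrite integral_lebesgue_rVS//; last first.
  by apply/measurable_EFinP; apply: measurable_indic; exact: measurable_axis_plane.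
case: (unliftP ord0 j) => [k ->|->].
  apply: integral0_eq => s _; rewrite -[RHS](IH k) lebesgue_rV_indic; last exact: measurable_axis_plane.
  apply: eq_integral => u _; congr EFin; rewrite !indicE; congr (nat_of_bool _)%:R.
  by apply/idP/idP => /set_mem h; apply/mem_set; move: h; rewrite /axis_plane/= cons_rVS.
rewrite -(setUv [set 0%R]) ge0_integral_setU//; last 4 first.
- exact: measurableC.
- apply: measurable_funTS; apply: (@measurable_int_cons _ _ (fun v => (\1_(axis_plane (ord0 : 'I_n.+1)) v)%:E)) => //.
  by apply/measurable_EFinP; apply: measurable_indic; exact: measurable_axis_plane.
- by move=> s _; exact: integral_ge0.
- exact/disj_setPCl.
rewrite [X in X + _]null_set_integral ?add0e//; last 2 first.
- apply: measurable_funTS; apply: (@measurable_int_cons _ _ (fun v => (\1_(axis_plane (ord0 : 'I_n.+1)) v)%:E)) => //.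
  by apply/measurable_EFinP; apply: measurable_indic; exact: measurable_axis_plane.
- exact: lebesgue_measure_set1.
apply: integral0_eq => s /= s0; apply: integral0_eq => u _.
by rewrite indicE memNset// /axis_plane/= cons_rV0.
Qed.

Definition off_axes n (u : 'rV[R]_n) := forall j, u ord0 j != 0%R.

Lemma lebesgue_rV_off_axes n : {ae @lebesgue_rV R n, forall u, off_axes u}.
Proof.
apply: filter_forall => j; exists (axis_plane j); split.
- exact: measurable_axis_plane.
- exact: lebesgue_rV_hyperplane.
- by move=> u /= /negP; rewrite negbK => /eqP.
Qed.

(** Off the coordinate hyperplanes every partial derivative has square 1, so the area
element [sqrt (1 + n)] is constant almost everywhere. *)
Lemma graph_areaE n (s c : R) (A : set 'rV[R]_n.+1) (D : set 'rV[R]_n) :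
  (s ^+ 2 = 1)%R -> measurable D -> measurable A ->
  graph_area (d := n.+1) (fun u => c + s * l1norm u)%R D A =
  (Num.sqrt n.+1%:R)%:E * @lebesgue_rV R n
    ((fun u => rcons_rV (d := n.+1) u (c + s * l1norm u)%R) @^-1` A `&` D).
Proof.
move=> s1 mD mA; rewrite /graph_area.
pose phi (u : 'rV[R]_n) := (c + s * l1norm u)%R.
have mphi : measurable_fun setT phi.
  by apply: measurable_funD => //; apply: measurable_funM => //; exact: measurable_l1norm.
have mr : measurable_fun setT (fun u : 'rV[R]_n => rcons_rV (d := n.+1) u (phi u)).
  by apply: measurable_rcons_rV => //; exact: measurable_id.
set E := (X in lebesgue_rV X).
have mE : measurable E.
  by apply: measurableI => //; rewrite -[X in measurable X]setTI; exact: mr.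
rewrite /= setIC -/E.
transitivity (\int[@lebesgue_rV R n]_(u in E)
    (cst ((Num.sqrt n.+1%:R)%:E) u)); last by rewrite integral_cst.
apply: ge0_ae_eq_integral => //.
- under eq_fun do under eq_bigr do rewrite derive_l1norm.
  apply/measurable_EFinP; apply: measurable_funTS.
  apply: measurableT_comp; first exact: continuous_measurable_fun (@sqrt_continuous R).
  apply: measurable_funD => //; apply: measurable_sum => j.
  by apply: measurable_funX; apply: measurableT_comp (measurable_coord j); exact: measurable_abs_slope.
- by move=> u _; rewrite lee_fin sqrtr_ge0.
- apply: filterS (lebesgue_rV_off_axes n) => u hu _; congr EFin; congr Num.sqrt.
  under eq_bigr do rewrite derive_l1norm abs_slope_sqr//.
  by rewrite sumr_const card_ord -[in RHS]addn1 natrD addrC.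
Qed.

Lemma l1sphere_areaE n (A : set 'rV[R]_n.+1) : measurable A ->
  l1sphere_area (d := n.+1) A = (Num.sqrt n.+1%:R)%:E * @cone_measure R n A.
Proof.
move=> mA; rewrite /l1sphere_area /cone_measure ge0_muleDr; last 2 first.
- exact: lebesgue_rV_ge0.
- exact: lebesgue_rV_ge0.
have E1 : (fun u : 'rV[R]_n => 1 - l1norm u)%R = (fun u => 1 + (-1) * l1norm u)%R.
  by apply/funext => u; rewrite mulN1r.
have E2 : (fun u : 'rV[R]_n => l1norm u - 1)%R = (fun u => -1 + 1 * l1norm u)%R.
  by apply/funext => u; rewrite mul1r addrC.
rewrite /= E1 E2 !graph_areaE ?sqrrN ?expr1n//; last 2 first.
- exact: measurable_open_l1ball.
- exact: measurable_open_l1ball.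
have -> : (fun u : 'rV[R]_n => rcons_rV (d := n.+1) u (1 + -1 * l1norm u))%R = @cap_pos R n.
  by apply/funext => u; rewrite /cap_pos mulN1r.
have -> : (fun u : 'rV[R]_n => rcons_rV (d := n.+1) u (-1 + 1 * l1norm u))%R = @cap_neg R n.
  by apply/funext => u; rewrite /cap_neg mul1r addrC.
by [].
Qed.

(** The constant area element cancels in the normalization. *)
Lemma uniform_l1sphereE n (mu : set 'rV[R]_n.+1 -> \bar R) : uniform_l1sphere mu ->
  forall A, measurable A -> mu A = ((@cone_mass R n)^-1)%:E * @cone_measure R n A.
Proof.
move=> umu A mA; rewrite umu//.
have mS : measurable (@l1sphere R n.+1).
  rewrite -[X in measurable X]setTI.
  exact: (@measurable_l1norm R n.+1 measurableT [set 1%R] (measurable_set1 _)).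
rewrite !l1sphere_areaE//.
have -> : @cone_measure R n (@l1sphere R n.+1) = (@cone_mass R n)%:E.
  rewrite -cone_measureT -[in RHS](setUv (@l1sphere R n.+1)) measureU//; last 2 first.
  - exact: measurableC.
  - exact: setICr.
  by rewrite [X in _ + X]cone_measure_sphere adde0.
have := @cone_measure_fin R n A mA; case: (@cone_measure R n A) => [r _|//|//].
rewrite -!EFinM /=; congr EFin; have s0 : Num.sqrt n.+1%:R != 0%R :> R.
  by rewrite sqrtr_eq0 -ltNge.
have := @cone_mass_gt0 R n => k0; field.
by rewrite s0 gt_eqF.
Qed.

End sphere_area.

(** * A Poincare inequality on the l1 sphere *)

Section uniform_law.
Context {R : realType}.

Lemma cone_massV_ge0 n : 0 <= (@cone_mass R n)^-1.
Proof. by rewrite invr_ge0 ltW// cone_mass_gt0. Qed.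

Definition unif_sphere n : set 'rV[R]_n.+1 -> \bar R :=
  mscale (NngNum (cone_massV_ge0 n)) (@cone_measure R n).

HB.instance Definition _ n := Measure.on (@unif_sphere n).

Lemma unif_sphereT n : @unif_sphere n setT = 1%E.
Proof.
rewrite /unif_sphere /mscale/= cone_measureT -EFinM mulVf//.
by rewrite gt_eqF// cone_mass_gt0.
Qed.

HB.instance Definition _ n := Measure_isProbability.Build _ _ _ (@unif_sphere n)
  (@unif_sphereT n).

Lemma measurable_sphere n : measurable (@l1sphere R n).
Proof.
rewrite -[X in measurable X]setTI.
exact: (@measurable_l1norm R n measurableT [set 1] (measurable_set1 _)).
Qed.

Lemma uniform_l1sphere_unif n (mu : set 'rV[R]_n.+1 -> \bar R) : uniform_l1sphere mu ->
  forall A, measurable A -> mu A = @unif_sphere n A.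
Proof. by move=> umu A mA; rewrite (uniform_l1sphereE umu). Qed.

Local Notation S n := (@l1sphere R n.+1).

Lemma unif_sphereC n : @unif_sphere n (~` S n) = 0%E.
Proof. by rewrite /unif_sphere /mscale/= cone_measure_sphere mule0. Qed.

Lemma unif_sphere1 n : @unif_sphere n (S n) = 1%E.
Proof.
rewrite -(@unif_sphereT n) -[in RHS](setUv (S n)) measureU//; last 3 first.
- exact: measurable_sphere.
- by apply: measurableC; exact: measurable_sphere.
- exact: setICr.
by rewrite [X in (_ + X)%E]unif_sphereC adde0.
Qed.

Local Open Scope ereal_scope.

Lemma integral_unif n (H : 'rV[R]_n.+1 -> \bar R) :
  measurable_fun setT H -> (forall v, 0 <= H v) ->
  \int[@unif_sphere n]_v H v = ((@cone_mass R n)^-1)%:E * \int[@cone_measure R n]_v H v.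
Proof. by move=> mH H0; rewrite /unif_sphere ge0_integral_mscale. Qed.

Lemma integral_cone_unif n (H : 'rV[R]_n.+1 -> \bar R) :
  measurable_fun setT H -> (forall v, 0 <= H v) ->
  \int[@cone_measure R n]_v H v = (@cone_mass R n)%:E * \int[@unif_sphere n]_v H v.
Proof.
move=> mH H0; rewrite integral_unif// muleA -EFinM divff ?mul1e//.
by rewrite gt_eqF// cone_mass_gt0.
Qed.

(** The complement of the sphere is a null set. *)
Lemma integral_on_sphere n (H : 'rV[R]_n.+1 -> \bar R) :
  measurable_fun setT H -> (forall v, 0 <= H v) ->
  \int[@unif_sphere n]_v H v = \int[@unif_sphere n]_(v in S n) H v.
Proof.
move=> mH H0; have mS := @measurable_sphere n.+1.
rewrite -[in LHS](setUv (S n)) ge0_integral_setU//; last 3 first.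
- exact: measurableC.
- exact: measurable_funTS.
- exact/disj_setPCl.
rewrite [X in _ + X]null_set_integral ?adde0//; first exact: measurableC.
- exact: measurable_funTS.
- exact: unif_sphereC.
Qed.

Definition bdd_sphere n (g : 'rV[R]_n.+1 -> R) := exists M : R, forall v, l1norm v = 1%R -> (`|g v| <= M)%R.

Lemma bdd_sphere_integrable n (g : 'rV[R]_n.+1 -> R) : measurable_fun setT g -> bdd_sphere g ->
  (@unif_sphere n).-integrable (S n) (EFin \o g).
Proof.
move=> mg [M gM]; have mS := @measurable_sphere n.+1.
apply: (@le_integrable _ _ _ _ _ mS _ (cst M%:E)).
- by apply/measurable_EFinP; exact: measurable_funTS.
- by move=> v Sv /=; rewrite lee_fin (le_trans (gM _ Sv))// ler_norm.
- exact: finite_measure_integrable_cst.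
Qed.

(** The mean over the sphere alone: outside of it, the functions of interest may be
unbounded. *)
Definition sphere_mean n (g : 'rV[R]_n.+1 -> R) : R := (\int[@unif_sphere n]_(v in S n) g v)%R.

Lemma sphere_meanE n (g : 'rV[R]_n.+1 -> R) : measurable_fun setT g -> bdd_sphere g ->
  (forall v, 0 <= g v)%R -> \int[@unif_sphere n]_v (g v)%:E = (sphere_mean g)%:E.
Proof.
move=> mg bg g0; rewrite integral_on_sphere//; last exact/measurable_EFinP.
rewrite /sphere_mean /Rintegral fineK//; apply: integrable_fin_num.
  exact: measurable_sphere.
exact: bdd_sphere_integrable.
Qed.

Local Close Scope ereal_scope.

Lemma bdd_sphereD n (f g : 'rV[R]_n.+1 -> R) : bdd_sphere f -> bdd_sphere g ->
  bdd_sphere (fun v => f v + g v).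
Proof.
move=> [M fM] [N gN]; exists (M + N) => v Sv.
by rewrite (le_trans (ler_normD _ _))// lerD ?fM ?gN.
Qed.

Lemma bdd_sphereM n (f g : 'rV[R]_n.+1 -> R) : bdd_sphere f -> bdd_sphere g ->
  bdd_sphere (fun v => f v * g v).
Proof.
move=> [M fM] [N gN]; exists (M * N) => v Sv.
by rewrite normrM ler_pM ?fM ?gN.
Qed.

Lemma bdd_sphere_cst n (c : R) : bdd_sphere (fun _ : 'rV[R]_n.+1 => c).
Proof. by exists `|c|. Qed.

Lemma bdd_sphere_lip n (K : R) (F : 'rV[R]_n.+1 -> R) : l1lip K F -> bdd_sphere F.
Proof.
move=> lF; exists (`|F 0| + K) => v v1.
have := lF v 0; rewrite subr0 v1 mulr1 => h.
by rewrite -(subrKC (F 0) (F v)) (le_trans (ler_normD _ _))// lerD2l.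
Qed.

Lemma sphere_mean_cst n (c : R) : sphere_mean (fun _ : 'rV[R]_n.+1 => c) = c.
Proof.
rewrite /sphere_mean Rintegral_cst; last exact: measurable_sphere.
transitivity (c * fine (1 : \bar R)%E); last by rewrite mulr1.
by congr (c * fine _); exact: unif_sphere1.
Qed.

Lemma sphere_meanD n (f g : 'rV[R]_n.+1 -> R) : measurable_fun setT f -> measurable_fun setT g ->
  bdd_sphere f -> bdd_sphere g -> sphere_mean (fun v => f v + g v) = sphere_mean f + sphere_mean g.
Proof.
move=> mf mg bf bg; apply: RintegralD; [exact: measurable_sphere|exact: bdd_sphere_integrable..].
Qed.

Lemma sphere_meanZ n (c : R) (f : 'rV[R]_n.+1 -> R) : measurable_fun setT f ->
  bdd_sphere f -> sphere_mean (fun v => c * f v) = c * sphere_mean f.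
Proof.
move=> mf bf; apply: RintegralZl; [exact: measurable_sphere|exact: bdd_sphere_integrable].
Qed.

Lemma sphere_mean_le n (f g : 'rV[R]_n.+1 -> R) : measurable_fun setT f -> measurable_fun setT g ->
  bdd_sphere f -> bdd_sphere g -> (forall v, l1norm v = 1 -> f v <= g v) ->
  sphere_mean f <= sphere_mean g.
Proof.
move=> mf mg bf bg fg; apply: le_Rintegral => //; [exact: measurable_sphere|exact: bdd_sphere_integrable..].
Qed.

Lemma sphere_mean_dist n (f g : 'rV[R]_n.+1 -> R) (c : R) : measurable_fun setT f -> measurable_fun setT g ->
  bdd_sphere f -> bdd_sphere g -> (forall v, l1norm v = 1 -> `|f v - g v| <= c) ->
  `|sphere_mean f - sphere_mean g| <= c.
Proof.
move=> mf mg bf bg fg.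
have h (f1 g1 : 'rV[R]_n.+1 -> R) : measurable_fun setT f1 -> measurable_fun setT g1 ->
  bdd_sphere f1 -> bdd_sphere g1 -> (forall v, l1norm v = 1 -> `|f1 v - g1 v| <= c) ->
  sphere_mean f1 <= sphere_mean g1 + c.
  move=> mf1 mg1 bf1 bg1 fg1; rewrite -[c in leRHS](@sphere_mean_cst n) -sphere_meanD//; last exact: bdd_sphere_cst.
  apply: sphere_mean_le => //.
  - exact: measurable_funD.
  - by apply: bdd_sphereD => //; exact: bdd_sphere_cst.
  - by move=> v /fg1; rewrite ler_norml; lra.
have h1 := h _ _ mf mg bf bg fg.
have h2 : sphere_mean g <= sphere_mean f + c by apply: h => // v v1; rewrite distrC fg.
by rewrite ler_norml; lra.
Qed.

(** The bias-variance decomposition around an arbitrary centre [b]. *)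
Lemma sphere_mean_sqr_shift n (g : 'rV[R]_n.+1 -> R) (b : R) : measurable_fun setT g -> bdd_sphere g ->
  sphere_mean (fun v => (g v - b) ^+ 2) = sphere_mean (fun v => (g v - sphere_mean g) ^+ 2) + (sphere_mean g - b) ^+ 2.
Proof.
move=> mg bg.
have h c : sphere_mean (fun v => (g v - c) ^+ 2) =
    sphere_mean (fun v => g v * g v) + (- 2 * c) * sphere_mean g + c ^+ 2.
  rewrite -sphere_meanZ// -[c ^+ 2 in RHS](@sphere_mean_cst n) -!sphere_meanD//.
  - by congr sphere_mean; apply/funext => v; ring.
  - by apply: measurable_funD; [exact: measurable_funM|exact: measurable_funM].
  - by apply: bdd_sphereD; apply: bdd_sphereM => //; exact: bdd_sphere_cst.
  - exact: bdd_sphere_cst.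
  - exact: measurable_funM.
  - exact: measurable_funM.
  - exact: bdd_sphereM.
  - by apply: bdd_sphereM => //; exact: bdd_sphere_cst.
by rewrite !h; ring.
Qed.

Lemma cons_rVB n s t (u v : 'rV[R]_n) : cons_rV s u - cons_rV t v = cons_rV (s - t) (u - v).
Proof. by rewrite -scaleN1r cons_rVZ cons_rVD mulN1r scaleN1r. Qed.

(** The conditional function given the first coordinate lives on a sphere rescaled by
[1 - |s|], hence the gain in the Lipschitz constant. *)
Lemma l1lip_cons n (K : R) (F : 'rV[R]_n.+2 -> R) s : l1lip K F -> `|s| <= 1 ->
  l1lip (K * (1 - `|s|)) (fun v => F (cons_rV s ((1 - `|s|) *: v))).
Proof.
move=> lF s1 u v; rewrite (le_trans (lF _ _))//.
rewrite cons_rVB l1norm_cons subrr normr0 add0r.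
by rewrite -scalerBr l1normZ ger0_norm ?subr_ge0// mulrA.
Qed.

(** A Beta integral. *)
Lemma integral_sqr_onemX n :
  (\int[@lebesgue_measure R]_(s in `](-1)%R, 1%R[%classic) ((s ^+ 2 * (1 - `|s|) ^+ n)%:E) =
  (4 / (n.+1%:R * n.+2%:R * n.+3%:R))%:E)%E.
Proof.
have -> : (\int[@lebesgue_measure R]_(s in `](-1)%R, 1%R[%classic) (s ^+ 2 * (1 - `|s|) ^+ n)%:E =
  \int[@lebesgue_measure R]_(s in `](-1)%R, 1%R[%classic) (fun t => `|t ^+ 2 * (1 - t) ^+ n|%:E) `|s|%R)%E.
  apply: eq_integral => s; rewrite inE/= in_itv/= => s1.
  rewrite (ger0_norm (x := `|s| ^+ 2 * _)) ?real_normK ?num_real//.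
  rewrite mulr_ge0 ?sqr_ge0// exprn_ge0// subr_ge0 ler_norml; lra.
rewrite (integral_absitv (g := fun t : R => `|t ^+ 2 * (1 - t) ^+ n|%:E)); last 2 first.
- apply/measurable_EFinP; apply: measurableT_comp => //; apply: measurable_funM.
    exact: measurable_funX.
  by apply: measurable_funX; apply: measurable_funB.
- by move=> x; rewrite lee_fin.
have -> : (\int[@lebesgue_measure R]_(s in `[0%R, 1%R]%classic) `|s ^+ 2 * (1 - s) ^+ n|%:E =
    (beta_fun 3 n.+1)%:E)%E.
  rewrite EFin_beta_fun integral_mkcond; apply: eq_integral => s _.
  rewrite !patchE; case: ifPn => //; rewrite inE/= in_itv/= => s1.
  by rewrite ger0_norm// mulr_ge0 ?sqr_ge0// exprn_ge0// subr_ge0; lra.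
rewrite beta_fun_fact -EFinM; congr EFin.
have n0 : n`!%:R != 0 :> R by rewrite pnatr_eq0 -lt0n fact_gt0.
rewrite add2n !factS fact0 !natrM; field.
have nn := ler0n R n.
by apply/and4P; split => //; apply: lt0r_neq0; lra.
Qed.

Lemma measurable_cons_sphere n : measurable_fun setT
  (fun p : R * 'rV[R]_n => cons_rV p.1 ((1 - `|p.1|) *: p.2)).
Proof.
pose g (q : measurableTypeR R * 'rV[R]_n) : measurableTypeR R * 'rV[R]_n :=
  (q.1, ((1 - `|q.1|) *: q.2)%R).
apply: (measurableT_comp (@measurable_cons_rV R n) (g := g)).
apply: measurable_fun_pair => //; apply: measurable_fun_scalerV => //.
by apply: measurable_funB => //; exact: (measurableT_comp (@normr_measurable R setT) measurable_fst).
Qed.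

Local Open Scope ereal_scope.

Lemma measurable_int_unif n (H : 'rV[R]_n.+2 -> \bar R) :
  measurable_fun setT H -> (forall v, 0 <= H v) ->
  measurable_fun setT (fun s : R => \int[@unif_sphere n]_v H (cons_rV s ((1 - `|s|) *: v)%R)).
Proof.
move=> mH H0.
apply: (@measurable_fun_fubini_tonelli_F _ _ _ _ _ (@unif_sphere n)
  (fun p : measurableTypeR R * 'rV[R]_n.+1 => H (cons_rV p.1 ((1 - `|p.1|) *: p.2)%R))) => //.
exact: (measurableT_comp mH (@measurable_cons_sphere _)).
Qed.

(** The law of the first coordinate, and the conditional law of the others. *)
Lemma integral_unifS n (H : 'rV[R]_n.+2 -> \bar R) :
  measurable_fun setT H -> (forall v, 0 <= H v) ->
  \int[@unif_sphere n.+1]_v H v =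
  (n.+1%:R / 2)%:E * \int[@lebesgue_measure R]_(s in `](-1)%R, 1%R[%classic)
    (((1 - `|s|) ^+ n)%:E * \int[@unif_sphere n]_v H (cons_rV s ((1 - `|s|) *: v)%R)).
Proof.
move=> mH H0; rewrite integral_unif// integral_coneS//.
have mHs s : measurable_fun setT (fun v : 'rV[R]_n.+1 => H (cons_rV s ((1 - `|s|) *: v)%R)).
  apply: (measurableT_comp mH); apply: (measurableT_comp (measurable_fun_cons s)).
  by apply: measurable_fun_scalerV => //; exact: measurable_id.
under eq_integral do rewrite (integral_cone_unif (mHs _))// muleCA.
have mi := measurable_int_unif mH H0.
have m1 : measurable_fun setT (fun s : R => ((1 - `|s|) ^+ n)%:E).
  apply/measurable_EFinP; apply: measurable_funX.
  by apply: measurable_funB => //; exact: normr_measurable.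
rewrite ge0_integralZl//; last 3 first.
- by apply: measurable_funTS; exact: emeasurable_funM.
- move=> s /=; rewrite in_itv/= => s1; rewrite mule_ge0 ?integral_ge0// lee_fin exprn_ge0// subr_ge0 ler_norml; lra.
- by rewrite lee_fin ltW// cone_mass_gt0.
rewrite muleA -EFinM; congr (_%:E * _).
rewrite cone_massS; have := @cone_mass_gt0 R n => k0; field.
by rewrite addrC natr1 !gt_eqF//=.
Qed.

Local Close Scope ereal_scope.

(** Induction on the dimension by the law of total variance along the first coordinate
[s]. The conditional variance is bounded by the induction hypothesis for the
Lipschitz constant [K (1 - |s|)], and the conditional mean moves by at most
[2 K |s|]. Integrating both against the law of [s] gives exactly
[8 K^2 / (n + 3)]: the constant 8 is the one that the recursion reproduces. *)
Lemma sphere_mean_variance n (K : R) (F : 'rV[R]_n.+1 -> R) : 0 <= K -> l1lip K F ->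
  sphere_mean (fun v => (F v - sphere_mean F) ^+ 2) <= 8 * K ^+ 2 / n.+2%:R.
Proof.
elim: n K F => [|n IH] K F K0 lF.
  have mF := l1lip_measurable K0 lF; have bF := bdd_sphere_lip lF.
  (* In dimension one the sphere is {1, -1}. *)
  pose a := (F (const_mx 1) + F (const_mx (-1))) / 2.
  have mFa : measurable_fun setT (fun v : 'rV[R]_1 => (F v - a) ^+ 2).
    by apply: measurable_funX; apply: measurable_funB.
  have bFa : bdd_sphere (fun v => (F v - a) ^+ 2).
    by under eq_fun do rewrite expr2; apply: bdd_sphereM; apply: bdd_sphereD => //; exact: bdd_sphere_cst.
  apply: (@le_trans _ _ (sphere_mean (fun v => (F v - a) ^+ 2))).
    by rewrite (sphere_mean_sqr_shift a mF bF) lerDl sqr_ge0.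
  rewrite -lee_fin -sphere_meanE//; last by move=> v; exact: sqr_ge0.
  rewrite integral_unif//; [|exact/measurable_EFinP|by move=> v; rewrite lee_fin sqr_ge0].
  rewrite integral_cone0//; [|exact/measurable_EFinP|by move=> v; rewrite lee_fin sqr_ge0].
  rewrite -EFinD -EFinM lee_fin /cone_mass expr1 fact0 divr1.
  have := lF (const_mx 1) (const_mx (-1)).
  rewrite /l1norm big_ord1 !mxE opprK (_ : `|1 + 1| = 2); last by rewrite ger0_norm.
  move=> h; have {}h : (F (const_mx 1) - F (const_mx (-1))) ^+ 2 <= (K * 2) ^+ 2.
    by rewrite -real_normK ?num_real// lerXn2r// nnegrE// mulr_ge0.
  have := sqr_ge0 K; rewrite /a; move: h; move: (F _) (F _) => p q; rewrite !expr2; lra.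
have mF := l1lip_measurable K0 lF; have bF := bdd_sphere_lip lF.
pose G s (v : 'rV[R]_n.+1) := F (cons_rV s ((1 - `|s|) *: v)).
(* The variance is bounded by the second moment around the conditional mean at [s = 0]. *)
pose a := sphere_mean (G 0).
have lG (s : R) : `|s| <= 1 -> l1lip (K * (1 - `|s|)) (G s) by move=> s1; exact: l1lip_cons.
have K1 (s : R) : `|s| <= 1 -> 0 <= K * (1 - `|s|) by move=> s1; rewrite mulr_ge0// subr_ge0.
have mG (s : R) : `|s| <= 1 -> measurable_fun setT (G s).
  by move=> s1; exact: l1lip_measurable (K1 _ s1) (lG _ s1).
have bG (s : R) : `|s| <= 1 -> bdd_sphere (G s) by move=> s1; exact: bdd_sphere_lip (lG _ s1).
have dG (s : R) : `|s| <= 1 -> `|sphere_mean (G s) - a| <= 2 * K * `|s|.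
  move=> s1; apply: sphere_mean_dist; [exact: mG|by apply: mG; rewrite normr0|exact: bG|by apply: bG; rewrite normr0|].
  move=> v v1; rewrite (le_trans (lF _ _))// cons_rVB l1norm_cons subr0 normr0 subr0 -scalerBl l1normZ v1 mulr1.
  rewrite (_ : 1 - `|s| - 1 = - `|s|) ?normrN ?normr_id; [lra|ring].
have mFa : measurable_fun setT (fun v : 'rV[R]_n.+2 => (F v - a) ^+ 2).
  by apply: measurable_funX; apply: measurable_funB.
have bsq m (f : 'rV[R]_m.+1 -> R) b : bdd_sphere f -> bdd_sphere (fun v => (f v - b) ^+ 2).
  by move=> bf; under eq_fun do rewrite expr2; apply: bdd_sphereM; apply: bdd_sphereD => //; exact: bdd_sphere_cst.
apply: (@le_trans _ _ (sphere_mean (fun v => (F v - a) ^+ 2))).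
  by rewrite (sphere_mean_sqr_shift a mF bF) lerDl sqr_ge0.
rewrite -lee_fin -sphere_meanE//; [|exact: bsq|by move=> v; exact: sqr_ge0].
have mFe : measurable_fun setT (fun v : 'rV[R]_n.+2 => ((F v - a) ^+ 2)%:E) by exact/measurable_EFinP.
have Fe0 (v : 'rV[R]_n.+2) : (0 <= ((F v - a) ^+ 2)%:E)%E by rewrite lee_fin sqr_ge0.
rewrite integral_unifS//.
pose c1 := 8 * K ^+ 2 / n.+2%:R; pose c2 := 4 * K ^+ 2.
have c10 : 0 <= c1 by rewrite divr_ge0// mulr_ge0// sqr_ge0.
have c20 : 0 <= c2 by rewrite mulr_ge0// sqr_ge0.
have m1 k : measurable_fun setT (fun s : R => ((1 - `|s|) ^+ k)%:E).
  apply/measurable_EFinP; apply: measurable_funX.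
  by apply: measurable_funB => //; exact: normr_measurable.
have m2 : measurable_fun setT (fun s : R => (s ^+ 2 * (1 - `|s|) ^+ n)%:E).
  apply/measurable_EFinP; apply: measurable_funM; first exact: measurable_funX.
  by apply: measurable_funX; apply: measurable_funB => //; exact: normr_measurable.
have itv1 (s : R) : `](-1)%R, 1%R[%classic s -> `|s| < 1.
  by rewrite /= in_itv/= ltr_norml.
have pw k (s : R) : `](-1)%R, 1%R[%classic s -> 0 <= (1 - `|s|) ^+ k.
  by move=> /itv1 s1; rewrite exprn_ge0// subr_ge0 ltW.
apply: (@le_trans _ _ ((n.+1%:R / 2)%:E * \int[@lebesgue_measure R]_(s in `](-1)%R, 1%R[%classic)
    (c1%:E * ((1 - `|s|) ^+ n.+2)%:E + c2%:E * (s ^+ 2 * (1 - `|s|) ^+ n)%:E))%E).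
  apply: lee_wpmul2l; first by rewrite lee_fin divr_ge0.
  apply: ge0_le_integral => //.
  - move=> s /itv1 s1; rewrite mule_ge0 ?integral_ge0// lee_fin exprn_ge0// subr_ge0 ltW//.
  - by apply: measurable_funTS; apply: emeasurable_funM; [exact: m1|exact: (measurable_int_unif mFe Fe0)].
  - apply: measurable_funTS; apply: emeasurable_funD.
      by apply: emeasurable_funM => //; exact: m1.
    by apply: emeasurable_funM => //; exact: m2.
  - move=> s /itv1 /ltW s1.
    have -> : (\int[@unif_sphere n]_v ((F (cons_rV s ((1 - `|s|) *: v)) - a) ^+ 2)%:E =
        (sphere_mean (fun v => (G s v - a) ^+ 2))%:E)%E.
      rewrite -sphere_meanE//; [|by apply: bsq; exact: bG|by move=> v; exact: sqr_ge0].
      by apply: measurable_funX; apply: measurable_funB => //; exact: mG.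
    rewrite (sphere_mean_sqr_shift a (mG _ s1) (bG _ s1)) -!EFinM lee_fin.
    have h1 := IH _ _ (K1 _ s1) (lG _ s1).
    have h2 : (sphere_mean (G s) - a) ^+ 2 <= (2 * K * `|s|) ^+ 2.
      by rewrite -real_normK ?num_real// lerXn2r ?dG// nnegrE// !mulr_ge0.
    have w0 : 0 <= (1 - `|s|) ^+ n by rewrite exprn_ge0// subr_ge0.
    apply: (@le_trans _ _ ((1 - `|s|) ^+ n *
      (8 * (K * (1 - `|s|)) ^+ 2 / n.+2%:R + (2 * K * `|s|) ^+ 2))).
      by rewrite ler_wpM2l// lerD.
    have -> : (2 * K * `|s|) ^+ 2 = 4 * K ^+ 2 * s ^+ 2.
      by rewrite exprMn real_normK ?num_real//; ring.
    rewrite le_eqVlt; apply/orP; left; apply/eqP; rewrite /c1 /c2 [_ ^+ n.+2]exprS [_ ^+ n.+1]exprS.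
    by field; rewrite gt_eqF//; have := ler0n R n; lra.
have p1 (s : R) : `](-1)%R, 1%R[%classic s -> (0 <= ((1 - `|s|) ^+ n.+2)%:E)%E.
  by move=> s1; rewrite lee_fin pw.
have p2 (s : R) : `](-1)%R, 1%R[%classic s -> (0 <= (s ^+ 2 * (1 - `|s|) ^+ n)%:E)%E.
  by move=> s1; rewrite lee_fin mulr_ge0 ?sqr_ge0// pw.
rewrite ge0_integralD//; last 4 first.
- by move=> s s1; rewrite mule_ge0// p1.
- by apply: measurable_funTS; apply: emeasurable_funM => //; exact: m1.
- by move=> s s1; rewrite mule_ge0// p2.
- by apply: measurable_funTS; apply: emeasurable_funM => //; exact: m2.
rewrite ge0_integralZl//; last by apply: measurable_funTS; exact: m1.
rewrite ge0_integralZl//; last by apply: measurable_funTS; exact: m2.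
rewrite integral_absonemX integral_sqr_onemX.
apply: (@le_trans _ _ (n.+1%:R / 2 * (c1 * (2 / n.+3%:R) +
  c2 * (4 / (n.+1%:R * n.+2%:R * n.+3%:R))))%:E); first exact: lexx.
rewrite lee_fin /c1 /c2 le_eqVlt; apply/orP; left; apply/eqP; field.
have nn := ler0n R n.
by apply/and3P; split => //; apply: lt0r_neq0; lra.
Qed.

Lemma sphere_meanN n (f : 'rV[R]_n.+1 -> R) : measurable_fun setT f -> bdd_sphere f ->
  (forall v, 0 <= f v) -> sphere_mean (fun v => f (- v)) = sphere_mean f.
Proof.
move=> mf bf f0; apply: EFin_inj; rewrite -!sphere_meanE//; last 2 first.
- exact: (measurableT_comp mf (@measurable_oppV R n.+1)).
- by have [M fM] := bf; exists M => v v1; apply: fM; rewrite l1normN.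
have mfe : measurable_fun setT (fun v : 'rV[R]_n.+1 => (f v)%:E) by exact/measurable_EFinP.
have mfNe : measurable_fun setT (fun v : 'rV[R]_n.+1 => (f (- v))%:E).
  exact: (measurableT_comp mfe (@measurable_oppV R n.+1)).
have fe0 (v : 'rV[R]_n.+1) : (0 <= (f v)%:E)%E by rewrite lee_fin.
by rewrite !integral_unif//; congr (_ * _)%E; exact: (cone_measureN mfe fe0).
Qed.

(** [F v - F (- v)] is a difference of two centred variables with the same law. *)
Lemma sphere_mean_odd_sqr n (K : R) (F : 'rV[R]_n.+1 -> R) : 0 <= K -> l1lip K F ->
  sphere_mean (fun v => (F v - F (- v)) ^+ 2) <= 32 * K ^+ 2 / n.+2%:R.
Proof.
move=> K0 lF; have mF := l1lip_measurable K0 lF; have bF := bdd_sphere_lip lF.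
have mFN : measurable_fun setT (fun v : 'rV[R]_n.+1 => F (- v)).
  exact: (measurableT_comp mF (@measurable_oppV R n.+1)).
have bN (f : 'rV[R]_n.+1 -> R) : bdd_sphere f -> bdd_sphere (fun v => f (- v)).
  by move=> [M fM]; exists M => v v1; apply: fM; rewrite l1normN.
pose q v := (F v - sphere_mean F) ^+ 2.
have mq : measurable_fun setT q by apply: measurable_funX; apply: measurable_funB.
have bq : bdd_sphere q.
  by rewrite /q; under eq_fun do rewrite expr2; apply: bdd_sphereM; apply: bdd_sphereD => //; exact: bdd_sphere_cst.
have mqN : measurable_fun setT (fun v : 'rV[R]_n.+1 => q (- v)).
  exact: (measurableT_comp mq (@measurable_oppV R n.+1)).
have bqN := bN _ bq.
apply: (@le_trans _ _ (sphere_mean (fun v => 2 * (q v + q (- v))))).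
  apply: sphere_mean_le.
  - by apply: measurable_funX; apply: measurable_funB.
  - by apply: measurable_funM => //; exact: measurable_funD.
  - have b1 : bdd_sphere (fun v => F v - F (- v)).
      have [M fM] := bF; exists (M + M) => v v1.
      by rewrite (le_trans (ler_normB _ _))// lerD ?fM// l1normN.
    by under eq_fun do rewrite expr2; exact: bdd_sphereM.
  - by apply: bdd_sphereM; [exact: bdd_sphere_cst|exact: bdd_sphereD].
  - move=> v _; rewrite /q; move: (F v) (F (- v)) (sphere_mean F) => a b c.
    have := sqr_ge0 (a - c + (b - c)); rewrite !expr2; lra.
rewrite sphere_meanZ; [|exact: measurable_funD|exact: bdd_sphereD].
rewrite sphere_meanD// sphere_meanN//; last by move=> v; exact: sqr_ge0.
have : sphere_mean q <= 8 * K ^+ 2 / n.+2%:R := sphere_mean_variance K0 lF.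
by rewrite -[8 * _ / _]mulrA -[32 * _ / _]mulrA; move: (_ / _) => r; lra.
Qed.

End uniform_law.

(** * Radial integrals and the ramp *)

Section radial.
Context {R : realType}.
Local Notation leb := (@lebesgue_measure R).
Local Notation mu n := (@lebesgue_rV R n).
Local Open Scope ereal_scope.

Lemma integral_shift n (w : 'rV[R]_n) (H : 'rV[R]_n -> \bar R) : measurable_fun setT H ->
  \int[mu n]_x H (x + w)%R = \int[mu n]_x H x.
Proof.
have ge0 (G : 'rV[R]_n -> \bar R) : measurable_fun setT G -> (forall x, 0 <= G x) ->
    \int[mu n]_x G (x + w)%R = \int[mu n]_x G x.
  move=> mG G0; rewrite [RHS](ge0_integral_rV_affine (a := 1%R) w) ?oner_eq0//.
  by rewrite normr1 expr1n mul1e; apply: eq_integral => x _; rewrite scale1r.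
move=> mH; rewrite integralE [RHS]integralE; congr (_ - _).
  have -> : (fun x : 'rV[R]_n => H (x + w)%R)^\+ = H^\+ \o (fun x => x + w)%R := funepos_comp H _.
  by apply: (ge0 (H^\+)); [exact: measurable_funepos|move=> x; exact: funepos_ge0].
have -> : (fun x : 'rV[R]_n => H (x + w)%R)^\- = H^\- \o (fun x => x + w)%R := funeneg_comp H _.
by apply: (ge0 (H^\-)); [exact: measurable_funeneg|move=> x; exact: funeneg_ge0].
Qed.

Lemma polar_radial n (g : R -> \bar R) : measurable_fun setT g -> (forall r, 0 <= g r) ->
  \int[mu n.+1]_v g (l1norm v) =
  (@cone_mass R n)%:E * \int[leb]_(r in `]0%R, +oo[%classic) ((r ^+ n)%:E * g r).
Proof.
move=> mg g0.
have mgl m : measurable_fun setT (fun v : 'rV[R]_m => g (l1norm v)).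
  exact: (measurableT_comp mg (@measurable_l1norm R m)).
rewrite polar// -ge0_integralZl//; last 3 first.
- apply: measurable_funTS; apply: emeasurable_funM => //.
  by apply/measurable_EFinP; exact: measurable_funX.
- by move=> r /=; rewrite in_itv/= andbT => r0; rewrite mule_ge0// lee_fin exprn_ge0// ltW.
- by rewrite lee_fin ltW// cone_mass_gt0.
apply: eq_integral => r; rewrite inE/= in_itv/= andbT => r0.
rewrite muleCA; congr (_ * _); rewrite integral_cone_unif//; last first.
  apply: (measurableT_comp (mgl n.+1)).
  by apply: measurable_fun_scalerV => //; exact: measurable_id.
congr (_ * _); rewrite integral_on_sphere//; last first.
  apply: (measurableT_comp (mgl n.+1)).
  by apply: measurable_fun_scalerV => //; exact: measurable_id.
transitivity (\int[@unif_sphere R n]_(v in @l1sphere R n.+1) (cst (g r) v)).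
  apply: eq_integral => v; rewrite inE /l1sphere/= => v1.
  by rewrite l1normZ v1 mulr1 gtr0_norm.
rewrite integral_cst; last exact: measurable_sphere.
by rewrite [X in _ * X]unif_sphere1 mule1.
Qed.

Definition l1sphere_at n (c : R) : set 'rV[R]_n := [set v | l1norm v = c].

Lemma lebesgue_rV_sphere0 n c : mu n.+1 (@l1sphere_at n.+1 c) = 0.
Proof.
have mS : measurable (@l1sphere_at n.+1 c).
  rewrite -[X in measurable X]setTI.
  exact: (@measurable_l1norm R n.+1 measurableT [set c] (measurable_set1 _)).
have -> : mu n.+1 (@l1sphere_at n.+1 c) = \int[mu n.+1]_v (\1_[set c] (l1norm v))%:E.
  rewrite lebesgue_rV_indic//; apply: eq_integral => v _; congr EFin.
rewrite (polar_radial n (g := fun r => (\1_[set c] r)%:E))//; last first.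
  by apply/measurable_EFinP; exact: measurable_indic.
rewrite integral_mkcond.
rewrite (ge0_ae_eq_integral (g := cst 0))//.
- by rewrite integral0 mule0.
- apply: measurable_patchT => //; apply: emeasurable_funM.
    by apply/measurable_EFinP; exact: measurable_funX.
  by apply/measurable_EFinP; exact: measurable_indic.
- move=> r _; apply: erestrict_ge0 => s /=; rewrite in_itv/= andbT => s0.
  by rewrite mule_ge0// lee_fin exprn_ge0// ltW.
- exists [set c]; split => //; first exact: lebesgue_measure_set1.
  move=> r /= hr; apply: contrapT => rc; apply: hr => _.
  by rewrite patchE; case: ifPn => // _; rewrite indicE memNset//= mule0.
Qed.

Lemma integral_itv_exp n : \int[leb]_(r in `]0%R, 1%R]%classic) (r ^+ n)%:E = (n.+1%:R^-1)%:E.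
Proof.
have mX : measurable_fun setT (fun r : R => (r ^+ n)%:E).
  by apply/measurable_EFinP; exact: measurable_funX.
have mY : measurable_fun setT (fun r : R => ((1 - r) ^+ n)%:E).
  by apply/measurable_EFinP; apply: measurable_funX; exact: measurable_funB.
rewrite integral_itv_obnd_cbnd; last exact: measurable_funTS.
have -> : \int[leb]_(r in `[0%R, 1%R]%classic) (r ^+ n)%:E =
  \int[leb]_(r in `[0%R, 1%R]%classic) (((1 - r)) ^+ n)%:E; last exact: integral_onemX.
rewrite (integration_by_substitution_onem (G := fun r : R => (r ^+ n)%R)) ?lexx ?ler01//.
  by rewrite onem1.
by apply: continuous_subspaceT => x; exact: exprn_continuous.
Qed.

Local Close Scope ereal_scope.

(** The indicator of the radii [r <= 1], made Lipschitz by a linear decay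
between the radii 1 and [1 + d]. *)
Definition ramp (d r : R) : R := Num.min 1 (Num.max 0 ((1 + d - r) / d)).

Lemma ramp_ge0 d r : (0 <= ramp d r)%R.
Proof. by rewrite /ramp le_min ler01 le_max lexx. Qed.

Lemma ramp_le1 d r : (ramp d r <= 1)%R.
Proof. by rewrite /ramp ge_min lexx. Qed.

Lemma ramp1 d r : (0 < d)%R -> (r <= 1)%R -> ramp d r = 1%R.
Proof.
move=> d0 r1; rewrite /ramp; apply/min_idPl; rewrite le_max; apply/orP; right.
by rewrite ler_pdivlMr//; lra.
Qed.

Lemma ramp0 d r : (0 < d)%R -> (1 + d <= r)%R -> ramp d r = 0%R.
Proof.
move=> d0 r1; rewrite /ramp (_ : Num.max _ _ = 0%R) ?(min_idPr ler01)//.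
by apply/max_idPl; rewrite ler_pdivrMr//; lra.
Qed.

Lemma ramp_mid d r : (0 < d)%R -> (1 <= r <= 1 + d)%R -> ramp d r = ((1 + d - r) / d)%R.
Proof.
move=> d0 r1; rewrite /ramp (_ : Num.max _ _ = ((1 + d - r) / d)%R).
  by apply/min_idPr; rewrite ler_pdivrMr//; lra.
by apply/max_idPr; rewrite divr_ge0//; lra.
Qed.

Lemma ramp_lip (d r s : R) : (0 < d)%R -> (`|ramp d r - ramp d s| <= `|r - s| / d)%R.
Proof.
move=> d0.
wlog rs : r s / (r <= s)%R => [h|].
  by have [rs|/ltW sr] := leP r s; [exact: h|rewrite distrC (distrC r s); exact: h].
have hd : (`|r - s| / d = (s - r) / d)%R by rewrite distrC ger0_norm// subr_ge0.
have xs : ((1 + d - r) / d = (1 + d - s) / d + (s - r) / d)%R by field; lra.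
have p0 : (0 <= (s - r) / d)%R by rewrite divr_ge0//; lra.
rewrite hd /ramp xs; move: ((1 + d - s) / d)%R ((s - r) / d)%R p0 => x p p0.
rewrite ler_norml; apply/andP; split; rewrite /Order.min /Order.max;
  (case: (ltP 0 x) => ?; case: (ltP 0 (x + p)) => ?;
   do 2?[case: ltP => ?]); lra.
Qed.

Lemma measurable_ramp d : measurable_fun setT (ramp d).
Proof.
apply: measurable_minr => //; apply: measurable_maxr => //.
by apply: measurable_funM => //; apply: measurable_funB.
Qed.

(** The opposite of the derivative of the ramp, except at its two corners. *)
Definition ramp_slope (d r : R) : R := if (1 < r) && (r < 1 + d) then d^-1 else 0.

Lemma measurable_ramp_slope d : measurable_fun setT (ramp_slope d).
Proof.
apply: measurable_fun_if => //; apply: measurable_and; exact: measurable_fun_ltr.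
Qed.

Lemma ramp_slope_ge0 d r : 0 < d -> 0 <= ramp_slope d r.
Proof. by move=> d0; rewrite /ramp_slope; case: ifP => // _; rewrite invr_ge0 ltW. Qed.

(** The first-order expansion of the ramp has no remainder near a point that is not a
corner. With [sign_near], this makes the difference quotients below eventually
constant, so that no differentiation is needed. *)
Lemma ramp_near (d r a : R) : 0 < d -> r != 1 -> r != 1 + d ->
  \forall e \near (0 : R)^'+, ramp d (r - e * a) - ramp d r = e * (a * ramp_slope d r).
Proof.
move=> d0 r1 r2.
have [e0 e00 he] : exists2 e0, 0 < e0 & forall e, 0 < e < e0 ->
   `|e * a| < Num.min `|r - 1| `|r - (1 + d)|.
  exists (Num.min `|r - 1| `|r - (1 + d)| / (`|a| + 1)).
    by rewrite divr_gt0 ?ltr_wpDl// lt_min !normr_gt0 !subr_eq0 r1 r2.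
  move=> e /andP[e1 e2]; rewrite normrM gtr0_norm//.
  move: e2; rewrite ltr_pdivlMr ?ltr_wpDl//; apply: le_lt_trans.
  by apply: ler_wpM2l; [exact: ltW|rewrite lerDl ler01].
near=> e.
have e1 : 0 < e by near: e; exact: nbhs_right_gt.
have e2 : e < e0 by near: e; exact: nbhs_right_lt.
have /he : 0 < e < e0 by rewrite e1.
rewrite lt_min => /andP[]; rewrite /ramp_slope.
rewrite !ltr_norml.
have [rl|rl|re] := ltgtP r 1; last by rewrite re eqxx in r1.
- rewrite ltr0_norm ?subr_lt0// => h _.
  by rewrite /= !ramp1 ?subrr ?mulr0//; lra.
- rewrite gtr0_norm ?subr_gt0// => h1.
  have [sl|sl|se] := ltgtP r (1 + d); last by rewrite se eqxx in r2.
  + rewrite ltr0_norm ?subr_lt0// => h2; rewrite /= !ramp_mid; [field; lra|lra..].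
  + rewrite gtr0_norm ?subr_gt0// => h2; rewrite /= !ramp0 ?subrr ?mulr0//; lra.
Unshelve. all: by end_near. Qed.

(** The integrability criterion for all the functions cut off by the ramp. *)
Lemma ball_bounded_integrable n (g : 'rV[R]_n.+1 -> R) (r M : R) :
  measurable_fun setT g -> (forall v, l1norm v <= r -> `|g v| <= M) ->
  (forall v, r < l1norm v -> g v = 0) -> (mu n.+1).-integrable setT (EFin \o g).
Proof.
move=> mg gM g0; apply/integrableP; split; first exact/measurable_EFinP.
pose rr : R := `|r|; pose MM : R := `|M|.
pose h (t : R) : \bar R := (MM * (nat_of_bool (t <= rr)%R)%:R)%:E.
have mh : measurable_fun setT h.
  apply/measurable_EFinP; apply: measurable_funM => //.
  rewrite (_ : (fun t => _) = \1_(`]-oo, rr]%classic)); last first.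
    by apply/funext => t; rewrite indicE; congr (nat_of_bool _)%:R;
      apply/idP/idP; rewrite inE/= in_itv.
  exact: measurable_indic.
have h0 t : (0 <= h t)%E by rewrite /h lee_fin mulr_ge0 ?ler0n ?normr_ge0.
apply: (@le_lt_trans _ _ (\int[mu n.+1]_v h (l1norm v))%E).
  apply: ge0_le_integral => //.
  - by apply: measurableT_comp => //; exact/measurable_EFinP.
  - exact: (measurableT_comp mh (@measurable_l1norm R _)).
  - move=> v _; rewrite /h /= lee_fin.
    have [vr|rv] := leP (l1norm v) r; last by rewrite g0// normr0 mulr_ge0 ?ler0n ?normr_ge0.
    have -> : l1norm v <= rr by rewrite (le_trans vr)// ler_norm.
    by rewrite mulr1 (le_trans (gM _ vr))// ler_norm.
rewrite polar_radial//; apply: lte_mul_pinfty; rewrite ?lee_fin ?(ltW (cone_mass_gt0 _))//.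
pose C := MM * rr ^+ n.
have C0 : 0 <= C by rewrite mulr_ge0 ?exprn_ge0 ?normr_ge0.
apply: (@le_lt_trans _ _ (\int[leb]_(t in `[0%R, rr]%classic) (cst C%:E t))%E).
  rewrite integral_mkcond [leRHS]integral_mkcond; apply: ge0_le_integral => //.
  - move=> t _; apply: erestrict_ge0 => u /=; rewrite in_itv/= andbT => u0.
    by rewrite mule_ge0// lee_fin exprn_ge0// ltW.
  - apply: measurable_patchT => //; apply: emeasurable_funM => //.
    by apply/measurable_EFinP; exact: measurable_funX.
  - exact: measurable_patchT.
  - move=> t _; rewrite !patchE; case: ifPn => [|_]; last first.
      by case: ifP => // _; rewrite lee_fin.
    rewrite inE/= in_itv/= andbT => t0; rewrite /h.
    have [tr|rt] := leP t rr; last by rewrite mulr0 mule0; case: ifP => // _; rewrite lee_fin.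
    rewrite ifT; last by rewrite inE/= in_itv/= (ltW t0).
    rewrite mulr1 -EFinM lee_fin /C mulrC; apply: ler_wpM2l; first exact: normr_ge0.
    by rewrite lerXn2r ?nnegrE ?normr_ge0// ltW.
rewrite integral_cst//= lebesgue_measure_itv/= lte_fin.
by case: ifPn => _; rewrite ?mule0 ?ltry// -EFinD -EFinM ltry.
Qed.

(** The l1 norm is linear on each open orthant. *)
Lemma sign_near n (y w : 'rV[R]_n) : off_axes y ->
  \forall e \near (0 : R)^'+, l1norm (y - e *: w) = l1norm y - e * dotp (sign_rV y) w.
Proof.
move=> y0.
have : \forall e \near (0 : R)^'+, forall j, `|y ord0 j - e * w ord0 j| = `|y ord0 j| - e * (sign_rV y ord0 j * w ord0 j).
  apply: filter_forall => j.
  have hy := y0 j; near=> e.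
  have e1 : 0 < e by near: e; exact: nbhs_right_gt.
  have e2 : e < `|y ord0 j| / (`|w ord0 j| + 1).
    by near: e; apply: nbhs_right_lt; rewrite divr_gt0 ?normr_gt0// ltr_wpDl.
  have ew : `|e * w ord0 j| < `|y ord0 j|.
    rewrite normrM gtr0_norm//; move: e2; rewrite ltr_pdivlMr ?ltr_wpDl//; apply: le_lt_trans.
    by apply: ler_wpM2l; [exact: ltW|rewrite lerDl ler01].
  rewrite mxE; move: ew; rewrite ltr_norml; have [yl|yl|ye] := ltgtP 0 (y ord0 j).
  - by rewrite (gtr0_norm yl) => ew; rewrite gtr0_norm; [ring|lra].
  - by rewrite (ltr0_norm yl) => ew; rewrite ltr0_norm; [ring|lra].
  - by move: (hy); rewrite -ye eqxx.
apply: filterS => e he; rewrite /l1norm /dotp mulr_sumr -sumrB.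
by apply: eq_bigr => j _; rewrite !mxE he mxE.
Unshelve. all: by end_near. Qed.

End radial.

(** * Convexity against the smoothed ball *)

Section smoothing.
Context {R : realType}.
Local Notation mu n := (@lebesgue_rV R n).

(** Convexity along the segment from [u] in the direction [v], in the form of an upper
bound for the increments. *)
Definition segment_convex n (F : 'rV[R]_n -> R) := forall u v (t : R), 0 <= t <= 1 ->
  F (u + t *: v) <= F u + t * (F (u + v) - F u).

Lemma measurable_dotp_sign n (w : 'rV[R]_n) :
  measurable_fun setT (fun y : 'rV[R]_n => dotp (sign_rV y) w).
Proof.
apply: measurable_sum => j; apply: measurable_funM => //.
under eq_fun do rewrite mxE; apply: measurable_fun_if => //.
by apply: measurable_fun_ler => //; exact: measurable_coord.
Qed.

Lemma dotp_sign_le n (y w : 'rV[R]_n) : `|dotp (sign_rV y) w| <= l1norm w.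
Proof.
rewrite (le_trans (ler_norm_sum _ _ _))//; apply: ler_sum => j _.
by rewrite normrM mxE; case: ifP => _; rewrite ?normrN normr1 mul1r.
Qed.

Lemma near_right_harmonic (P : R -> Prop) : (\forall e \near (0 : R)^'+, P e) ->
  \forall k \near \oo, P (k.+1%:R^-1).
Proof.
move=> [e /= e0 he]; near=> k; apply: he => /=; last by rewrite invr_gt0.
rewrite sub0r normrN gtr0_norm ?invr_gt0//.
by near: k; exact: (near_infty_natSinv_lt (PosNum e0)).
Unshelve. all: by end_near. Qed.

Lemma l1lip_bound n (K : R) (F : 'rV[R]_n -> R) (r : R) y : 0 <= K -> l1lip K F ->
  l1norm y <= r -> `|F y| <= `|F 0| + K * r.
Proof.
move=> K0 lF yr; rewrite -(subrKC (F 0) (F y)) (le_trans (ler_normD _ _))// lerD2l.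
by rewrite (le_trans (lF _ _))// subr0 ler_wpM2l.
Qed.

Lemma measurable_shift n (w : 'rV[R]_n) : measurable_fun setT (fun y : 'rV[R]_n => y + w).
Proof. by apply: measurable_fun_addrV; [exact: measurable_id|exact: measurable_cst]. Qed.

Lemma measurable_l1sphere_at n (c : R) : measurable (@l1sphere_at R n c).
Proof.
rewrite -[X in measurable X]setTI.
exact: (@measurable_l1norm R n measurableT [set c] (measurable_set1 _)).
Qed.

Lemma ae_l1norm_neq n (c : R) : {ae mu n.+1, forall y, ~ l1sphere_at c y}.
Proof.
exists (@l1sphere_at R n.+1 c); split.
- exact: measurable_l1sphere_at.
- exact: lebesgue_rV_sphere0.
- by move=> y /= /contrapT.
Qed.

(** Let [phi y = ramp d |y|_1]. By translation invariance, the integral of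
[(phi (y - e w) - phi y) * F y] is the integral of [phi y * (F (y + e w) - F y)],
which convexity bounds by [e] times the right-hand side. Dividing by [e] and
letting [e] tend to 0, the left-hand side follows by dominated convergence. *)
Lemma ramp_gradient_le n (K : R) (F : 'rV[R]_n.+1 -> R) (w : 'rV[R]_n.+1) (d : R) :
  0 <= K -> l1lip K F -> segment_convex F -> 0 < d <= 1 ->
  \int[mu n.+1]_y (dotp (sign_rV y) w * ramp_slope d (l1norm y) * F y) <=
  \int[mu n.+1]_y (ramp d (l1norm y) * (F (y + w) - F y)).
Proof.
move=> K0 lF cF /andP[d0 d1].
have mF := l1lip_measurable K0 lF.
have mN : measurable_fun setT (@l1norm R n.+1) := @measurable_l1norm R n.+1.
have mR : measurable_fun setT (fun y : 'rV[R]_n.+1 => ramp d (l1norm y)).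
  exact: (measurableT_comp (measurable_ramp d) mN).
have mS : measurable_fun setT (fun y : 'rV[R]_n.+1 => ramp_slope d (l1norm y)).
  exact: (measurableT_comp (measurable_ramp_slope d) mN).
have mFw v : measurable_fun setT (fun y : 'rV[R]_n.+1 => F (y + v)).
  exact: (measurableT_comp mF (measurable_shift v)).
(* The steps of the translation run through [1 / (k + 1)]. *)
pose e (k : nat) : R := k.+1%:R^-1.
have e0 k : 0 < e k by rewrite invr_gt0.
have e1 k : e k <= 1 by rewrite invf_le1// ler1n.
have ke k : k.+1%:R * e k = 1 by rewrite divff.
pose r0 := 2 + l1norm w.
have w0 := l1norm_ge0 w.
pose Rk k (y : 'rV[R]_n.+1) := ramp d (l1norm (y - e k *: w)).
have mRk k : measurable_fun setT (Rk k).
  apply: (measurableT_comp (measurable_ramp d)); apply: (measurableT_comp mN).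
  exact: measurable_shift.
pose D k y := k.+1%:R * (Rk k y - ramp d (l1norm y)) * F y.
pose L y := dotp (sign_rV y) w * ramp_slope d (l1norm y) * F y.
have mD k : measurable_fun setT (D k).
  by apply: measurable_funM => //; apply: measurable_funM => //; exact: measurable_funB.
have mL : measurable_fun setT L.
  by apply: measurable_funM => //; apply: measurable_funM => //; exact: measurable_dotp_sign.
have ewk k : l1norm (e k *: w) <= l1norm w.
  by rewrite l1normZ gtr0_norm// ler_piMl.
have far k y : r0 < l1norm y -> 1 + d <= l1norm (y - e k *: w).
  move=> hy; have := l1normD (y - e k *: w) (e k *: w); rewrite subrK.
  have := ewk k; move: hy; rewrite /r0; lra.
have D0 k y : r0 < l1norm y -> D k y = 0.
  move=> hy; rewrite /D /Rk !ramp0 ?subrr ?mulr0 ?mul0r//; last exact: far.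
  by move: hy; rewrite /r0; lra.
pose C := l1norm w / d * (`|F 0| + K * r0).
have C0 : 0 <= C by rewrite mulr_ge0 ?divr_ge0 ?addr_ge0 ?mulr_ge0// ?ltW// /r0; lra.
have DC k y : l1norm y <= r0 -> `|D k y| <= C.
  move=> hy; rewrite /D normrM ler_pM//; last exact: l1lip_bound.
  rewrite normrM ger0_norm// mulrC -ler_pdivlMr// /Rk.
  rewrite (le_trans (ramp_lip _ _ d0))// ler_pdivrMr// mulrAC divfK ?gt_eqF//.
  have -> : l1norm w / k.+1%:R = l1norm (e k *: w).
    by rewrite l1normZ gtr0_norm// mulrC.
  have h1 := l1normD (y - e k *: w) (e k *: w); rewrite subrK in h1.
  have h2 := l1normD y (- (e k *: w)); rewrite l1normN in h2.
  by rewrite ler_norml; lra.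
pose g (y : 'rV[R]_n.+1) : R := if l1norm y <= r0 then C else 0.
have mg : measurable_fun setT g.
  by apply: measurable_fun_if => //; exact: measurable_fun_ler.
have ig : (mu n.+1).-integrable setT (EFin \o g).
  apply: (@ball_bounded_integrable _ _ _ r0 C) => // v.
    by rewrite /g => ->; rewrite ger0_norm.
  by rewrite /g leNgt => ->.
have ptw : {ae mu n.+1, forall y, setT y -> (EFin \o D k) y @[k --> \oo] --> (EFin \o L) y}.
  have s0 := @lebesgue_rV_off_axes R n.+1.
  have s1 := @ae_l1norm_neq n 1.
  have s2 := @ae_l1norm_neq n (1 + d).
  near=> y => _.
  have y0 : off_axes y by near: y.
  have y1 : l1norm y != 1 by apply/eqP; near: y.
  have y2 : l1norm y != 1 + d by apply/eqP; near: y.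
  apply: cvg_near_cst.
  have h1 := near_right_harmonic (sign_near w y0).
  have h2 := near_right_harmonic (ramp_near (dotp (sign_rV y) w) d0 y1 y2).
  near=> k; rewrite /= /D /Rk /L; congr EFin; congr (_ * _).
  have -> : l1norm (y - e k *: w) = l1norm y - e k * dotp (sign_rV y) w.
    by near: k; exact: h1.
  have -> : ramp d (l1norm y - e k * dotp (sign_rV y) w) - ramp d (l1norm y) =
    e k * (dotp (sign_rV y) w * ramp_slope d (l1norm y)) by near: k; exact: h2.
  by rewrite mulrA ke mul1r.
have dom : {ae mu n.+1, forall y, forall k, setT y -> (`|(EFin \o D k) y| <= (EFin \o g) y)%E}.
  apply/aeW => y k _; rewrite lee_fin /g; have [hy|hy] := leP (l1norm y) r0.
    exact: DC.
  by rewrite D0// normr0.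
have mDe k : measurable_fun setT (EFin \o D k) by exact/measurable_EFinP.
have mLe : measurable_fun setT (EFin \o L) by exact/measurable_EFinP.
have [iL _ lim] := dominated_convergence measurableT mDe mLe ptw ig dom.
pose B y := ramp d (l1norm y) * (F (y + w) - F y).
have iramp (G : 'rV[R]_n.+1 -> R) (M : R) : measurable_fun setT G ->
    (forall y, l1norm y <= r0 -> `|G y| <= M) ->
    (mu n.+1).-integrable setT (EFin \o (fun y => ramp d (l1norm y) * G y)).
  move=> mG GM; apply: (@ball_bounded_integrable _ _ _ r0 M).
  - exact: measurable_funM.
  - move=> y /GM hy; rewrite normrM ger0_norm ?ramp_ge0//.
    by rewrite (le_trans _ hy)// ler_piMl// ramp_le1.
  - by move=> y hy; rewrite ramp0 ?mul0r//; move: hy; rewrite /r0; lra.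
have dF v y : `|F (y + v) - F y| <= K * l1norm v.
  by rewrite (le_trans (lF _ _))// addrAC subrr add0r.
have iB : (mu n.+1).-integrable setT (EFin \o B).
  by apply: (iramp _ (K * l1norm w)) => //; exact: measurable_funB.
rewrite -lee_fin /Rintegral !fineK; last 2 first.
- exact: integrable_fin_num.
- exact: integrable_fin_num.
rewrite -(cvg_lim _ lim)//; apply: lime_le; first by apply/cvg_ex; eexists; exact: lim.
apply: nearW => k.
suff : (\int[mu n.+1]_y (D k y)%:E <= \int[mu n.+1]_y (B y)%:E)%E by [].
pose P1 y := ramp d (l1norm y) * F y.
pose P2 y := ramp d (l1norm y) * F (y + e k *: w).
pose P3 y := Rk k y * F y.
have i1 : (mu n.+1).-integrable setT (EFin \o P1).
  by apply: (iramp _ (`|F 0| + K * r0)) => // y hy; exact: l1lip_bound.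
have i2 : (mu n.+1).-integrable setT (EFin \o P2).
  apply: (iramp _ (`|F 0| + K * (r0 + l1norm w))) => // y hy; apply: l1lip_bound => //.
  by rewrite (le_trans (l1normD _ _))// lerD.
have i3 : (mu n.+1).-integrable setT (EFin \o P3).
  apply: (@ball_bounded_integrable _ _ _ r0 (`|F 0| + K * r0)).
  - exact: measurable_funM.
  - move=> y hy; rewrite normrM ger0_norm ?ramp_ge0//.
    by rewrite (le_trans _ (l1lip_bound K0 lF hy))// ler_piMl// ramp_le1.
  - by move=> y hy; rewrite /P3 /Rk ramp0 ?mul0r//; exact: far.
(* Translation invariance of the Lebesgue measure. *)
have E23 : (\int[mu n.+1]_y (P3 y)%:E = \int[mu n.+1]_y (P2 y)%:E)%E.
  rewrite -(@integral_shift _ _ (e k *: w) (EFin \o P3)); last exact: measurable_int i3.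
  by apply: eq_integral => y _; rewrite /= /P3 /P2 /Rk addrK.
have -> : (\int[mu n.+1]_y (D k y)%:E =
   \int[mu n.+1]_y (k.+1%:R * (P2 y - P1 y))%:E)%E.
  have -> : (\int[mu n.+1]_y (D k y)%:E = \int[mu n.+1]_y (k.+1%:R%:E * ((P3 y)%:E - (P1 y)%:E)))%E.
    apply: eq_integral => y _; rewrite /D /P3 /P1 -EFinB -EFinM; congr EFin; ring.
  rewrite integralZl//; last exact: integrableB.
  rewrite integralB// E23 -integralB// -integralZl//; last exact: integrableB.
apply: le_integral => //.
- have i21 := integrableB measurableT i2 i1.
  have := integrableZl measurableT k.+1%:R i21.
  by apply: eq_integrable => // y _; rewrite /= -EFinB -EFinM.
- move=> y _; rewrite lee_fin /P2 /P1 /B -mulrBr mulrCA ler_wpM2l ?ramp_ge0//.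
  have ek : 0 <= e k <= 1 by rewrite ltW//= e1.
  have := cF y w (e k) ek; rewrite -lerBlDl => /(ler_wpM2l (ler0n R k.+1)).
  by rewrite mulrA ke mul1r.
Unshelve. all: by end_near. Qed.

End smoothing.

(** * Radial moments of the ramp *)

Section ramp_radial.
Context {R : realType}.
Local Notation leb := (@lebesgue_measure R).
Local Open Scope ereal_scope.

(** A convex function of [d] lies below its chord between 0 and 1, whose slope
[2 ^ n - 1] is rounded up. *)
Lemma expr1D_le n (d : R) : (0 <= d <= 1)%R -> ((1 + d) ^+ n <= 1 + 2 ^+ n * d)%R.
Proof.
move=> /andP[d0 d1].
suff : ((1 + d) ^+ n <= 1 + (2 ^+ n - 1) * d)%R by nra.
elim: n => [|n IH]; first by rewrite !expr0 subrr mul0r addr0.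
rewrite exprSr [(2 ^+ n.+1)%R]exprS.
apply: (le_trans (ler_wpM2r _ IH)); first by rewrite addr_ge0.
have p1 : (1 <= 2 ^+ n :> R)%R by rewrite exprn_ege1// ler1n.
have : (0 <= (2 ^+ n - 1) * (d * (1 - d)))%R by rewrite !mulr_ge0//; lra.
move: (2 ^+ n)%R p1 => p p1; nra.
Qed.

(** The moments of the ramp are those of the indicator of [r <= 1] up to the mass of
the layer of width [d], on which [r ^ k <= 2 ^ k]. *)
Lemma ramp_moment k (d : R) : (0 < d <= 1)%R ->
  (k.+1%:R^-1)%:E <= \int[leb]_(r in `]0%R, +oo[%classic) (r ^+ k * ramp d r)%:E
    <= (k.+1%:R^-1 + 2 ^+ k * d)%:E.
Proof.
move=> /andP[d0 d1].
have mX : measurable_fun setT (fun r : R => (r ^+ k)%:E).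
  by apply/measurable_EFinP; exact: measurable_funX.
have mXr : measurable_fun setT (fun r : R => (r ^+ k * ramp d r)%:E).
  apply/measurable_EFinP; apply: measurable_funM; [exact: measurable_funX|exact: measurable_ramp].
apply/andP; split.
  rewrite -integral_itv_exp integral_mkcond [leRHS]integral_mkcond.
  apply: ge0_le_integral => //.
  - by move=> r _; apply: erestrict_ge0 => s /=; rewrite in_itv/= => /andP[s0 _];
      rewrite lee_fin exprn_ge0// ltW.
  - exact: measurable_patchT.
  - exact: measurable_patchT.
  - move=> r _; rewrite !patchE; case: ifPn => [|_].
      rewrite inE/= in_itv/= => /andP[r0 r1]; rewrite ifT ?inE/= ?in_itv/= ?r0//.
      by rewrite ramp1 ?mulr1.
    case: ifPn => // ; rewrite inE/= in_itv/= andbT => r0.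
    by rewrite lee_fin mulr_ge0 ?ramp_ge0// exprn_ge0// ltW.
have h0 : 0 <= \int[leb]_(r in `[1%R, (1 + d)%R]%classic) (cst (2 ^+ k)%:E r).
  by apply: integral_ge0 => r _; rewrite lee_fin exprn_ge0.
have -> : (k.+1%:R^-1 + 2 ^+ k * d)%:E = \int[leb]_(r in `]0%R, 1%R]%classic) (r ^+ k)%:E +
   \int[leb]_(r in `[1%R, (1 + d)%R]%classic) (cst (2 ^+ k)%:E r).
  rewrite integral_itv_exp integral_cst//= lebesgue_measure_itv/= lte_fin.
  by rewrite ltrDl d0 -EFinB -EFinM -EFinD addrAC subrr add0r.
rewrite integral_mkcond [X in _ <= X + _]integral_mkcond [X in _ <= _ + X]integral_mkcond.
rewrite -ge0_integralD//; last 4 first.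
- by move=> r _; apply: erestrict_ge0 => s /=; rewrite in_itv/= => /andP[s0 _];
    rewrite lee_fin exprn_ge0// ltW.
- exact: measurable_patchT.
- by move=> r _; apply: erestrict_ge0 => s /= _; rewrite lee_fin exprn_ge0.
- exact: measurable_patchT.
apply: ge0_le_integral => //.
- by move=> r _; apply: erestrict_ge0 => s /=; rewrite in_itv/= andbT => s0;
    rewrite lee_fin mulr_ge0 ?ramp_ge0// exprn_ge0// ltW.
- exact: measurable_patchT.
- by apply: emeasurable_funD; exact: measurable_patchT.
move=> r _.
have p0 (A : set R) : 0 <= ((cst (2 ^+ k)%:E : R -> \bar R) \_ A) r.
  by rewrite patchE; case: ifP => // _; rewrite lee_fin exprn_ge0.
have q0 : 0 <= ((fun r : R => (r ^+ k)%:E) \_ `]0%R, 1%R]%classic) r.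
  rewrite patchE; case: ifP => //; rewrite inE/= in_itv/= => /andP[r0 _].
  by rewrite lee_fin exprn_ge0// ltW.
rewrite [leLHS]patchE; case: ifPn => [|_]; last by rewrite adde_ge0.
rewrite inE/= in_itv/= andbT => r0.
have [r1|r1] := leP r 1%R.
  rewrite ramp1// mulr1; apply: le_trans (leeDl _ (p0 _)).
  by rewrite patchE ifT// inE/= in_itv/= r0.
apply: le_trans (leeDr _ q0).
have [r2|r2] := leP (1 + d)%R r; first by rewrite ramp0// mulr0 p0.
rewrite patchE ifT ?inE/= ?in_itv/= ?(ltW r1) ?(ltW r2)// lee_fin.
rewrite (@le_trans _ _ (r ^+ k)%R)//; first by rewrite ler_piMr ?ramp_le1// exprn_ge0// ltW.
by rewrite lerXn2r ?nnegrE//; lra.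
Qed.

Lemma ramp_slope_moment k (d : R) : (0 < d <= 1)%R ->
  1 <= \int[leb]_(r in `]0%R, +oo[%classic) (r ^+ k * ramp_slope d r)%:E <= ((1 + d) ^+ k)%:E.
Proof.
move=> /andP[d0 d1].
pose I := `]1%R, (1 + d)%R[%classic : set R.
have cstI (c : R) : \int[leb]_(r in I) (cst (c * d^-1)%:E r) = c%:E.
  rewrite /I integral_cst//= lebesgue_measure_itv/= lte_fin.
  by rewrite ltrDl d0 -EFinB -EFinM addrAC subrr add0r divfK// gt_eqF.
have -> : \int[leb]_(r in `]0%R, +oo[%classic) (r ^+ k * ramp_slope d r)%:E =
   \int[leb]_(r in I) (r ^+ k * d^-1)%:E.
  rewrite integral_mkcond [RHS]integral_mkcond; apply: eq_integral => r _.
  rewrite !patchE /I; case: ifPn => [|rN]; last first.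
    rewrite ifF//; apply: contraNF rN; rewrite !inE/= !in_itv/= => /andP[r1 _].
    by rewrite andbT (lt_trans ltr01).
  rewrite !inE/= in_itv/= andbT => r0; rewrite /ramp_slope.
  case: ifPn => r1; first by rewrite ifT// inE/= in_itv.
  by rewrite ifF ?mulr0//; apply: contraNF r1; rewrite inE/= in_itv.
have mk : measurable_fun I (fun r : R => (r ^+ k * d^-1)%:E).
  by apply: measurable_funTS; apply/measurable_EFinP; apply: measurable_funM.
have mI : measurable I by exact: measurable_itv.
have di : (0 <= d^-1)%R by rewrite invr_ge0 ltW.
apply/andP; split.
  rewrite -[leLHS](cstI 1%R); apply: ge0_le_integral => //.
  - by move=> r _; rewrite /= lee_fin mulr_ge0.
  - move=> r; rewrite /I /= in_itv/= => /andP[r1 _].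
    by rewrite /= lee_fin mul1r ler_peMl// exprn_ege1// ltW.
rewrite -[leRHS](cstI); apply: ge0_le_integral => //.
- move=> r; rewrite /I /= in_itv/= => /andP[r1 _].
  by rewrite lee_fin mulr_ge0// exprn_ge0//; lra.
- move=> r; rewrite /I /= in_itv/= => /andP[r1 r2].
  by rewrite lee_fin ler_wpM2r// lerXn2r ?nnegrE; lra.
Qed.

End ramp_radial.

(** * The bias of the symmetric difference estimator *)

Section sphere_gradient.
Context {R : realType}.
Local Notation leb := (@lebesgue_measure R).
Local Notation mu n := (@lebesgue_rV R n).

Lemma dotp_sign_scale n (r : R) (v w : 'rV[R]_n) : 0 < r ->
  dotp (sign_rV (r *: v)) w = dotp (sign_rV v) w.
Proof. by move=> r0; apply: eq_bigr => j _; rewrite !mxE pmulr_rge0. Qed.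

(** The slope of the ramp is the density of a probability on the radii between 1 and
[1 + d], and on this layer the integrand varies by [O(d)] along a ray. So the
integral is that of the sphere, times its mass, up to [O(d)]. *)
Lemma ramp_slope_lower n (M : R) (G : 'rV[R]_n.+1 -> R) (w : 'rV[R]_n.+1) (d : R) :
  0 <= M -> l1lip M G -> G 0 = 0 -> 0 < d <= 1 ->
  @cone_mass R n * (sphere_mean (fun v => dotp (sign_rV v) w * G v)
     - l1norm w * M * (1 + 2 ^+ n.+1) * d) <=
  \int[mu n.+1]_y (dotp (sign_rV y) w * ramp_slope d (l1norm y) * G y).
Proof.
move=> M0 lG G0 /andP[d0 d1].
have d01 : 0 < d <= 1 by rewrite d0.
have mG := l1lip_measurable M0 lG.
have w0 := l1norm_ge0 w.
have k0 := @cone_mass_gt0 R n.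
have GM r y : l1norm y <= r -> `|G y| <= M * r.
  by move=> /(l1lip_bound M0 lG); rewrite G0 normr0 add0r.
have aG r y : l1norm y <= r -> `|dotp (sign_rV y) w * G y| <= l1norm w * (M * r).
  by move=> /GM h; rewrite normrM ler_pM// dotp_sign_le.
(* [C] makes the integrand nonnegative, as the polar formula requires: on the support
   of the slope the radius is at most 2. *)
pose C := l1norm w * (M * 2).
have C0 : 0 <= C by rewrite !mulr_ge0.
pose a y := dotp (sign_rV y) w.
have ma : measurable_fun setT a by exact: measurable_dotp_sign.
pose psi (y : 'rV[R]_n.+1) := ramp_slope d (l1norm y).
have mpsi : measurable_fun setT psi.
  exact: (measurableT_comp (measurable_ramp_slope d) (@measurable_l1norm R n.+1)).
have psi0 y : 0 <= psi y by exact: ramp_slope_ge0.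
have psi2 y : 2 < l1norm y -> psi y = 0.
  move=> hy; rewrite /psi /ramp_slope; case: ifP => //; move=> /andP[_ h].
  by move: hy h d1; lra.
pose H y := (a y * G y + C) * psi y.
have mH : measurable_fun setT H.
  by apply: measurable_funM => //; apply: measurable_funD => //; exact: measurable_funM.
have H0 y : 0 <= H y.
  have [y2|/psi2 hy] := leP (l1norm y) 2; last by rewrite /H hy mulr0.
  apply: mulr_ge0; last exact: psi0.
  by have := aG _ _ y2; rewrite ler_norml /C /a; lra.
have iC : (mu n.+1).-integrable setT (EFin \o (fun y => C * psi y)).
  apply: (@ball_bounded_integrable _ _ _ 2 (C * d^-1)).
  - exact: measurable_funM.
  - move=> y _; rewrite ger0_norm ?mulr_ge0// ler_wpM2l// /psi /ramp_slope.
    by case: ifP => // _; rewrite invr_ge0 ltW.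
  - by move=> y /psi2 ->; rewrite mulr0.
have iH : (mu n.+1).-integrable setT (EFin \o H).
  apply: (@ball_bounded_integrable _ _ _ 2 ((C + C) * d^-1)) => //.
  - move=> y y2; rewrite /H normrM ler_pM//.
      by rewrite (le_trans (ler_normD _ _))// lerD ?(ger0_norm C0)//; exact: aG.
    rewrite ger0_norm// /psi /ramp_slope.
    by case: ifP => // _; rewrite invr_ge0 ltW.
  - by move=> y /psi2 hy; rewrite /H hy mulr0.
have -> : \int[mu n.+1]_y (dotp (sign_rV y) w * ramp_slope d (l1norm y) * G y) =
   \int[mu n.+1]_y H y - \int[mu n.+1]_y (C * psi y).
  rewrite -RintegralB//; apply: eq_Rintegral => y _; rewrite /H /psi /a; ring.
pose Q := sphere_mean (fun v => dotp (sign_rV v) w * G v).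
pose q := Q + C - l1norm w * M * d.
have ipsi : (mu n.+1).-integrable setT (EFin \o psi).
  apply: (@ball_bounded_integrable _ _ _ 2 d^-1) => // y _.
  by rewrite ger0_norm// /psi /ramp_slope; case: ifP => // _; rewrite invr_ge0 ltW.
have E0 : \int[mu n.+1]_y (C * psi y) <= C * (@cone_mass R n * (1 + 2 ^+ n * d)).
  rewrite RintegralZl//; apply: ler_wpM2l => //.
  rewrite -lee_fin /Rintegral fineK; last exact: integrable_fin_num.
  rewrite (polar_radial n (g := fun r => (ramp_slope d r)%:E)); last 2 first.
  - by apply/measurable_EFinP; exact: measurable_ramp_slope.
  - by move=> r; rewrite lee_fin ramp_slope_ge0.
  rewrite [leRHS]EFinM; apply: lee_pmul => //.
  - by rewrite lee_fin ltW.
  - apply: integral_ge0 => r /=; rewrite in_itv/= andbT => r0.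
    by rewrite mule_ge0// lee_fin ?exprn_ge0 ?ramp_slope_ge0// ltW.
  - have /andP[_] := @ramp_slope_moment R n d d01.
    under eq_integral do rewrite EFinM.
    move=> h; apply: (le_trans h); rewrite lee_fin.
    by apply: expr1D_le; rewrite d1 ltW.
have E1 : @cone_mass R n * q <= \int[mu n.+1]_y H y.
  have [q0|q0] := leP q 0.
    rewrite (@le_trans _ _ 0)//; first by rewrite pmulr_rle0.
    by apply: Rintegral_ge0.
  rewrite -lee_fin /Rintegral fineK; last exact: integrable_fin_num.
  have mHe : measurable_fun setT (fun y => (H y)%:E) by exact/measurable_EFinP.
  rewrite polar//.
  (* The sphere of radius [r] contributes at least as much as the unit sphere, up to [O(d)]. *)
  have inner r : 0 < r -> ((@cone_mass R n * q * ramp_slope d r)%:E <=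
      \int[@cone_measure R n]_v (H (r *: v))%:E)%E.
    move=> r0.
    have mHr : measurable_fun setT (fun v : 'rV[R]_n.+1 => H (r *: v)).
      by apply: (measurableT_comp mH); apply: measurable_fun_scalerV.
    have HrE v : l1norm v = 1 -> H (r *: v) = (a v * G (r *: v) + C) * ramp_slope d r.
      move=> v1; rewrite /H /a dotp_sign_scale// /psi l1normZ v1 mulr1.
      by rewrite gtr0_norm.
    have mHre : measurable_fun setT (fun v : 'rV[R]_n.+1 => (H (r *: v))%:E).
      exact/measurable_EFinP.
    rewrite integral_cone_unif//; last by move=> v; rewrite lee_fin.
    have bG c : bdd_sphere (fun v : 'rV[R]_n.+1 => a v * G (c *: v)).
      exists (l1norm w * (M * `|c|)) => v v1.
      by rewrite normrM ler_pM ?dotp_sign_le// GM// l1normZ v1 mulr1.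
    have mGc c : measurable_fun setT (fun v : 'rV[R]_n.+1 => a v * G (c *: v)).
      apply: measurable_funM => //; apply: (measurableT_comp mG).
      by apply: measurable_fun_scalerV => //; exact: measurable_id.
    have bHr : bdd_sphere (fun v => H (r *: v)).
      have [B hB] := bdd_sphereM (bdd_sphereD (bG r) (@bdd_sphere_cst R n C)) (@bdd_sphere_cst R n (ramp_slope d r)).
      by exists B => v v1; rewrite HrE// hB.
    rewrite sphere_meanE// -EFinM lee_fin -mulrA ler_pM2l//.
    have -> : q = sphere_mean (fun v => a v * G (1 *: v) + (C - l1norm w * M * d)).
      rewrite sphere_meanD//; last exact: bdd_sphere_cst.
      rewrite sphere_mean_cst /q -addrA; congr (sphere_mean _ + _).
      by apply/funext => v; rewrite scale1r.
    have bq : bdd_sphere (fun v : 'rV[R]_n.+1 => a v * G (1 *: v) + (C - l1norm w * M * d)).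
      by apply: bdd_sphereD => //; exact: bdd_sphere_cst.
    have mq : measurable_fun setT (fun v : 'rV[R]_n.+1 => a v * G (1 *: v) + (C - l1norm w * M * d)).
      exact: measurable_funD.
    rewrite mulrC -sphere_meanZ//; apply: sphere_mean_le => //.
    - exact: measurable_funM.
    - by apply: bdd_sphereM => //; exact: bdd_sphere_cst.
    - move=> v v1; rewrite HrE// mulrC /ramp_slope; case: ifPn => [/andP[r1 r2]|_]; last by rewrite !mulr0.
      rewrite ler_wpM2r ?invr_ge0 ?(ltW d0)//.
      suff : `|a v * G (1 *: v) - a v * G (r *: v)| <= l1norm w * M * d.
        by rewrite ler_norml => /andP[_]; lra.
      rewrite -mulrBr normrM -mulrA ler_pM//; first exact: dotp_sign_le.
      rewrite (le_trans (lG _ _))// ler_wpM2l// -scalerBl l1normZ v1 mulr1.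
      by rewrite ltr0_norm; lra.
  have /andP[h1 _] := @ramp_slope_moment R n d d01.
  have kq : 0 <= @cone_mass R n * q by rewrite mulr_ge0 ?ltW.
  apply: (@le_trans _ _ ((@cone_mass R n * q)%:E * \int[leb]_(r in `]0%R, +oo[%classic) (r ^+ n * ramp_slope d r)%:E)%E).
    by rewrite lee_pemulr ?lee_fin.
  rewrite -ge0_integralZl//; last 2 first.
  - apply: measurable_funTS; apply/measurable_EFinP; apply: measurable_funM => //.
    exact: measurable_ramp_slope.
  - move=> r /=; rewrite in_itv/= andbT => r0.
    by rewrite lee_fin mulr_ge0 ?exprn_ge0 ?ramp_slope_ge0// ltW.
  apply: ge0_le_integral => //.
  - move=> r /=; rewrite in_itv/= andbT => r0.
    by rewrite mule_ge0 ?lee_fin// mulr_ge0 ?exprn_ge0 ?ramp_slope_ge0// ltW.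
  - apply: measurable_funTS; apply: emeasurable_funM => //; apply/measurable_EFinP.
    by apply: measurable_funM => //; exact: measurable_ramp_slope.
  - apply: measurable_funTS; apply: emeasurable_funM; first by apply/measurable_EFinP.
    apply: (measurable_int_cone (H := fun p : R * 'rV[R]_n.+1 => (H (p.1 *: p.2))%:E)).
      exact: (measurableT_comp mHe (@measurable_scale_pair R n.+1)).
    by move=> p; rewrite lee_fin.
  - move=> r /=; rewrite in_itv/= andbT => r0.
    rewrite -EFinM mulrCA EFinM; apply: lee_pmul; rewrite ?lee_fin.
    - by rewrite exprn_ge0 ?(ltW r0).
    - by rewrite mulr_ge0 ?ramp_slope_ge0.
    - exact: lexx.
    - exact: inner.
have : \int[mu n.+1]_y H y - \int[mu n.+1]_y (C * psi y) >=
   @cone_mass R n * q - C * (@cone_mass R n * (1 + 2 ^+ n * d)) by rewrite lerB.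
apply: le_trans; rewrite /q /C -/Q exprS.
by rewrite le_eqVlt; apply/orP; left; apply/eqP; ring.
Qed.

(** [ramp_gradient_le] is applied to [F] in the direction [w] and to [y |-> F (- y)]
in the direction [- w]. In the sum of the right-hand sides,
[F y + F (- y) >= 2 F 0] by convexity and [F (w + y)], [F (w - y)] are at most
[F w + K |y|_1], which leaves [2 (F w - F 0)] times the mass of the ball and [2 K]
times the integral of [|y|_1] over it, namely the masses [1 / (n + 1)] and
[1 / (n + 2)] relative to the sphere. The width [d] of the ramp then tends to 0. *)
Lemma sphere_gradient n (K : R) (F : 'rV[R]_n.+1 -> R) (w : 'rV[R]_n.+1) :
  0 <= K -> l1lip K F -> segment_convex F ->
  n.+1%:R / 2 * sphere_mean (fun v => dotp (sign_rV v) w * (F v - F (- v))) <=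
  F w - F 0 + K * (n.+1%:R / n.+2%:R).
Proof.
move=> K0 lF cF; have mF := l1lip_measurable K0 lF.
have k0 := @cone_mass_gt0 R n; set kap := cone_mass n in k0.
pose FN y := F (- y).
have lFN : l1lip K FN by move=> u v; rewrite (le_trans (lF _ _))// -opprD l1normN.
have mFN := l1lip_measurable K0 lFN.
have cFN : segment_convex FN.
  by move=> u v t t01; rewrite /FN !opprD -scalerN; exact: cF.
pose G y := F y - F (- y).
have lG : l1lip (K + K) G.
  move=> u v; rewrite mulrDl.
  have -> : G u - G v = (F u - F v) - (FN u - FN v) by rewrite /G /FN; ring.
  by rewrite (le_trans (ler_normB _ _))// lerD.
have G0 : G 0 = 0 by rewrite /G oppr0 subrr.
pose Q := sphere_mean (fun v => dotp (sign_rV v) w * G v).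
pose E0 := F w - F 0.
(* [M] collects the coefficients of all the error terms, which are linear in [d]. *)
pose M := l1norm w * (K + K) * (1 + 2 ^+ n.+1) + 2 * `|E0| * 2 ^+ n + 2 * K * 2 ^+ n.+1.
have w0 := l1norm_ge0 w.
have M0 : 0 <= M.
  by rewrite /M !addr_ge0 ?mulr_ge0 ?addr_ge0 ?exprn_ge0.
have step (d : R) : 0 < d <= 1 -> Q <= 2 * E0 / n.+1%:R + 2 * K / n.+2%:R + M * d.
  move=> d01; have /andP[d0 d1] := d01.
  pose ph (y : 'rV[R]_n.+1) := ramp d (l1norm y).
  have mph : measurable_fun setT ph.
    exact: (measurableT_comp (measurable_ramp d) (@measurable_l1norm R n.+1)).
  have ph0 y : 0 <= ph y := ramp_ge0 _ _.
  have ph1 y : ph y <= 1 := ramp_le1 _ _.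
  have ph2 y : 2 < l1norm y -> ph y = 0 by move=> y2; rewrite /ph ramp0//; lra.
  have iph (g : 'rV[R]_n.+1 -> R) (B : R) : measurable_fun setT g ->
      (forall y, l1norm y <= 2 -> `|g y| <= B) ->
      (mu n.+1).-integrable setT (EFin \o (fun y => ph y * g y)).
    move=> mg gB; apply: (@ball_bounded_integrable _ _ _ 2 B).
    - exact: measurable_funM.
    - move=> y /gB hy; rewrite normrM ger0_norm//.
      by rewrite (le_trans _ hy)// ler_piMl.
    - by move=> y /ph2 ->; rewrite mul0r.
  have dF v y : `|F (y + v) - F y| <= K * l1norm v.
    by rewrite (le_trans (lF _ _))// addrAC subrr add0r.
  have mFw v : measurable_fun setT (fun y : 'rV[R]_n.+1 => F (y + v)).
    exact: (measurableT_comp mF (measurable_shift v)).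
  have mN : measurable_fun setT (@l1norm R n.+1) := @measurable_l1norm R n.+1.
  have iS (f : 'rV[R]_n.+1 -> R) v : l1lip K f -> (mu n.+1).-integrable setT
      (EFin \o (fun y => dotp (sign_rV y) v * ramp_slope d (l1norm y) * f y)).
    move=> lf; apply: (@ball_bounded_integrable _ _ _ 2 (l1norm v * d^-1 * (`|f 0| + K * 2))).
    - apply: measurable_funM; last exact: l1lip_measurable lf.
      apply: measurable_funM; first exact: measurable_dotp_sign.
      exact: (measurableT_comp (measurable_ramp_slope d) mN).
    - move=> y y2; rewrite normrM ler_pM//; last exact: l1lip_bound.
      rewrite normrM ler_pM ?dotp_sign_le// ger0_norm ?ramp_slope_ge0//.
      by rewrite /ramp_slope; case: ifP => // _; rewrite invr_ge0 ltW.
    - move=> y y2; rewrite /ramp_slope; case: ifP; last by rewrite mulr0 mul0r.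
      by move=> /andP[_ h]; move: h y2 d1; lra.
  have r1 := ramp_gradient_le w K0 lF cF d01.
  have r2 := ramp_gradient_le (- w) K0 lFN cFN d01.
  have KK : 0 <= K + K by rewrite addr_ge0.
  have low := ramp_slope_lower w KK lG G0 d01.
  have GE : \int[mu n.+1]_y (dotp (sign_rV y) w * ramp_slope d (l1norm y) * G y) =
      \int[mu n.+1]_y (dotp (sign_rV y) w * ramp_slope d (l1norm y) * F y) +
      \int[mu n.+1]_y (dotp (sign_rV y) (- w) * ramp_slope d (l1norm y) * FN y).
    rewrite -RintegralD//; [|exact: iS..].
    apply: eq_Rintegral => y _; rewrite /G /FN.
    have -> : dotp (sign_rV y) (- w) = - dotp (sign_rV y) w.
      by rewrite /dotp -sumrN; apply: eq_bigr => j _; rewrite [(- w) _ _]mxE mulrN.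
    by ring.
  have i1 (f : 'rV[R]_n.+1 -> R) v : l1lip K f -> (mu n.+1).-integrable setT
      (EFin \o (fun y => ph y * (f (y + v) - f y))).
    move=> lf; have mf := l1lip_measurable K0 lf.
    apply: (iph _ (K * l1norm v)).
      by apply: measurable_funB => //; exact: (measurableT_comp mf (measurable_shift v)).
    by move=> y _; rewrite (le_trans (lf _ _))// addrAC subrr add0r.
  have i2 : (mu n.+1).-integrable setT (EFin \o (fun y => ph y * l1norm y)).
    by apply: (iph _ 2) => // y y2; rewrite ger0_norm// l1norm_ge0.
  have i3 : (mu n.+1).-integrable setT (EFin \o ph).
    by apply: (@ball_bounded_integrable _ _ ph 2 1) => // y _; rewrite ger0_norm.
  have up : \int[mu n.+1]_y (ph y * (F (y + w) - F y)) +
      \int[mu n.+1]_y (ph y * (FN (y + - w) - FN y)) <=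
      2 * E0 * \int[mu n.+1]_y ph y + 2 * K * \int[mu n.+1]_y (ph y * l1norm y).
    rewrite -RintegralD//; [|exact: i1..].
    have i3' : (mu n.+1).-integrable setT (EFin \o (fun y => 2 * E0 * ph y)).
      exact: integrableZl i3.
    have i2' : (mu n.+1).-integrable setT (EFin \o (fun y => 2 * K * (ph y * l1norm y))).
      exact: integrableZl i2.
    rewrite -!RintegralZl// -RintegralD//.
    apply: le_Rintegral => //.
    - exact: integrableD (i1 _ _ lF) (i1 _ _ lFN).
    - exact: integrableD i3' i2'.
    move=> y _; rewrite -mulrDr [leRHS](_ : _ = ph y * (2 * E0 + 2 * K * l1norm y)); last by ring.
    rewrite ler_wpM2l// /FN opprB /E0.
    have := lF (y + w) w; have := lF (w - y) w.
    rewrite addrK addrAC subrr add0r l1normN !ler_norml => /andP[_ h1] /andP[_ h2].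
    have half : 0 <= (2^-1 : R) <= (1 : R) by rewrite invr_ge0 ler0n invf_le1// ler1n.
    have := cF y (- (2 *: y)) 2^-1 half.
    rewrite scalerN scalerA mulVf// scale1r subrr.
    have -> : y - 2 *: y = - y by rewrite scaler_nat mulr2n opprD addrA subrr add0r.
    rewrite -[2 * K * _]mulrA; move: h1 h2.
    move: (F (w - y)) (F (y + w)) (F y) (F (- y)) (F w) (F 0) (K * l1norm y).
    by clear => a b c a' b' c' k; lra.
  have I0 : kap / n.+1%:R <= \int[mu n.+1]_y ph y <= kap * (n.+1%:R^-1 + 2 ^+ n * d).
    rewrite -!lee_fin /Rintegral fineK; last exact: integrable_fin_num.
    rewrite (polar_radial n (g := fun r => (ramp d r)%:E)); last 2 first.
    - by apply/measurable_EFinP; exact: measurable_ramp.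
    - by move=> r; rewrite lee_fin ramp_ge0.
    under eq_integral do rewrite -EFinM.
    have /andP[h1 h2] := @ramp_moment R n d d01.
    by rewrite [(kap / _)%:E]EFinM [(kap * (_ + _))%:E]EFinM !lee_wpmul2l// lee_fin ltW.
  have I1 : \int[mu n.+1]_y (ph y * l1norm y) <= kap * (n.+2%:R^-1 + 2 ^+ n.+1 * d).
    rewrite -!lee_fin /Rintegral fineK; last exact: integrable_fin_num.
    have mr : measurable_fun setT (fun r : R => (ramp d r * `|r|)%:E).
      apply/measurable_EFinP; apply: measurable_funM; first exact: measurable_ramp.
      exact: normr_measurable.
    have -> : (\int[mu n.+1]_y (ph y * l1norm y)%:E =
       \int[mu n.+1]_y (fun r : R => (ramp d r * `|r|)%:E) (l1norm y))%E.
      by apply: eq_integral => y _; rewrite (ger0_norm (l1norm_ge0 y)).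
    rewrite (polar_radial n (g := fun r : R => (ramp d r * `|r|)%:E))//; last first.
      by move=> r; rewrite lee_fin mulr_ge0 ?ramp_ge0.
    have /andP[_ h2] := @ramp_moment R n.+1 d d01.
    rewrite [(kap * (_ + _))%:E]EFinM; apply: lee_wpmul2l; first by rewrite lee_fin ltW.
    rewrite (le_trans _ h2)// le_eqVlt; apply/orP; left; apply/eqP.
    apply: eq_integral => r; rewrite inE/= in_itv/= andbT => r0.
    by rewrite -EFinM (gtr0_norm r0) exprS; congr EFin; ring.
  have E0I : 2 * E0 * \int[mu n.+1]_y ph y <= kap * (2 * E0 / n.+1%:R + 2 * `|E0| * (2 ^+ n * d)).
    have p0 : 0 <= 2 ^+ n * d by rewrite mulr_ge0 ?exprn_ge0// ltW.
    have pk : 0 <= kap * (2 ^+ n * d) by rewrite mulr_ge0// ltW.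
    move: I0 pk => /andP[].
    move: (n.+1%:R^-1) (2 ^+ n * d) (\int[mu n.+1]_y ph y) => i p I I01 I02 pk.
    have [e0|e0] := leP 0 E0.
      rewrite (ger0_norm e0).
      have -> : kap * (2 * E0 * i + 2 * E0 * p) = 2 * E0 * (kap * (i + p)) by ring.
      by rewrite ler_wpM2l// mulr_ge0.
    have e1 : 0 <= - E0 by rewrite oppr_ge0 ltW.
    have := ler_wpM2l e1 I01; have := mulr_ge0 e1 pk.
    rewrite (ltr0_norm e0); move: (kap) (E0) => k e; clear; nra.
  have K2 : 0 <= 2 * K by rewrite mulr_ge0.
  have KI := ler_wpM2l K2 I1.
  have fin : kap * Q <= kap * (2 * E0 / n.+1%:R + 2 * K / n.+2%:R + M * d).
    move: low; rewrite GE -/Q -/kap => low.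
    have := le_trans low (lerD r1 r2) => {}low.
    have := le_trans low up => {}low.
    have := le_trans low (lerD E0I KI) => {}low.
    rewrite -subr_ge0 in low; rewrite -subr_ge0; apply: (le_trans low).
    by rewrite le_eqVlt; apply/orP; left; apply/eqP; rewrite /M; ring.
  by rewrite ler_pM2l in fin.
(* The width of the ramp tends to 0. *)
have hQ : Q <= 2 * E0 / n.+1%:R + 2 * K / n.+2%:R.
  apply/ler_addgt0Pr => e e0.
  pose d := Num.min 1 (e / (M + 1)).
  have M1 : 0 < M + 1 by rewrite ltr_wpDl.
  have d0 : 0 < d by rewrite lt_min ltr01 divr_gt0.
  have d1 : d <= 1 by rewrite ge_min lexx.
  have dM : d * (M + 1) <= e by rewrite -ler_pdivlMr// ge_min lexx orbT.
  have /step : 0 < d <= 1 by rewrite d0.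
  move: dM; rewrite mulrDr mulr1 mulrC => dM h; apply: (le_trans h).
  by rewrite lerD2l; lra.
have -> : F w - F 0 + K * (n.+1%:R / n.+2%:R) =
  n.+1%:R / 2 * (2 * E0 / n.+1%:R + 2 * K / n.+2%:R).
  have a0 : n.+1%:R != 0 :> R by rewrite pnatr_eq0.
  have b0 : n.+2%:R != 0 :> R by rewrite pnatr_eq0.
  by rewrite /E0; move: (n.+1%:R : R) (n.+2%:R : R) a0 b0 => a b a0 b0; field; rewrite a0 b0.
by rewrite ler_pM2l ?divr_gt0.
Qed.

End sphere_gradient.

(** * Exponential weights *)

Section exponential_weights.
Context {R : realType}.

Definition partition_fun n (eta : R) (z : 'rV[R]_n.+1) : R := \sum_j expR (eta * z ord0 j).

Definition softmax n (eta : R) (z : 'rV[R]_n.+1) : 'rV[R]_n.+1 :=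
  \row_j (expR (eta * z ord0 j) / partition_fun eta z).

Lemma partition_fun_gt0 n (eta : R) (z : 'rV[R]_n.+1) : 0 < partition_fun eta z.
Proof.
rewrite /partition_fun (bigD1 ord0)//= ltr_pwDl ?expR_gt0//.
by apply: sumr_ge0 => j _; exact: expR_ge0.
Qed.

Lemma softmax_gt0 n (eta : R) (z : 'rV[R]_n.+1) j : 0 < softmax eta z ord0 j.
Proof. by rewrite mxE divr_gt0 ?expR_gt0 ?partition_fun_gt0. Qed.

Lemma softmax_sum n (eta : R) (z : 'rV[R]_n.+1) : \sum_j softmax eta z ord0 j = 1.
Proof.
under eq_bigr do rewrite mxE.
by rewrite -mulr_suml divff// gt_eqF// partition_fun_gt0.
Qed.

Lemma simplex_sum n (x : 'rV[R]_n) : simplex x -> \sum_j x ord0 j = 1.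
Proof. by move=> [x0 <-]; apply: eq_bigr => j _; rewrite ger0_norm. Qed.

Lemma softmax_simplex n (eta : R) (z : 'rV[R]_n.+1) : simplex (softmax eta z).
Proof.
split=> [j|]; first by rewrite ltW// softmax_gt0.
by rewrite -(softmax_sum eta z); apply: eq_bigr => j _; rewrite gtr0_norm// softmax_gt0.
Qed.

Lemma ln_softmax n (eta : R) (z : 'rV[R]_n.+1) j :
  ln (softmax eta z ord0 j) = eta * z ord0 j - ln (partition_fun eta z).
Proof. by rewrite mxE ln_div ?posrE ?expR_gt0 ?partition_fun_gt0// expRK. Qed.

(** [1 + t <= exp t] at [t = ln p - ln y], with its equality case; the sum of these
terms is the Gibbs inequality. *)
Lemma gibbs_term (p y : R) : 0 < p -> 0 <= y ->
  y * (ln p - ln y) <= p - y ?= iff (y == p).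
Proof.
move=> p0; rewrite le_eqVlt => /orP[/eqP <-|y0]; apply/leifP.
  by rewrite mul0r subr0 (lt_eqF p0).
case: eqVneq => [->|yp]; first by rewrite subrr mulr0 subrr.
have t0 : ln p - ln y != 0.
  by rewrite subr_eq0; apply: contraNneq yp => /ln_inj ->; rewrite ?posrE.
have pE : p = y * expR (ln p - ln y).
  by rewrite expRB !lnK ?posrE// mulrC divfK// gt_eqF.
rewrite [ltRHS](_ : _ = y * (expR (ln p - ln y) - 1)); last by rewrite mulrBr mulr1 -pE.
by rewrite ltr_pM2l// ltrBrDl expR_gt1Dx.
Qed.

(** The gap to the maximum is the relative entropy of [x] with respect to the softmax,
which vanishes only if the two are equal. *)
Lemma argmax_softmax n (eta : R) (z x : 'rV[R]_n.+1) :
  is_argmax (@simplex R n.+1) (fun y => eta * dotp z y - negentropy y) x ->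
  x = softmax eta z.
Proof.
move=> [sx]; have sp := softmax_simplex eta z; move=> /(_ _ sp).
set p := softmax eta z in sp *.
have gap y : simplex y -> eta * dotp z y - negentropy y =
    ln (partition_fun eta z) + \sum_j y ord0 j * (ln (p ord0 j) - ln (y ord0 j)).
  move=> sy; rewrite -[ln (partition_fun eta z)]mulr1 -(simplex_sum sy).
  rewrite /dotp /negentropy !mulr_sumr -big_split -sumrB/=; apply: eq_bigr => j _.
  by rewrite ln_softmax; ring.
rewrite (gap _ sx) (gap _ sp) lerD2l [leLHS]big1; last by move=> j _; rewrite subrr mulr0.
move=> h; apply/rowP => j.
have g k : x ord0 k * (ln (p ord0 k) - ln (x ord0 k)) <= p ord0 k - x ord0 k ?= iff (x ord0 k == p ord0 k).
  by apply: gibbs_term; [exact: softmax_gt0|case: sx].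
have := leif_sum (fun k (_ : true) => g k).
rewrite sumrB (simplex_sum sx) (simplex_sum sp) subrr => -[h1 h2].
have : \sum_(k < n.+1) x ord0 k * (ln (p ord0 k) - ln (x ord0 k)) == 0.
  by rewrite eq_le h1 h.
by rewrite h2 => /forallP/(_ j)/eqP.
Qed.

(** For [|x| >= 1/2], both exponentials are at most [exp |x| <= exp (2 x^2)].
For [|x| < 1/2], the inequality [exp x <= 1 / (1 - x)] and its analogue for [- x] add up to [2 / (1 - x^2)]. *)
Lemma cosh_le (x : R) : expR x + expR (- x) <= 2 * expR (2 * x ^+ 2).
Proof.
wlog x0 : x / 0 <= x => [H|].
  have [/H//|/ltW x0] := leP 0 x.
  by have := H (- x); rewrite oppr_ge0 opprK sqrrN addrC; exact.
have [x1|x1] := leP 2^-1 x.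
  have h : x <= 2 * x ^+ 2.
    by rewrite expr2; nra.
  have h1 : expR x <= expR (2 * x ^+ 2) by rewrite ler_expR.
  have h2 : expR (- x) <= expR x by rewrite ler_expR; lra.
  lra.
have e1 : expR x <= (1 - x)^-1.
  rewrite -[x in expR x]opprK expRN lef_pV2 ?posrE ?expR_gt0//; last by lra.
  exact: expR_ge1Dx.
have e2 : expR (- x) <= (1 + x)^-1.
  rewrite expRN lef_pV2 ?posrE ?expR_gt0//; last by lra.
  exact: expR_ge1Dx.
have e3 : 1 + 2 * x ^+ 2 <= expR (2 * x ^+ 2) := expR_ge1Dx _.
rewrite (le_trans (lerD e1 e2))//.
rewrite (@le_trans _ _ (2 * (1 + 2 * x ^+ 2)))//; last by rewrite ler_pM2l.
have -> : (1 - x)^-1 + (1 + x)^-1 = 2 / (1 - x ^+ 2).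
  by field; apply/and3P; split; apply/eqP; nra.
rewrite ler_pM2l// -[leLHS]mul1r ler_pdivrMr; last by nra.
have s0 : 0 <= x ^+ 2 by exact: sqr_ge0.
have s1 : x ^+ 2 <= 2^-1 by rewrite expr2; nra.
move: (x ^+ 2) s0 s1 => s s0 s1; nra.
Qed.

(** Write [A] and [B] for the means of [exp Y] and [exp (- Y)]. Jensen gives
[B >= exp (- m)] for the mean [m] of [Y], so that [A exp (- m) <= A B], and
[A B <= ((A + B) / 2)^2] is controlled by [cosh_le]. Centring through [B] avoids
the second derivative of the log-Laplace transform. *)
Lemma hoeffding_sum n (p Y : 'I_n -> R) (a : R) : (forall j, 0 <= p j) -> \sum_j p j = 1 ->
  (forall j, Y j ^+ 2 = a) ->
  \sum_j p j * expR (Y j) <= expR (\sum_j p j * Y j + 4 * a).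
Proof.
move=> p0 p1 Ya; set m := \sum_j p j * Y j.
pose A := \sum_j p j * expR (Y j); pose B := \sum_j p j * expR (- Y j).
have A0 : 0 <= A by apply: sumr_ge0 => j _; rewrite mulr_ge0 ?expR_ge0.
have B0 : expR (- m) <= B.
  have -> : B = expR (- m) * \sum_j p j * expR (m - Y j).
    rewrite mulr_sumr; apply: eq_bigr => j _.
    by rewrite mulrCA -expRD addKr.
  rewrite ler_peMr ?expR_ge0//.
  rewrite [leLHS](_ : _ = \sum_j p j * (1 + (m - Y j))).
    by apply: ler_sum => j _; rewrite ler_wpM2l ?expR_ge1Dx.
  under eq_bigr do rewrite mulrDr mulr1 mulrBr.
  by rewrite big_split/= sumrB -mulr_suml p1 mul1r subrr addr0.
have AB : A + B <= 2 * expR (2 * a).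
  rewrite -big_split/= -[leRHS]mul1r -[X in X * _]p1 mulr_suml; apply: ler_sum => j _.
  by rewrite -mulrDr ler_wpM2l// -(Ya j) cosh_le.
have h : A * expR (- m) <= expR (2 * a) ^+ 2.
  apply: (@le_trans _ _ (A * B)); first by rewrite ler_wpM2l.
  have e0 := expR_ge0 (2 * a).
  have Bp : 0 <= B by rewrite (le_trans _ B0)// expR_ge0.
  have := sqr_ge0 (A - B); rewrite !expr2.
  move: AB e0 Bp A0; move: (expR (2 * a)) (A) (B); clear => e x y; nra.
rewrite addrC expRD -ler_pdivrMr ?expR_gt0// -expRN (le_trans h)//.
by rewrite expr2 -expRD ler_expR; lra.
Qed.

(** One step of the potential; the entries of [s] are signs, so that all the entries
of the increment have the square [(eta * c)^2]. *)
Lemma partition_fun_step n (eta c : R) (z s : 'rV[R]_n.+1) : (forall j, s ord0 j ^+ 2 = 1) ->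
  ln (partition_fun eta (z - c *: s)) <= ln (partition_fun eta z)
    - eta * dotp (c *: s) (softmax eta z) + 4 * (eta * c) ^+ 2.
Proof.
move=> s1; have Z0 := partition_fun_gt0 eta z.
pose p j := softmax eta z ord0 j.
pose Y j := - (eta * c) * s ord0 j.
have ZE : partition_fun eta (z - c *: s) = partition_fun eta z * \sum_j p j * expR (Y j).
  rewrite mulr_sumr; apply: eq_bigr => j _; rewrite /p /Y [softmax _ _ _ _]mxE mulrA.
  rewrite [partition_fun eta z * _]mulrC divfK ?gt_eqF// -expRD.
  by rewrite !mxE; congr expR; ring.
have S0 : 0 < \sum_j p j * expR (Y j).
  by rewrite -(pmulr_rgt0 _ Z0) -ZE partition_fun_gt0.
rewrite ZE lnM ?posrE// -addrA lerD2l -ler_expR lnK ?posrE//.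
have h := @hoeffding_sum n.+1 p Y ((eta * c) ^+ 2).
rewrite (le_trans (h _ _ _))//.
- by move=> j; rewrite ltW// softmax_gt0.
- exact: softmax_sum.
- by move=> j; rewrite exprMn s1 mulr1 sqrrN.
rewrite ler_expR lerD2r le_eqVlt; apply/orP; left; apply/eqP.
rewrite /dotp mulr_sumr -sumrN; apply: eq_bigr => j _; rewrite /p /Y [(c *: s) _ _]mxE; ring.
Qed.

Lemma partition_fun_ge n (eta : R) (z u : 'rV[R]_n.+1) : simplex u ->
  eta * dotp z u <= ln (partition_fun eta z).
Proof.
move=> su; rewrite -[leRHS]mulr1 -(simplex_sum su) /dotp !mulr_sumr; apply: ler_sum => j _.
rewrite mulrA ler_wpM2r//; first by case: su.
rewrite -ler_expR lnK ?posrE ?partition_fun_gt0// /partition_fun (bigD1 j)//=.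
by rewrite lerDl; apply: sumr_ge0 => k _; exact: expR_ge0.
Qed.

(** The potential steps are summed from [ln d] at [z = 0], and the final potential is
bounded below by the comparator [u]. *)
Lemma exponential_weights_regret n (eta : R) (z s : nat -> 'rV[R]_n.+1) (c : nat -> R) (T : nat)
    (u : 'rV[R]_n.+1) : 0 < eta -> z 1%N = 0 ->
  (forall t, (1 <= t)%N -> z t.+1 = z t - c t *: s t) ->
  (forall t j, s t ord0 j ^+ 2 = 1) -> simplex u ->
  \sum_(1 <= t < T.+1) (dotp (c t *: s t) (softmax eta (z t) - u) - 4 * eta * c t ^+ 2)
    <= ln n.+1%:R / eta.
Proof.
move=> eta0 z1 zS s1 su.
suff h m : \sum_(1 <= t < m.+1) (dotp (c t *: s t) (softmax eta (z t)) - 4 * eta * c t ^+ 2)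
     <= (ln n.+1%:R - ln (partition_fun eta (z m.+1))) / eta /\
   dotp (z m.+1) u = - \sum_(1 <= t < m.+1) dotp (c t *: s t) u.
  have [h1 h2] := h T.
  have -> : \sum_(1 <= t < T.+1) (dotp (c t *: s t) (softmax eta (z t) - u) - 4 * eta * c t ^+ 2) =
     \sum_(1 <= t < T.+1) (dotp (c t *: s t) (softmax eta (z t)) - 4 * eta * c t ^+ 2) + dotp (z T.+1) u.
    rewrite h2 -sumrB; apply: eq_bigr => t _.
    have -> : dotp (c t *: s t) (softmax eta (z t) - u) = dotp (c t *: s t) (softmax eta (z t)) - dotp (c t *: s t) u.
      by rewrite /dotp -sumrB; apply: eq_bigr => j _; rewrite [(_ - u) _ _]mxE [(- u) _ _]mxE mulrBr.
    ring.
  rewrite -lerBrDr (le_trans h1)// mulrBl lerD2l lerN2 ler_pdivlMr// mulrC.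
  exact: partition_fun_ge.
elim: m => [|m [IH1 IH2]].
  rewrite !big_nil z1; split; last by rewrite oppr0 /dotp big1// => j _; rewrite mxE mul0r.
  rewrite (_ : partition_fun eta 0 = n.+1%:R) ?subrr ?mul0r//.
  rewrite /partition_fun (eq_bigr (fun=> 1)); last by move=> j _; rewrite mxE mulr0 expR0.
  by rewrite sumr_const card_ord.
rewrite (@big_nat_recr _ _ _ m.+1)//= (@big_nat_recr _ _ _ m.+1)//= (zS m.+1)//; split; last first.
  rewrite opprD -IH2 /dotp -sumrB; apply: eq_bigr => j _.
  by rewrite !mxE mulrBl.
rewrite (le_trans (lerD IH1 (lexx _)))// -lerBrDl -mulrBl ler_pdivlMr//.
have := partition_fun_step eta (c m.+1) (z m.+1) (s1 m.+1).
have -> : 4 * (eta * c m.+1) ^+ 2 = 4 * eta * c m.+1 ^+ 2 * eta by ring.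
rewrite mulrBl [dotp _ _ * eta]mulrC; lra.
Qed.

End exponential_weights.

(** * Independence from the past *)

Section independence.
Local Open Scope ereal_scope.
Context d (Omega : measurableType d) (R : realType) (P : probability Omega R).

Lemma random_variable_of d1 (T : measurableType d1) (f : Omega -> T) : measurable_fun setT f ->
  exists Y : {RV P >-> T}, Y = f :> (Omega -> T).
Proof.
move=> mf; pose m1 := isMeasurableFun.Build _ _ _ _ f mf.
by pose Y : {mfun Omega >-> T} := HB.pack f m1; exists Y.
Qed.

(** The restriction to the event [E] makes the statement usable inside an induction
where [E] collects conditions on the future. Both sides are measures in [C] that
agree on rectangles. *)
Lemma joint_law d1 d2 (T1 : measurableType d1) (T2 : measurableType d2)
    (Y : {RV P >-> T1}) (X : {RV P >-> T2}) (E : set Omega) : measurable E ->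
  (forall A B, measurable A -> measurable B ->
     P (Y @^-1` A `&` (X @^-1` B `&` E)) = P (Y @^-1` A) * (P (X @^-1` B) * P E)) ->
  forall C, measurable C -> P ((fun w => (Y w, X w)) @^-1` C `&` E) =
    (distribution P Y \x distribution P X) C * P E.
Proof.
move=> mE h C mC.
have mYX : measurable_fun setT (fun w => (Y w, X w)) by exact: measurable_fun_pair.
have [m2 m2E] : exists m2 : {sigma_finite_measure set T2 -> \bar R},
    pushforward (mrestr P mE) X = m2.
  apply: sigma_finite_measure_of.
  - by rewrite /pushforward preimage_set0 measure0.
  - by move=> A; rewrite /pushforward /mrestr.
  - exact: (@measure_semi_sigma_additive _ _ _ (pushforward (mrestr P mE) X)).
  - apply: fin_num_fun_sigma_finite.
      by rewrite /pushforward preimage_set0 measure0.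
    move=> A mA; rewrite /pushforward /mrestr.
    apply: fin_num_measure; apply: measurableI => //.
    by rewrite -[X in measurable X]setTI; exact: measurable_funPT.
have m2A A : measurable A -> m2 A = P (X @^-1` A) * P E.
  move=> mA; rewrite -m2E /pushforward /mrestr.
  have := h setT A measurableT mA.
  by rewrite preimage_setT setTI probability_setT mul1e.
pose m' := pushforward (mrestr P mE) (fun w => (Y w, X w)).
transitivity (m' C) => //.
rewrite /m' -(product_measure_unique (m1 := distribution P Y) (m2 := m2))//.
- rewrite /product_measure1 -ge0_integralZr//.
  + apply: eq_integral => y _ /=; rewrite m2A//; exact: measurable_xsection.
  + exact: measurable_fun_xsection.
- move=> A B mA mB /=; rewrite m2A// -h// /pushforward /mrestr setIA; congr (P _).
Qed.

Lemma joint_law_pair d1 d2 (T1 : measurableType d1) (T2 : measurableType d2)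
    (Y : {RV P >-> T1}) (X : {RV P >-> T2}) :
  (forall A B, measurable A -> measurable B ->
     P (Y @^-1` A `&` X @^-1` B) = P (Y @^-1` A) * P (X @^-1` B)) ->
  forall C, measurable C -> P ((fun w => (Y w, X w)) @^-1` C) =
    (distribution P Y \x distribution P X) C.
Proof.
move=> h C mC; have := @joint_law _ _ _ _ Y X setT measurableT _ C mC.
rewrite probability_setT mule1 setIT; apply => A B mA mB.
by rewrite setIT mule1 h.
Qed.

End independence.

Section online.
Local Open Scope ereal_scope.
Context d d1 d2 (Omega : measurableType d) (R : realType) (P : probability Omega R)
  (T : measurableType d1) (S : measurableType d2).
Variables (z0 : T) (step : nat -> T * S -> T) (X : nat -> {RV P >-> S}).

(** The state after [k] rounds of a recursion driven by the samples [X 1, X 2, ...]. *)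
Fixpoint past (k : nat) (w : Omega) : T :=
  if k is j.+1 then step j (past j w, X j.+1 w) else z0.

Hypothesis mstep : forall k, measurable_fun setT (step k).

Lemma measurable_past k : measurable_fun setT (past k).
Proof.
elim: k => [|k IH]; first exact: measurable_cst.
apply: (measurableT_comp (mstep k) (g := fun w => (past k w, X k.+1 w))).
exact: measurable_fun_pair.
Qed.

Let cyl (s : seq nat) (A : nat -> set S) : set Omega := \bigcap_(i in [set` s]) (X i @^-1` A i).

Let measurable_preim d3 (U : measurableType d3) (f : Omega -> U) A : measurable_fun setT f ->
  measurable A -> measurable (f @^-1` A).
Proof. by move=> mf mA; rewrite -[X in measurable X]setTI; exact: mf. Qed.

Let cyl1 k C : cyl [:: k] (fun=> C) = X k @^-1` C.
Proof.
by apply/seteqP; split => [w /(_ k)|w hw i]; rewrite /= inE; [apply|move=> /eqP ->].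
Qed.

Hypothesis indep : mutually_independent [set t | (1 <= t)%N] X.

(** Induction on [k]. The pair made of the state and the next sample has a product law,
also on the event that later samples fall in given sets; pushing this product law
through the update gives the statement for the next state. *)
Lemma past_indep k (s : seq nat) (A : nat -> set S) : uniq s ->
  (forall i, i \in s -> (k < i)%N /\ measurable (A i)) ->
  forall B, measurable B -> P (past k @^-1` B `&` cyl s A) = P (past k @^-1` B) * P (cyl s A).
Proof.
have mcyl (r : seq nat) (D : nat -> set S) : (forall i, i \in r -> measurable (D i)) -> measurable (cyl r D).
  move=> mD; apply: fin_bigcap_measurable => [|i ir]; first exact: finite_seq.
  by apply: measurable_preim => //; exact: mD.
elim: k s A => [|k IH] s A us hs B mB.
  have [Bz|Bz] := pselect (B z0).
    rewrite (_ : past 0 @^-1` B = setT); last by apply/seteqP; split.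
    by rewrite setTI probability_setT mul1e.
  rewrite (_ : past 0 @^-1` B = set0); last by apply/seteqP; split.
  by rewrite set0I measure0 mul0e.
have mE : measurable (cyl s A) by apply: mcyl => i /hs[].
have [Y YE] := random_variable_of P (measurable_past k).
have sk : k.+1 \notin s by apply/negP => /hs[]; rewrite ltnn.
(* The condition on the next sample is one more condition on the future. *)
have consE D : X k.+1 @^-1` D `&` cyl s A = cyl (k.+1 :: s) (fun i => if i == k.+1 then D else A i).
  apply/seteqP; split => [w [/= h1 h2] i /=|w h].
    rewrite inE => /orP[/eqP ->|si]; first by rewrite eqxx.
    by case: eqP => [->//|_]; exact: h2.
  split => [|i si].
    by have := h k.+1; rewrite /= eqxx; apply; rewrite mem_head.
  by have := h i; rewrite /= (negbTE (memPn sk i si)); apply; rewrite inE si orbT.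
have h D C : measurable D -> measurable C -> P (Y @^-1` D `&` (X k.+1 @^-1` C `&` cyl s A)) =
    P (Y @^-1` D) * (P (X k.+1 @^-1` C) * P (cyl s A)).
  move=> mD mC; rewrite YE consE IH//=; last 2 first.
  - by rewrite sk.
  - move=> i; rewrite inE => /orP[/eqP ->|si]; first by rewrite eqxx.
    have [ki mi] := hs _ si; rewrite (ltn_trans _ ki)//.
    by rewrite (negbTE (memPn sk i si)).
  congr (_ * _); rewrite /cyl indep/=; last 2 first.
  - by rewrite sk.
  - move=> i; rewrite inE => /orP[/eqP ->|si]; first by rewrite eqxx.
    have [ki mi] := hs _ si; rewrite (leq_ltn_trans _ ki)//.
    by rewrite (negbTE (memPn sk i si)).
  rewrite big_cons eqxx; congr (_ * _).
  rewrite indep//; last first.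
    by move=> i si; have [ki mi] := hs _ si; split=> //; exact: leq_ltn_trans ki.
  by apply: eq_big_seq => i si; rewrite (negbTE (memPn sk i si)).
have mC : measurable (step k @^-1` B) by rewrite -[X in measurable X]setTI; exact: mstep.
have J := joint_law mE h mC.
have J1 : P (past k.+1 @^-1` B) = (distribution P Y \x distribution P (X k.+1)) (step k @^-1` B).
  rewrite -(joint_law_pair _ mC).
    by congr (P _); apply/seteqP; split => w /=; rewrite YE.
  move=> D C mD mC'; rewrite YE; have := @IH [:: k.+1] (fun=> C) isT _ D mD.
  by rewrite cyl1; apply => i; rewrite inE => /eqP ->.
rewrite J1 -J; congr (P _); apply/seteqP; split => w /=; rewrite YE//.
Qed.

(** A bound in mean over the next sample that is uniform in the state survives when
the state is the random past. *)
Lemma past_integral_le k (H : T * S -> \bar R) (b : \bar R) : measurable_fun setT H ->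
  (forall p, 0 <= H p) ->
  (forall y, \int[distribution P (X k.+1)]_x H (y, x) <= b) ->
  \int[P]_w H (past k w, X k.+1 w) <= b.
Proof.
move=> mH H0 Hb.
have [Y YE] := random_variable_of P (measurable_past k).
pose f w := (Y w, X k.+1 w).
have mf : measurable_fun setT f by exact: measurable_fun_pair.
have mc : measurable_fun setT (fun w => (past k w, X k.+1 w)).
  by apply: measurable_fun_pair => //; exact: measurable_past.
have -> : \int[P]_w H (past k w, X k.+1 w) = \int[pushforward P f]_p H p.
  by rewrite ge0_integral_pushforward// preimage_setT; apply: eq_integral => w _; rewrite /= /f YE.
rewrite (eq_measure_integral (distribution P Y \x distribution P (X k.+1))); last first.
  move=> B mB _; apply: joint_law_pair => // D C mD mC.
  have := @past_indep k [:: k.+1] (fun=> C) isT _ D mD.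
  by rewrite cyl1 YE; apply => i; rewrite inE => /eqP ->.
rewrite fubini_tonelli1//.
apply: (@le_trans _ _ (\int[distribution P Y]_y cst b y)).
  apply: ge0_le_integral => //.
  - by move=> y _; exact: integral_ge0.
  - exact: measurable_fun_fubini_tonelli_F.
  - by move=> y _; exact: Hb.
by rewrite integral_cst// [X in _ * X](@probability_setT _ _ _ (distribution P Y)) mule1.
Qed.

End online.

(** * One round of the algorithm *)

Section round.
Context {R : realType} (n : nat).
Implicit Types (f : 'rV[R]_n.+1 -> R) (x u v z : 'rV[R]_n.+1).

Lemma convex_segment f : convex_function [set: 'rV[R]_n.+1] f -> segment_convex f.
Proof.
move=> cf u v t /andP[t0 t1].
have := cf (Itv01 t0 t1) (u + v) u.
rewrite !in_setT => /(_ isT isT).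
have -> : u + t *: v = t *: (u + v) + (1 - t) *: u.
  by apply/rowP => j; rewrite !mxE; ring.
move=> h; apply: (le_trans h); rewrite convRE/= /onem.
by rewrite le_eqVlt; apply/orP; left; apply/eqP; ring.
Qed.

Definition diff_quotient f (h : R) x v : R :=
  n.+1%:R / (2 * h) * (f (x + h *: v) - f (x - h *: v)).

(** The instantaneous regret minus the part that exponential weights control pathwise. *)
Definition excess f (h eta : R) u x v : R :=
  f x - f u - dotp (diff_quotient f h x v *: sign_rV v) (x - u)
  + 4 * eta * diff_quotient f h x v ^+ 2.

Lemma grad_estimateE f (h a : R) x v :
  grad_estimate f h x v a a = diff_quotient f h x v *: sign_rV v.
Proof. by rewrite /grad_estimate /diff_quotient; congr (_ * _ *: _); ring. Qed.

Lemma dotpZl (c : R) u v : dotp (c *: u) v = c * dotp u v.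
Proof. by rewrite /dotp mulr_sumr; apply: eq_bigr => j _; rewrite mxE mulrA. Qed.

Lemma dotpZr (c : R) u v : dotp u (c *: v) = c * dotp u v.
Proof. by rewrite /dotp mulr_sumr; apply: eq_bigr => j _; rewrite mxE mulrCA. Qed.

Lemma diff_quotient_bound f (L h : R) x v : 0 <= L -> l1lip L f -> 0 < h -> l1norm v = 1 ->
  `|diff_quotient f h x v| <= n.+1%:R * L.
Proof.
move=> L0 lf h0 v1; rewrite /diff_quotient normrM ger0_norm; last first.
  by rewrite divr_ge0// mulr_ge0// ltW.
have -> : n.+1%:R * L = n.+1%:R / (2 * h) * (L * (2 * h)).
  by rewrite mulrCA mulfVK ?mulf_neq0 ?gt_eqF// mulrC.
rewrite ler_wpM2l//; first by rewrite divr_ge0// mulr_ge0// ltW.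
rewrite (le_trans (lf _ _))// ler_wpM2l//.
have -> : x + h *: v - (x - h *: v) = (2 * h) *: v.
  by apply/rowP => j; rewrite !mxE; ring.
by rewrite l1normZ v1 mulr1 gtr0_norm// mulr_gt0.
Qed.

Lemma simplex_dist x u : simplex x -> simplex u -> l1norm (x - u) <= 2.
Proof.
move=> [_ x1] [_ u1]; rewrite (le_trans (l1normD _ _))// l1normN x1 u1.
by rewrite -natr1 addrC lexx.
Qed.

(** A common bound for the absolute values of the excess; adding it makes the
integrands nonnegative. *)
Definition excess_cap (L eta : R) : R :=
  L * 2 + n.+1%:R * L * 2 + 4 * eta * (n.+1%:R * L) ^+ 2.

Lemma excess_bound f (L h eta : R) u x v : 0 <= L -> l1lip L f -> 0 < h -> 0 <= eta ->
  simplex x -> simplex u -> l1norm v = 1 -> `|excess f h eta u x v| <= excess_cap L eta.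
Proof.
move=> L0 lf h0 e0 sx su v1; have xu := simplex_dist sx su.
have qb := diff_quotient_bound x L0 lf h0 v1.
rewrite /excess (le_trans (ler_normD _ _))// lerD//.
  rewrite (le_trans (ler_normB _ _))// lerD//.
    by rewrite (le_trans (lf _ _))// ler_wpM2l.
  rewrite dotpZl normrM ler_pM//.
  by rewrite (le_trans (dotp_sign_le _ _)).
rewrite normrM ger0_norm ?mulr_ge0// ler_wpM2l ?mulr_ge0//.
by rewrite normrX lerXn2r ?nnegrE ?mulr_ge0.
Qed.

(** The quotient is rewritten as an exponential, to avoid the inverse function. *)
Lemma measurable_softmax (eta : R) : measurable_fun setT (@softmax R n eta).
Proof.
apply: measurable_fun_rV => j.
have mc k : measurable_fun setT (fun z : 'rV[R]_n.+1 => expR (eta * z ord0 k)).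
  apply: (measurableT_comp (@measurable_expR R)); apply: measurable_funM => //.
  exact: measurable_coord.
rewrite (_ : (fun z => _) = fun z : 'rV[R]_n.+1 => expR (eta * z ord0 j - ln (partition_fun eta z))).
  apply: (measurableT_comp (@measurable_expR R)); apply: measurable_funB.
    by apply: measurable_funM => //; exact: measurable_coord.
  apply: (measurableT_comp (@measurable_ln R)); exact: measurable_sum.
apply/funext => z; rewrite mxE expRB lnK// posrE; exact: partition_fun_gt0.
Qed.

Lemma measurable_sign_rV : measurable_fun setT (@sign_rV R n.+1).
Proof.
apply: measurable_fun_rV => j; under eq_fun do rewrite mxE.
apply: measurable_fun_if => //.
by apply: measurable_fun_ler => //; exact: measurable_coord.
Qed.

Section measurable_round.
Context d (T : measurableType d).
Variables (f : 'rV[R]_n.+1 -> R) (L h : R).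
Hypotheses (L0 : 0 <= L) (lf : l1lip L f).
Variables (x v : T -> 'rV[R]_n.+1) (a b : T -> R).
Hypotheses (mx : measurable_fun setT x) (mv : measurable_fun setT v).
Hypotheses (ma : measurable_fun setT a) (mb : measurable_fun setT b).

Let mf := l1lip_measurable L0 lf.

Let measurable_query (s : R) : measurable_fun setT (fun t => f (x t + s *: v t)).
Proof.
apply: (measurableT_comp mf); apply: measurable_fun_addrV => //.
exact: measurable_fun_scalerV.
Qed.

Let measurable_queryN : measurable_fun setT (fun t => f (x t - h *: v t)).
Proof.
rewrite (_ : (fun t => _) = fun t => f (x t + (- h) *: v t)); first exact: measurable_query.
by apply/funext => t; rewrite scaleNr.
Qed.

Lemma measurable_grad_estimate :
  measurable_fun setT (fun t => grad_estimate f h (x t) (v t) (a t) (b t)).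
Proof.
apply: measurable_fun_scalerV.
  apply: measurable_funM => //; apply: measurable_funB; apply: measurable_funD => //.
exact: (measurableT_comp measurable_sign_rV).
Qed.

Lemma measurable_diff_quotient : measurable_fun setT (fun t => diff_quotient f h (x t) (v t)).
Proof. by apply: measurable_funM => //; apply: measurable_funB. Qed.

Lemma measurable_excess (eta : R) (u : 'rV[R]_n.+1) :
  measurable_fun setT (fun t => excess f h eta u (x t) (v t)).
Proof.
have mq := measurable_diff_quotient.
apply: measurable_funD; last first.
  by apply: measurable_funM => //; exact: measurable_funX.
apply: measurable_funB.
  by apply: measurable_funB => //; exact: (measurableT_comp mf).
apply: measurable_sum => j; apply: measurable_funM.
  apply: (measurableT_comp (measurable_coord j)); apply: measurable_fun_scalerV => //.
  exact: (measurableT_comp measurable_sign_rV).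
apply: (measurableT_comp (measurable_coord j)).
by apply: measurable_fun_addrV.
Qed.

End measurable_round.

(** In the variable [F v = f (x + h v)], which is [L h]-Lipschitz, and with
[w = (u - x) / h], the linear term is bounded by [sphere_gradient] and the
quadratic term by [sphere_mean_odd_sqr]. *)
Lemma excess_mean f (L h eta : R) u x : 0 <= L -> l1lip L f -> segment_convex f -> 0 < h -> 0 <= eta ->
  simplex x -> simplex u ->
  sphere_mean (excess f h eta u x) <= L * h * (n.+1%:R / n.+2%:R) + 32 * eta * n.+1%:R * L ^+ 2.
Proof.
move=> L0 lf cf h0 e0 sx su.
pose F v := f (x + h *: v).
have K0 : 0 <= L * h by rewrite mulr_ge0// ltW.
have lF : l1lip (L * h) F.
  move=> v w; rewrite (le_trans (lf _ _))//.
  have -> : x + h *: v - (x + h *: w) = h *: (v - w).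
    by rewrite opprD addrACA subrr add0r scalerBr.
  by rewrite l1normZ gtr0_norm// mulrA.
have cF : segment_convex F.
  move=> v w t t01; rewrite /F scalerDr addrA scalerA mulrC -scalerA (le_trans (cf _ _ _ t01))//.
  by rewrite [h *: (v + w)]scalerDr addrA.
pose w := h^-1 *: (u - x).
have hn : h != 0 by rewrite gt_eqF.
have SG := sphere_gradient w K0 lF cF.
have SQ := sphere_mean_odd_sqr K0 lF.
have Fw : F w = f u by rewrite /F /w scalerA mulfV// scale1r subrKC.
have F0 : F 0 = f x by rewrite /F scaler0 addr0.
pose q := diff_quotient f h x.
have mF := l1lip_measurable K0 lF.
have mFN : measurable_fun setT (fun v : 'rV[R]_n.+1 => F (- v)).
  exact: (measurableT_comp mF (@measurable_oppV R n.+1)).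
have bF := bdd_sphere_lip lF.
have bFN : bdd_sphere (fun v => F (- v)).
  by have [M FM] := bF; exists M => v v1; apply: FM; rewrite l1normN.
pose D v := F v - F (- v).
have mD : measurable_fun setT D by exact: measurable_funB.
have bD : bdd_sphere D.
  have [M FM] := bF; exists (M + M) => v v1.
  by rewrite (le_trans (ler_normB _ _))// lerD ?FM// l1normN.
have qE v : q v = n.+1%:R / (2 * h) * D v by rewrite /q /diff_quotient /D /F scalerN.
have mdw : measurable_fun setT (fun v => dotp (sign_rV v) w).
  exact: measurable_dotp_sign.
have bdw : bdd_sphere (fun v => dotp (sign_rV v) w).
  by exists (l1norm w) => v _; exact: dotp_sign_le.
have mwD : measurable_fun setT (fun v => dotp (sign_rV v) w * D v) by exact: measurable_funM.
have bwD : bdd_sphere (fun v => dotp (sign_rV v) w * D v) by exact: bdd_sphereM.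
have mD2 : measurable_fun setT (fun v => D v ^+ 2) by exact: measurable_funX.
have bD2 : bdd_sphere (fun v => D v ^+ 2) by under eq_fun do rewrite expr2; exact: bdd_sphereM.
have -> : excess f h eta u x = fun v => (f x - f u + n.+1%:R / 2 * (dotp (sign_rV v) w * D v))
    + (4 * eta * (n.+1%:R / (2 * h)) ^+ 2) * D v ^+ 2.
  apply/funext => v; rewrite /excess -/(q v) qE dotpZl.
  have -> : x - u = (- h) *: w.
    by rewrite /w scaleNr scalerA mulfV// scale1r opprB.
  by rewrite dotpZr exprMn; field.
rewrite sphere_meanD; last 4 first.
- by apply: measurable_funD => //; exact: measurable_funM.
- exact: measurable_funM.
- by apply: bdd_sphereD; [exact: bdd_sphere_cst|apply: bdd_sphereM => //; exact: bdd_sphere_cst].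
- by apply: bdd_sphereM => //; exact: bdd_sphere_cst.
rewrite sphere_meanD//; last 3 first.
- exact: measurable_funM.
- exact: bdd_sphere_cst.
- by apply: bdd_sphereM => //; exact: bdd_sphere_cst.
rewrite sphere_mean_cst !sphere_meanZ// lerD//.
  have : n.+1%:R / 2 * sphere_mean (fun v => dotp (sign_rV v) w * D v) <=
    F w - F 0 + L * h * (n.+1%:R / n.+2%:R) := SG.
  rewrite Fw F0; move: (_ * sphere_mean _) (L * h * _) => s k; clear; lra.
apply: (@le_trans _ _ (4 * eta * (n.+1%:R / (2 * h)) ^+ 2 * (32 * (L * h) ^+ 2 / n.+2%:R))).
  apply: ler_wpM2l => //; apply: mulr_ge0; last exact: sqr_ge0.
  by rewrite mulr_ge0.
have a0 : 0 < n.+1%:R :> R by rewrite ltr0n.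
have b0 : 0 < n.+2%:R :> R by rewrite ltr0n.
have ab : n.+1%:R <= n.+2%:R :> R by rewrite ler_nat.
have -> : 4 * eta * (n.+1%:R / (2 * h)) ^+ 2 * (32 * (L * h) ^+ 2 / n.+2%:R) =
  32 * eta * n.+1%:R * L ^+ 2 * (n.+1%:R / n.+2%:R).
  by move: (n.+1%:R : R) (n.+2%:R : R) a0 b0 => a b a0 b0; field; rewrite hn gt_eqF.
rewrite ler_piMr//; last by rewrite ler_pdivrMr// mul1r.
by apply: mulr_ge0; [rewrite !mulr_ge0|exact: sqr_ge0].
Qed.

End round.

(** * Numerical constants *)

Section constants.
Context {R : realType}.

Lemma sqrt_sum_bounds : (59 / 10 <= Num.sqrt 6 + Num.sqrt 12 :> R) /\ (Num.sqrt 6 + Num.sqrt 12 <= 592 / 100 :> R).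
Proof.
have lo (a b : R) : 0 <= a -> a ^+ 2 <= b -> a <= Num.sqrt b.
  by move=> a0 h; rewrite -(ger0_norm a0) -sqrtr_sqr ler_wsqrtr.
have hi (a b : R) : 0 <= a -> b <= a ^+ 2 -> Num.sqrt b <= a.
  by move=> a0 h; rewrite -[leRHS](ger0_norm a0) -sqrtr_sqr ler_wsqrtr.
have h1 : 244 / 100 <= Num.sqrt (6 : R) by apply: lo; rewrite ?expr2; lra.
have h2 : 346 / 100 <= Num.sqrt (12 : R) by apply: lo; rewrite ?expr2; lra.
have h3 : Num.sqrt (6 : R) <= 245 / 100 by apply: hi; rewrite ?expr2; lra.
have h4 : Num.sqrt (12 : R) <= 347 / 100 by apply: hi; rewrite ?expr2; lra.
split; lra.
Qed.

(** With [s = sqrt 6 + sqrt 12] and [Q = L sqrt (d T ln d)], the three terms are at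
most [7/100 Q], [32 / s Q] and [s Q], and [s] lies between 5.9 and 5.92. *)
Lemma regret_constant (n T : nat) (L eta h : R) :
  (2 <= n)%N -> (1 <= T)%N -> 0 < L ->
  eta = Num.sqrt (ln n.+1%:R) / ((Num.sqrt 6 + Num.sqrt 12) * L)
        * Num.sqrt (1 / (n.+1%:R * T%:R)) ->
  0 < h ->
  h <= 7 * Num.sqrt (ln n.+1%:R) / (100 * (n.+1%:R / (n.+1%:R + 1)) * Num.sqrt T%:R)
       * Num.sqrt n.+1%:R ->
  0 < eta /\
  T%:R * (L * h * (n.+1%:R / n.+2%:R) + 32 * eta * n.+1%:R * L ^+ 2) + ln n.+1%:R / eta
    <= 119 / 10 * L * Num.sqrt (n.+1%:R * T%:R * ln n.+1%:R).
Proof.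
move=> n2 T1 L0; have [s1 s2] := sqrt_sum_bounds.
move: (Num.sqrt 6 + Num.sqrt 12) s1 s2 => s s1 s2.
have l0 : 0 < ln n.+1%:R :> R by rewrite ln_gt0// ltr1n ltnS ltnW.
have d0 : 0 < n.+1%:R :> R by rewrite ltr0n.
have t0 : 0 < T%:R :> R by rewrite ltr0n.
have dE : n.+2%:R = n.+1%:R + 1 :> R by rewrite -natr1.
rewrite dE; move: (n.+1%:R : R) (T%:R : R) d0 t0 l0 => d t d0 t0.
move: (ln d) => l l0.
have s0 : 0 < s by lra.
have dt0 : 0 <= d * t by rewrite mulr_ge0 ?ltW.
rewrite div1r sqrtrV// (sqrtrM l dt0) (sqrtrM t (ltW d0)).
have : 0 < Num.sqrt l by rewrite sqrtr_gt0.
have : 0 < Num.sqrt t by rewrite sqrtr_gt0.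
have : 0 < Num.sqrt d by rewrite sqrtr_gt0.
have := sqr_sqrtr (ltW l0); have := sqr_sqrtr (ltW t0); have := sqr_sqrtr (ltW d0).
move: (Num.sqrt l) (Num.sqrt t) (Num.sqrt d) => r p q qE pE rE q0 p0 r0.
move=> etaE h0 hh.
have eta0 : 0 < eta by rewrite etaE mulr_gt0 ?divr_gt0 ?invr_gt0 ?mulr_gt0.
split => //.
have A1 : l / eta = s * (L * (r * p * q)).
  by rewrite etaE -rE; field; rewrite !gt_eqF.
have A2 : t * (32 * eta * d * L ^+ 2) = 32 / s * (L * (r * p * q)).
  by rewrite etaE -pE -qE; field; rewrite !gt_eqF.
have A3 : t * (L * h * (d / (d + 1))) <= 7 / 100 * (L * (r * p * q)).
  have dd : 0 < d + 1 by lra.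
  have c0 : 0 <= t * (L * (d / (d + 1))) by rewrite ltW// !mulr_gt0 ?invr_gt0.
  have := ler_wpM2l c0 hh.
  have -> : t * (L * (d / (d + 1))) * (7 * r / (100 * (d / (d + 1)) * p) * q) = 7 / 100 * (L * (r * p * q)).
    by rewrite -pE; field; rewrite !gt_eqF.
  by rewrite [t * (L * h * _)](_ : _ = t * (L * (d / (d + 1))) * h)//; ring.
have B : 32 / s <= 5424 / 1000 by rewrite ler_pdivrMr//; lra.
have X0 : 0 <= L * (r * p * q) by rewrite ltW// !mulr_gt0.
rewrite mulrDr A1 A2 (_ : 119 / 10 * L * _ = 119 / 10 * (L * (r * p * q))); last by ring.
have := ler_wpM2r X0 B; have := ler_wpM2r X0 s2; move: A3.
move: (L * (r * p * q)) X0 => X X0; lra.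
Qed.

End constants.

(** * The expected regret *)

Section regret.
Local Open Scope ereal_scope.
Context (R : realType) (disp : measure_display) (Omega : measurableType disp)
  (P : probability Omega R) (n T : nat) (L eta h : R) (f : nat -> 'rV[R]_n.+1 -> R)
  (zeta : nat -> {RV P >-> 'rV[R]_n.+1}) (u : 'rV[R]_n.+1).
Hypotheses (L0 : (0 <= L)%R) (eta0 : (0 < eta)%R) (h0 : (0 < h)%R).
Hypothesis cf : forall t, (1 <= t)%N -> segment_convex (f t).
Hypothesis lf : forall t, (1 <= t)%N -> l1lip L (f t).
Hypothesis unif : forall t, (1 <= t)%N -> uniform_l1sphere (distribution P (zeta t)).
Hypothesis indep : mutually_independent [set t | (1 <= t)%N] zeta.
Hypothesis su : simplex u.

(** The update without noise; it coincides almost surely with that of the algorithm. *)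
Definition state_update (k : nat) (p : 'rV[R]_n.+1 * 'rV[R]_n.+1) : 'rV[R]_n.+1 :=
  (p.1 - diff_quotient (f k.+1) h (softmax eta p.1) p.2 *: sign_rV p.2)%R.

Lemma measurable_state_update k : measurable_fun setT (state_update k).
Proof.
have mq : measurable_fun setT (fun p : 'rV[R]_n.+1 * 'rV[R]_n.+1 =>
    diff_quotient (f k.+1) h (softmax eta p.1) p.2).
  apply: (measurable_diff_quotient h L0 (lf (ltn0Sn k))); last exact: measurable_snd.
  exact: (measurableT_comp (measurable_softmax eta) measurable_fst).
apply: measurable_fun_addrV; first exact: measurable_fst.
rewrite (_ : (fun t0 => _) = fun p : 'rV[R]_n.+1 * 'rV[R]_n.+1 =>
    ((- diff_quotient (f k.+1) h (softmax eta p.1) p.2) *: sign_rV p.2)%R); last first.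
  by apply/funext => p; rewrite scaleNr.
apply: measurable_fun_scalerV; first by apply: measurableT_comp => //; exact: mq.
exact: (measurableT_comp (@measurable_sign_rV R n) measurable_snd).
Qed.

Definition clean_state (k : nat) (w : Omega) : 'rV[R]_n.+1 :=
  past (0%R : 'rV[R]_n.+1) state_update zeta k w.

Lemma measurable_clean_state k : measurable_fun setT (clean_state k).
Proof. exact: (measurable_past _ _ measurable_state_update). Qed.

Local Notation B := (excess_cap n L eta).
Local Notation b := (L * h * (n.+1%:R / n.+2%:R) + 32 * eta * n.+1%:R * L ^+ 2)%R.

Let B0 : (0 <= B)%R.
Proof.
rewrite /excess_cap !addr_ge0 ?mulr_ge0 ?ler0n ?(ltW eta0)//; exact: sqr_ge0.
Qed.

(** The excess is bounded on the sphere only, which carries the law of the samples;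
the value 0 elsewhere and the shift make it a nonnegative integrand everywhere. *)
Definition shifted_excess (k : nat) (p : 'rV[R]_n.+1 * 'rV[R]_n.+1) : \bar R :=
  (if l1norm p.2 == 1%R then excess (f k.+1) h eta u (softmax eta p.1) p.2 + B else 0)%:E.

Lemma measurable_shifted_excess k : measurable_fun setT (shifted_excess k).
Proof.
apply/measurable_EFinP; apply: measurable_fun_ifT => //.
  apply: measurable_fun_eqr => //.
  exact: (measurableT_comp (@measurable_l1norm R n.+1) measurable_snd).
apply: measurable_funD => //.
apply: (measurable_excess h L0 (lf (ltn0Sn k))); last exact: measurable_snd.
exact: (measurableT_comp (measurable_softmax eta) measurable_fst).
Qed.

Lemma shifted_ge0 k p : 0 <= shifted_excess k p.
Proof.
rewrite /shifted_excess lee_fin; case: ifPn => // /eqP v1.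
have := excess_bound L0 (lf (ltn0Sn k)) h0 (ltW eta0) (softmax_simplex eta p.1) su v1.
by rewrite ler_norml => /andP[h1 _]; rewrite -lerBlDr sub0r.
Qed.

(** Conditionally on the past, [excess_mean] applies. *)
Lemma shifted_mean k : \int[P]_w shifted_excess k (clean_state k w, zeta k.+1 w) <= (b + B)%:E.
Proof.
have sg := shifted_ge0.
apply: (@past_integral_le _ _ _ _ _ _ _ _ _ state_update) => //; first exact: measurable_state_update.
  exact: measurable_shifted_excess.
move=> y.
have lk := lf (ltn0Sn k).
rewrite (eq_measure_integral (@unif_sphere R n)); last first.
  by move=> A mA _; exact: (uniform_l1sphere_unif (unif (ltn0Sn k)) mA).
have ms : measurable_fun setT (fun v => shifted_excess k (y, v)).
  by apply: (measurableT_comp (measurable_shifted_excess k)); exact: measurable_fun_pair.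
rewrite integral_on_sphere//.
have mex : measurable_fun setT (excess (f k.+1) h eta u (softmax eta y)).
  exact: (measurable_excess h L0 lk).
have bex : bdd_sphere (excess (f k.+1) h eta u (softmax eta y)).
  exists B => v v1; apply: (excess_bound L0 lk) => //; first exact: ltW.
  exact: softmax_simplex.
rewrite (_ : integral _ _ _ = (sphere_mean (fun v => excess (f k.+1) h eta u (softmax eta y) v + B)%R)%:E).
  rewrite lee_fin sphere_meanD//; last exact: bdd_sphere_cst.
  rewrite sphere_mean_cst lerD2r; apply: excess_mean => //; [exact: cf|exact: ltW|exact: softmax_simplex].
rewrite /sphere_mean /Rintegral fineK; last first.
  apply: integrable_fin_num; first exact: measurable_sphere.
  apply: bdd_sphere_integrable; first exact: measurable_funD.
  by apply: bdd_sphereD => //; exact: bdd_sphere_cst.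
by apply: eq_integral => v; rewrite inE /l1sphere/= => v1; rewrite /shifted_excess /= v1 eqxx.
Qed.

Lemma zeta_sphere t : (1 <= t)%N -> {ae P, forall w, l1norm (zeta t w) = 1%R}.
Proof.
move=> t1; exists (zeta t @^-1` (~` @l1sphere R n.+1)); split.
- rewrite -[X in measurable X]setTI; apply: measurable_funPT => //.
  by apply: measurableC; exact: measurable_sphere.
- have := @uniform_l1sphere_unif R n _ (unif t1) (~` @l1sphere R n.+1).
  rewrite unif_sphereC; apply; apply: measurableC; exact: measurable_sphere.
- by move=> w /=.
Qed.

(** On a trajectory that stays on the sphere, the regret is the sum of the excesses
plus a remainder to which [exponential_weights_regret] applies. *)
Lemma clean_regret w : (forall t, (1 <= t)%N -> l1norm (zeta t w) = 1%R) ->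
  ((\sum_(1 <= t < T.+1) (f t (softmax eta (clean_state t.-1 w)) - f t u) + T%:R * B)%:E <=
   \sum_(k < T) shifted_excess k (clean_state k w, zeta k.+1 w) + (ln n.+1%:R / eta)%:E).
Proof.
move=> z1.
pose z t := clean_state t.-1 w.
pose c t := diff_quotient (f t) h (softmax eta (z t)) (zeta t w).
have zS t : (1 <= t)%N -> z t.+1 = (z t - c t *: sign_rV (zeta t w))%R by case: t.
have s1 t (j : 'I_n.+1) : (sign_rV (zeta t w) ord0 j ^+ 2 = 1)%R.
  by rewrite mxE; case: ifP => _; rewrite ?sqrrN expr1n.
have := @exponential_weights_regret R n eta z (fun t => sign_rV (zeta t w)) c T u eta0 erefl zS s1 su.
rewrite !big_add1 /= !big_mkord => EW.
rewrite (eq_bigr (fun k : 'I_T => (excess (f k.+1) h eta u (softmax eta (z k.+1)) (zeta k.+1 w) + B)%:E)); last first.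
  by move=> k _; rewrite /shifted_excess z1//= eqxx.
rewrite sumEFin -EFinD lee_fin -lerBlDl (le_trans _ EW)//.
have -> : (T%:R * B = \sum_(k < T) B)%R by rewrite sumr_const card_ord mulr_natl.
rewrite -big_split -sumrB/=.
by apply: ler_sum => k _; rewrite /excess -/(c k.+1) /z /=; lra.
Qed.

(** The states [y] may differ from the noiseless ones on a null set, as those of the
algorithm do. *)
Theorem regret_bound (y : nat -> Omega -> 'rV[R]_n.+1) :
  (forall t, (1 <= t)%N -> measurable_fun setT (y t)) ->
  {ae P, forall w, forall t, (1 <= t)%N -> y t w = clean_state t.-1 w} ->
  'E_P[fun w => (\sum_(1 <= t < T.+1) (f t (softmax eta (y t w)) - f t u))%R] <=
  (T%:R * b + ln n.+1%:R / eta)%:E.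
Proof.
move=> my yE; rewrite unlock; have sg := shifted_ge0.
pose D w := (\sum_(1 <= t < T.+1) (f t (softmax eta (y t w)) - f t u))%R.
have DE w : D w = (\sum_(k < T) (f k.+1 (softmax eta (y k.+1 w)) - f k.+1 u))%R.
  by rewrite /D big_add1 /= big_mkord.
have mD : measurable_fun setT D.
  rewrite (funext DE); apply: measurable_sum => k; apply: measurable_funB => //.
  apply: (measurableT_comp (l1lip_measurable L0 (lf (ltn0Sn k)))).
  by apply: (measurableT_comp (measurable_softmax eta)); exact: my.
have DB w : (`|D w| <= T%:R * B)%R.
  rewrite DE (le_trans (ler_norm_sum _ _ _))//.
  rewrite [leRHS](_ : _ = \sum_(k < T) B)%R; last by rewrite sumr_const card_ord mulr_natl.
  apply: ler_sum => k _; rewrite (le_trans (lf (ltn0Sn k) _ _))//.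
  apply: (@le_trans _ _ (L * 2)%R).
    by rewrite ler_wpM2l// simplex_dist//; exact: softmax_simplex.
  rewrite /excess_cap -addrA lerDl addr_ge0 ?mulr_ge0 ?ler0n ?(ltW eta0)//; exact: sqr_ge0.
have TB0 : (0 <= T%:R * B)%R by rewrite mulr_ge0.
have iD : P.-integrable setT (EFin \o D).
  apply: (@le_integrable _ _ _ _ _ measurableT _ (cst (T%:R * B)%:E)).
  - exact/measurable_EFinP.
  - by move=> w _ /=; rewrite lee_fin (le_trans (DB w))// ler_norm.
  - exact: finite_measure_integrable_cst.
have ic : P.-integrable setT (EFin \o cst (T%:R * B)%R) by exact: finite_measure_integrable_cst.
(* After adding [T * B], both sides are integrals of nonnegative functions. *)
rewrite -(@leeD2rE _ (T%:R * B)%:E)//.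
have -> : \int[P]_w (D w)%:E + (T%:R * B)%:E = \int[P]_w (D w + T%:R * B)%:E.
  rewrite (integralD_EFin measurableT iD ic); congr (_ + _).
  transitivity (\int[P]_w cst (T%:R * B)%:E w) => //.
  by rewrite integral_cst// [X in _ * X](@probability_setT _ _ _ P) mule1.
have mcs k : measurable_fun setT (fun w => shifted_excess k (clean_state k w, zeta k.+1 w)).
  apply: (measurableT_comp (measurable_shifted_excess k)); apply: measurable_fun_pair => //.
  exact: measurable_clean_state.
have lnd0 : (0 <= ln n.+1%:R / eta)%R.
  by rewrite divr_ge0 ?(ltW eta0)// ln_ge0// ler1n.
apply: (@le_trans _ _ (\int[P]_w
   (\sum_(k < T) shifted_excess k (clean_state k w, zeta k.+1 w) + (ln n.+1%:R / eta)%:E))).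
  apply: ae_ge0_le_integral => //.
  - by move=> w _; rewrite lee_fin; have := DB w; rewrite ler_norml => /andP[]; lra.
  - by apply/measurable_EFinP; exact: measurable_funD.
  - by move=> w _; apply: adde_ge0; [by apply: sume_ge0 => k _; exact: shifted_ge0|rewrite lee_fin].
  - by apply: emeasurable_funD => //; exact: emeasurable_sum.
  have zS : {ae P, forall w, forall t, (1 <= t)%N -> l1norm (zeta t w) = 1%R}.
    apply: (ae_foralln (P := fun t w => (1 <= t)%N -> l1norm (zeta t w) = 1%R)) => -[|t].
      by apply/aeW => w.
    by apply: filterS (zeta_sphere (ltn0Sn t)) => w.
  near=> w => _.
  have zw : forall t, (1 <= t)%N -> l1norm (zeta t w) = 1%R by near: w.
  have yw : forall t, (1 <= t)%N -> y t w = clean_state t.-1 w by near: w.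
  apply: le_trans (clean_regret zw); rewrite lee_fin lerD2r /D.
  rewrite le_eqVlt; apply/orP; left; apply/eqP; apply: eq_big_nat => t /andP[t1 _].
  by rewrite yw.
rewrite ge0_integralD//; last 2 first.
- by move=> w _; apply: sume_ge0 => k _; exact: shifted_ge0.
- exact: emeasurable_sum.
rewrite ge0_integral_sum//.
rewrite integral_cst// [X in _ + _ * X](@probability_setT _ _ _ P) mule1.
apply: (@le_trans _ _ (\sum_(k < T) (b + B)%:E + (ln n.+1%:R / eta)%:E)).
  by rewrite leeD2r//; apply: lee_sum => k _; exact: shifted_mean.
rewrite sumEFin sumr_const card_ord -EFinD -EFinD lee_fin.
by rewrite -[((_ + _) *+ T)%R]mulr_natl mulrDr addrAC.
Unshelve. all: by end_near. Qed.

End regret.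

Theorem corollary2 (R : realType) (disp : measure_display)
    (Omega : measurableType disp) (P : probability Omega R)
    (d T : nat) (L eta h : R)
    (f : nat -> 'rV[R]_d -> R)
    (zeta : nat -> {RV P >-> 'rV[R]_d})
    (xi' xi'' : nat -> {RV P >-> R})
    (z x : nat -> Omega -> 'rV[R]_d) :
  (3 <= d)%N -> (1 <= T)%N -> 0 < L ->
  (forall t, (1 <= t)%N -> convex_function [set: 'rV[R]_d] (f t)) ->
  (forall t, (1 <= t)%N ->
     forall u v : 'rV[R]_d, `|f t u - f t v| <= L * l1norm (u - v)) ->
  (forall t, (1 <= t)%N -> uniform_l1sphere (distribution P (zeta t))) ->
  mutually_independent [set t | (1 <= t)%N] zeta ->
  (forall t, (1 <= t)%N -> {ae P, forall w, xi' t w = xi'' t w}) ->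
  eta = Num.sqrt (ln d%:R) / ((Num.sqrt 6 + Num.sqrt 12) * L)
        * Num.sqrt (1 / (d%:R * T%:R)) ->
  0 < h ->
  h <= 7 * Num.sqrt (ln d%:R) / (100 * (d%:R / (d%:R + 1)) * Num.sqrt T%:R)
       * Num.sqrt d%:R ->
  (forall w, dual_averaging_run (@simplex R d) (@negentropy R d)
     (fun=> eta) (fun=> h) f (fun t => zeta t w)
     (fun t => xi' t w) (fun t => xi'' t w)
     (fun t => z t w) (fun t => x t w)) ->
  forall u : 'rV[R]_d, @simplex R d u ->
    ('E_P[fun w => (\sum_(1 <= t < T.+1) (f t (x t w) - f t u))%R]
      <= (119 / 10 * L * Num.sqrt (d%:R * T%:R * ln d%:R))%:E)%E.
Proof.
case: d f zeta z x => [//|n] f zeta z x n2 T1 L0 cf lf unif indep noise etaE h0 hh run u su.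
have [eta0 const] := regret_constant n2 T1 L0 etaE h0 hh.
have xE t w : (1 <= t)%N -> x t w = softmax eta (z t w).
  by move=> t1; apply: argmax_softmax; have [_ /(_ t t1)[]] := run w.
have zS t w : (1 <= t)%N -> z t.+1 w =
    z t w - grad_estimate (f t) h (softmax eta (z t w)) (zeta t w) (xi' t w) (xi'' t w).
  by move=> t1; rewrite -xE//; have [_ /(_ t t1)[]] := run w.
have z1 w : z 1%N w = 0 by have [] := run w.
have mz t : (1 <= t)%N -> measurable_fun setT (z t).
  case: t => // t _; elim: t => [|t IH].
    by rewrite (_ : z 1%N = cst 0)//; apply/funext.
  rewrite (_ : z t.+2 = fun w => z t.+1 w + (-1) *: grad_estimate (f t.+1) h (softmax eta (z t.+1 w))
     (zeta t.+1 w) (xi' t.+1 w) (xi'' t.+1 w)); last first.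
    by apply/funext => w; rewrite zS// scaleN1r.
  apply: measurable_fun_addrV => //; apply: measurable_fun_scalerV => //.
  apply: (measurable_grad_estimate h (ltW L0) (lf t.+1 (ltn0Sn t))) => //.
  exact: (measurableT_comp (measurable_softmax eta)).
have zE : {ae P, forall w, forall t, (1 <= t)%N -> z t w = clean_state eta h f zeta t.-1 w}.
  have nz : {ae P, forall w, forall t, (1 <= t)%N -> xi' t w = xi'' t w}.
    apply: (ae_foralln (P := fun t w => (1 <= t)%N -> xi' t w = xi'' t w)) => -[|t].
      by apply/aeW => w.
    by apply: filterS (noise t.+1 (ltn0Sn t)) => w.
  apply: filterS nz => w nw -[//|t] _; elim: t => [|t IH]; first exact: z1.
  by rewrite zS// nw// grad_estimateE IH.
have cs t (t1 : (1 <= t)%N) := convex_segment (cf t t1).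
have := regret_bound T (ltW L0) eta0 h0 cs lf unif indep su mz zE.
rewrite (_ : (fun w => _) = (fun w => \sum_(1 <= t < T.+1) (f t (x t w) - f t u))); last first.
  by apply/funext => w; apply: eq_big_nat => t /andP[t1 _]; rewrite xE.
by move=> h1; apply: (le_trans h1); rewrite lee_fin.
Qed.
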